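(* Let $p\in[3,5)$ and let $g\in L^\infty(\mathbb{R}^3)$ satisfy: $g\geqslant 0$; the set $\Omega_0=\{x\in\mathbb{R}^3:g(x)=0\}$ is bounded and has nonempty interior; and $\liminf_{|x|\to\infty}g(x)=1$. Let $M_0,M_1,M$, $\alpha$, $c_\lambda$ and $\mu_2(\lambda)=\max\{0,M_0(\lambda)^{p-1}-1\}$ be as provided by the existence property (E2) in the context. Fix $\mu$ with $\mu>\mu_2(\lambda)$ for all sufficiently small $\lambda>0$, and for each such $\lambda$ let $u_\lambda\in\mathscr{D}_V$ denote the solution of the system $$-\Delta u+(1+\mu g(x))u+\lambda\phi u=|u|^{p-1}u,\qquad -\Delta\phi=u^2,\qquad \lim_{|x|\to\infty}\phi(x)=0\qquad (x\in\mathbb{R}^3)$$ provided by (E2). Then there exists a weak solution $u_0\in\mathscr{D}_V\setminus\{0\}$ of $$-\Delta u+(1+\mu g(x))u=|u|^{p-1}u\quad\text{in }\mathbb{R}^3$$ (the case $\lambda=0$) such that, along a subsequence, $$u_\lambda\to u_0\quad\text{strongly in }\mathscr{D}_V\ \text{ as }\lambda\to0.$$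
   Context: $\lambda,\mu$ are positive parameters and $V_\mu(x)=1+\mu g(x)$. $|\cdot|_q$ denotes the $L^q(\mathbb{R}^3)$ norm. $\mathscr{D}^{1,2}(\mathbb{R}^3)$ is the completion of $C_0^\infty(\mathbb{R}^3)$ in the norm $|\nabla u|_2$. $\mathscr{D}_V=\{u\in\mathscr{D}^{1,2}(\mathbb{R}^3):\int_{\mathbb{R}^3}V_\mu u^2dx<\infty\}$ is a Hilbert space with norm $\|u\|_{\mathscr{D}_V}^2=\int_{\mathbb{R}^3}|\nabla u|^2+V_\mu(x)u^2\,dx$ (equivalent to the $H^1(\mathbb{R}^3)$ norm). For $u\in\mathscr{D}_V$, $\phi_u$ is the unique solution in $\mathscr{D}^{1,2}(\mathbb{R}^3)$ of $-\Delta\phi=u^2$, and $$I(u)=I_\lambda(u)=\frac12\int_{\mathbb{R}^3}|\nabla u|^2+V_\mu(x)u^2\,dx+\frac{\lambda}{4}\int_{\mathbb{R}^3}\phi_u u^2\,dx-\frac1{p+1}\int_{\mathbb{R}^3}|u|^{p+1}dx .$$ $I\in C^1(\mathscr{D}_V,\mathbb{R})$ with $I'(u)\varphi=\int\nabla u\nabla\varphi+V_\mu u\varphi\,dx+\lambda\int\phi_u u\varphi\,dx-\int|u|^{p-1}u\varphi\,dx$. A (weak) solution of the system is $u\in\mathscr{D}_V$ (with $\phi=\phi_u$) such that $I'(u)\varphi=0$ for all $\varphi\in\mathscr{D}_V$; it is nontrivial if $u\not\equiv0$. For $\lambda=0$ a weak solution is $u\in\mathscr{D}_V$ with $\int\nabla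 u\nabla\varphi+V_\mu u\varphi\,dx=\int|u|^{p-1}u\varphi\,dx$ for all $\varphi\in\mathscr{D}_V$. (E2) For every $\lambda>0$ there are positive constants $M_0(\lambda),M_1(\lambda),M(\lambda)$, independent of $\mu$ and nondecreasing in $\lambda$, a constant $\alpha>0$ independent of $\lambda$ and $\mu$, and a constant $c_\lambda>0$ independent of $\mu$, such that for every $\mu>\mu_2(\lambda)=\max\{0,M_0(\lambda)^{p-1}-1\}$ the system has a nontrivial weak solution $(u,\phi)=(u,\phi_u)\in\mathscr{D}_V\times\mathscr{D}^{1,2}(\mathbb{R}^3)$ with $|u|\leqslant M_0(\lambda)$ and $0<\phi\leqslant M_1(\lambda)$ a.e. in $\mathbb{R}^3$, $\|u\|_{\mathscr{D}_V}+|\nabla\phi|_2\leqslant M(\lambda)$, and $I_\lambda(u)\in[\alpha,c_\lambda]$. ''The solution provided by (E2)'' means a solution with these properties. *)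

(* Defs.v *)
From HB Require Import structures.
From mathcomp Require Import all_boot all_order all_algebra.
From mathcomp Require Import all_classical all_reals all_analysis.
Import Order.TTheory GRing.Theory Num.Theory.
Import numFieldNormedType.Exports.

Set Implicit Arguments.
Unset Strict Implicit.
Unset Printing Implicit Defensive.

Local Open Scope classical_set_scope.
Local Open Scope ring_scope.

Notation R3 R :=
  (measurableTypeR R * measurableTypeR R * measurableTypeR R)%type.

Definition leb3 (R : realType) : {measure set (R3 R) -> \bar R} :=
  ((@lebesgue_measure R \x @lebesgue_measure R) \x @lebesgue_measure R)%E.

(* The product norm `|x| on R3 R is the sup norm; it is only used through
   notions that are the same for the Euclidean norm. *)
Definition at_infty (R : realType) : set_system (R3 R) :=
  [set A | exists r : R, forall x : R3 R, r < `|x| -> A x].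

Definition basis3 (R : realType) (i : 'I_3) : R3 R :=
  ((i == 0 :> nat)%:R, (i == 1 :> nat)%:R, (i == 2 :> nat)%:R).

Definition partial (R : realType) (i : 'I_3) (f : R3 R -> R) : R3 R -> R :=
  fun x => 'D_(basis3 R i) f x.

Definition partials (R : realType) (s : seq 'I_3) (f : R3 R -> R) :
  R3 R -> R := foldr (@partial R) f s.

Definition smooth (R : realType) (f : R3 R -> R) : Prop :=
  forall s : seq 'I_3, continuous (partials s f) /\
    forall (i : 'I_3) (x : R3 R), derivable (partials s f) x (basis3 R i).

Definition test_function (R : realType) (f : R3 R -> R) : Prop :=
  smooth f /\ compact (closure [set x | f x != 0]).

(* A function together with its gradient; [u.1] is the function and [u.2 i]
   its i-th partial derivative. *)
Notation gfun R := ((R3 R -> R) * ('I_3 -> R3 R -> R))%type.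

(* The completion of the test functions in the norm |grad u|_2. By Sobolev's
   inequality a Cauchy sequence for this norm converges in L^6, which realizes
   the completion as a space of functions: u.1 is the L^6 limit of test
   functions whose gradients converge to u.2 in L^2. In particular u.2 is
   the weak gradient of u.1, determined a.e. by u.1. *)
Definition D12 (R : realType) : set (gfun R) :=
  [set u | [/\ measurable_fun setT u.1,
      forall i, measurable_fun setT (u.2 i) &
      exists f : nat -> R3 R -> R,
      [/\ forall n, test_function (f n),
          'N[leb3 R]_(6%:E) [EFin \o (f n \- u.1)%R]%E @[n --> \oo] --> 0%E &
          forall i, 'N[leb3 R]_(2%:E) [EFin \o (partial i (f n) \- u.2 i)%R]%E
                    @[n --> \oo] --> 0%E]]].

Definition gdot (R : realType) (u v : gfun R) (x : R3 R) : R :=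
  \sum_(i < 3) u.2 i x * v.2 i x.

Definition grad_norm (R : realType) (u : gfun R) : R :=
  Num.sqrt (\int[leb3 R]_x gdot u u x).

Definition Vpot (R : realType) (g : R3 R -> R) (mu : R) (x : R3 R) : R :=
  1 + mu * g x.

Definition DV (R : realType) (g : R3 R -> R) (mu : R) : set (gfun R) :=
  [set u | D12 u /\
    (\int[leb3 R]_x (Vpot g mu x * u.1 x ^+ 2)%:E < +oo)%E].

(* The real-valued integrals below are Lebesgue integrals composed with [fine];
   all of them converge for elements of DV and phi in D12. *)
Definition DV_norm (R : realType) (g : R3 R -> R) (mu : R) (u : gfun R) : R :=
  Num.sqrt (\int[leb3 R]_x (gdot u u x + Vpot g mu x * u.1 x ^+ 2)).

Definition nontrivial (R : realType) (u : gfun R) : Prop :=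
  ~ {ae leb3 R, forall x, u.1 x = 0}.

(* phi = phi_u, the solution in D^{1,2} of - Delta phi = u^2 *)
Definition is_phi (R : realType) (u phi : gfun R) : Prop :=
  D12 phi /\ forall v : gfun R, D12 v ->
    \int[leb3 R]_x gdot phi v x = \int[leb3 R]_x (u.1 x ^+ 2 * v.1 x).

(* I_lambda(u), to be used with phi = phi_u *)
Definition energy (R : realType) (p : R) (g : R3 R -> R) (mu lam : R)
    (u phi : gfun R) : R :=
  2^-1 * (\int[leb3 R]_x (gdot u u x + Vpot g mu x * u.1 x ^+ 2))
  + lam / 4 * (\int[leb3 R]_x (phi.1 x * u.1 x ^+ 2))
  - (p + 1)^-1 * (\int[leb3 R]_x (`|u.1 x| `^ (p + 1))).

(* I_lambda'(u) v, to be used with phi = phi_u *)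
Definition denergy (R : realType) (p : R) (g : R3 R -> R) (mu lam : R)
    (u phi v : gfun R) : R :=
  (\int[leb3 R]_x (gdot u v x + Vpot g mu x * u.1 x * v.1 x))
  + lam * (\int[leb3 R]_x (phi.1 x * u.1 x * v.1 x))
  - (\int[leb3 R]_x (`|u.1 x| `^ (p - 1) * u.1 x * v.1 x)).

Definition weak_solution (R : realType) (p : R) (g : R3 R -> R) (mu lam : R)
    (u phi : gfun R) : Prop :=
  [/\ DV g mu u, is_phi u phi &
      forall v, DV g mu v -> denergy p g mu lam u phi v = 0].

Definition weak_solution0 (R : realType) (p : R) (g : R3 R -> R) (mu : R)
    (u : gfun R) : Prop :=
  DV g mu u /\ forall v, DV g mu v ->
    \int[leb3 R]_x (gdot u v x + Vpot g mu x * u.1 x * v.1 x)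
    = \int[leb3 R]_x (`|u.1 x| `^ (p - 1) * u.1 x * v.1 x).

Definition well (R : realType) (g : R3 R -> R) : Prop :=
  [/\ g \in Lfun (leb3 R) +oo%E,
      forall x, 0 <= g x,
      bounded_set [set x | g x = 0],
      ([set x | g x = 0])° !=set0 &
      limf_einf (EFin \o g) (@at_infty R) = 1%:E].

Definition mu2 (R : realType) (p : R) (M0 : R -> R) (lam : R) : R :=
  Num.max 0 (M0 lam `^ (p - 1) - 1).

(* The properties of the solutions provided by [existence] below. *)
Definition bounded_solution (R : realType) (p : R) (g : R3 R -> R)
    (M0 M1 M : R -> R) (alpha : R) (c : R -> R) (mu lam : R)
    (u : gfun R) : Prop :=
  exists phi : gfun R,
    [/\ weak_solution p g mu lam u phi /\ nontrivial u,
        {ae leb3 R, forall x, `|u.1 x| <= M0 lam},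
        {ae leb3 R, forall x, 0 < phi.1 x <= M1 lam},
        DV_norm g mu u + grad_norm phi <= M lam &
        alpha <= energy p g mu lam u phi <= c lam].

Definition pos_nondecreasing (R : realType) (f : R -> R) : Prop :=
  (forall l, 0 < l -> 0 < f l) /\
  (forall l l', 0 < l -> l <= l' -> f l <= f l').

Definition existence (R : realType) (p : R) (g : R3 R -> R)
    (M0 M1 M : R -> R) (alpha : R) (c : R -> R) : Prop :=
  [/\ pos_nondecreasing M0, pos_nondecreasing M1 /\ pos_nondecreasing M,
      0 < alpha, forall l, 0 < l -> 0 < c l &
      forall lam mu, 0 < lam -> mu2 p M0 lam < mu ->
        exists u, bounded_solution p g M0 M1 M alpha c mu lam u].

(* Main.v *)
Require Import Defs.
From HB Require Import structures.
From mathcomp Require Import all_boot all_order all_algebra.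
From mathcomp Require Import all_classical all_reals all_analysis.
From mathcomp Require Import measurable_realfun ess_sup_inf ring lra.
Import Order.TTheory GRing.Theory Num.Theory.
Import numFieldNormedType.Exports.
Set Implicit Arguments.
Unset Strict Implicit.
Unset Printing Implicit Defensive.
Local Open Scope classical_set_scope.
Local Open Scope ring_scope.

(** The solutions u_lambda, for lambda at most l1 = lbar / 2, satisfy
    |u_lambda| <= K := M0(l1), their potentials are bounded by M1(l1), and they
    are bounded in D_V. On a bounded domain Rellich's theorem would give a
    limit in L^2; on R^3 mass could escape to infinity, and the assumption
    mu > mu2 prevents it: it says that K^(p-1) < 1 + mu. Far from the origin g
    is at least almost 1, so V - |u|^(p-1) is bounded below there by a positive
    constant. Testing the equation with eta^2 u, where eta is a
    cutoff that vanishes at the origin and varies slowly, shows that the L^2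
    mass of u_lambda outside a large cube is uniformly small ([tightness]).

    Inside a cube, Poincare's inequality on small boxes bounds the L^1 norm by
    finitely many averages and a small multiple of the gradient ([tame_cube]).
    Along an ultrafilter of parameters converging to 0 the averages converge,
    and boundedness by K turns L^1 into L^2, so the family u_lambda is Cauchy
    in L^2 ([rellich]).

    Subtracting the equations of u_lambda and u_lambda' and testing with the
    difference bounds their squared distance in D_V by
    p K^(p-1) |u_lambda - u_lambda'|_2^2 + O(lambda + lambda')
    ([cauchy_estimate]): the terms phi_u u carry the small factor lambda, and
    s |-> |s|^(p-1) s is Lipschitz on [-K, K]. The family is therefore Cauchy
    in D_V, and a sequence of parameters tending to 0 gives a sequence of
    solutions that converges quickly ([cauchy_subsequence]). Its limit u0 is an
    element of D_V because L^2 is complete ([L2_complete]) and D^{1,2} is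
    closed under limits ([D12_closed]), and every term of the equation passes
    to the limit ([limit_weak_solution]). Finally u0 is not 0, because
    the energy of a solution is at most K^(p-1) |u|_2^2 ([energy_le]) while it
    stays above alpha.

    An element of D^{1,2} is a limit of test functions in L^6, with gradients
    converging in L^2; inequalities such as Poincare's are proved for test
    functions, where the fundamental theorem of calculus applies along
    coordinate lines, and then transferred by [D12P]. *)


(** * Integrable and square-integrable real functions *)

Section integrable_functions.
Context d (T : measurableType d) (R : realType) (m : {measure set T -> \bar R}).
Implicit Types (f g h : T -> R).

Definition intg f := m.-integrable setT (EFin \o f).

Lemma intg_meas f : intg f -> measurable_fun setT f.
Proof. by move=> /measurable_int /measurable_EFinP. Qed.

Lemma intg_eq f g : f =1 g -> intg f -> intg g.
Proof. by move=> /funext ->. Qed.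

Lemma intgD f g : intg f -> intg g -> intg (fun x => f x + g x).
Proof. exact: integrableD. Qed.

Lemma intgB f g : intg f -> intg g -> intg (fun x => f x - g x).
Proof. exact: integrableB. Qed.

Lemma intgZ k f : intg f -> intg (fun x => k * f x).
Proof. by move=> /(integrableZl measurableT k). Qed.

Lemma intg0 : intg (fun=> 0).
Proof. exact: integrable0. Qed.

Lemma intg_sum (I : Type) (s : seq I) (F : I -> T -> R) :
  (forall i, intg (F i)) -> intg (fun x => \sum_(i <- s) F i x).
Proof.
move=> iF; elim: s => [|i s IH].
  by apply: intg_eq intg0 => x; rewrite big_nil.
by apply: intg_eq (intgD (iF i) IH) => x; rewrite big_cons.
Qed.

Lemma intg_abs f : intg f -> intg (fun x => `|f x|).
Proof. exact: integrable_norm. Qed.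

Lemma le_intg_ae f g : measurable_fun setT f ->
  {ae m, forall x, `|f x| <= g x} -> intg g -> intg f.
Proof.
move=> mf fg ig; have mg := intg_meas ig.
have /integrableP[_ goo] := ig.
apply/integrableP; split; first exact/measurable_EFinP.
apply: le_lt_trans goo; apply: ae_ge0_le_integral => //.
- by do 2 apply: measurableT_comp => //.
- by do 2 apply: measurableT_comp => //.
- by apply: filterS fg => x fgx _; rewrite lee_fin (le_trans fgx)// ler_norm.
Qed.

Lemma le_intg f g : measurable_fun setT f ->
  (forall x, `|f x| <= g x) -> intg g -> intg f.
Proof. by move=> mf fg; apply: le_intg_ae => //; apply: aeW. Qed.

Local Notation Int f := (\int[m]_x f x).

Lemma IntD f g : intg f -> intg g ->
  \int[m]_x (f x + g x) = Int f + Int g.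
Proof. exact: RintegralD. Qed.

Lemma IntB f g : intg f -> intg g ->
  \int[m]_x (f x - g x) = Int f - Int g.
Proof. exact: RintegralB. Qed.

Lemma IntZ k f : intg f -> \int[m]_x (k * f x) = k * Int f.
Proof. exact: RintegralZl. Qed.

Lemma Int_ae f g : measurable_fun setT f -> measurable_fun setT g ->
  {ae m, forall x, f x = g x} -> Int f = Int g.
Proof.
move=> mf mg fg; rewrite /Rintegral; congr fine; apply: ae_eq_integral => //.
- exact/measurable_EFinP.
- exact/measurable_EFinP.
- by apply: filterS fg => x -> _.
Qed.

Lemma le_Int_ae f g : intg f -> intg g ->
  {ae m, forall x, f x <= g x} -> Int f <= Int g.
Proof.
move=> /[dup] /intg_meas mf If /[dup] /intg_meas mg Ig fg.
rewrite -subr_ge0 -IntB// (@Int_ae _ (fun x => Num.max (g x - f x) 0)).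
- by apply: Rintegral_ge0 => x _; rewrite le_max lexx orbT.
- exact: measurable_funB.
- by apply: measurable_maxr => //; exact: measurable_funB.
- by apply: filterS fg => x fgx; rewrite max_l// subr_ge0.
Qed.

Lemma le_Int f g : intg f -> intg g -> (forall x, f x <= g x) ->
  Int f <= Int g.
Proof. by move=> If Ig fg; apply: le_Int_ae => //; apply: aeW. Qed.

Lemma Int_ge0 f : (forall x, 0 <= f x) -> 0 <= Int f.
Proof. by move=> f0; apply: Rintegral_ge0. Qed.

Lemma le_norm_Int f : intg f -> `|Int f| <= \int[m]_x `|f x|.
Proof. exact: le_normr_Rintegral. Qed.

Lemma intgE f : intg f -> (\int[m]_x (f x)%:E = (Int f)%:E)%E.
Proof. by move=> If; rewrite /Rintegral fineK//; exact: integrable_fin_num. Qed.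

Lemma intg_le_fin f e : measurable_fun setT f -> (forall x, 0 <= f x) ->
  (\int[m]_x (f x)%:E <= e%:E)%E -> intg f /\ Int f <= e.
Proof.
move=> mf f0 fe; have If : intg f.
  apply/integrableP; split; first exact/measurable_EFinP.
  apply: le_lt_trans (ltry e); apply: le_trans fe.
  by under eq_integral do rewrite /= ger0_norm//.
by split => //; rewrite -lee_fin -intgE.
Qed.

End integrable_functions.

Section square_integrable.
Context d (T : measurableType d) (R : realType) (m : {measure set T -> \bar R}).
Implicit Types (f g h : T -> R).
Local Notation intg := (intg m).
Local Notation Int f := (\int[m]_x f x).

Definition L2 f := measurable_fun setT f /\ intg (fun x => f x ^+ 2).

Definition sq f : R := \int[m]_x (f x ^+ 2).

Lemma sq_ge0 f : 0 <= sq f.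
Proof. by apply: Int_ge0 => x; rewrite sqr_ge0. Qed.

Lemma le_L2_ae f g : measurable_fun setT f ->
  {ae m, forall x, `|f x| <= `|g x|} -> L2 g -> L2 f.
Proof.
move=> mf fg [mg ig]; split=> //.
apply: le_intg_ae ig; first exact: measurable_funX.
apply: filterS fg => x fgx.
by rewrite ger0_norm ?sqr_ge0// -real_normK ?num_real// -[leRHS]real_normK
  ?num_real// ler_sqr ?nnegrE.
Qed.

Lemma le_L2 f g : measurable_fun setT f ->
  (forall x, `|f x| <= `|g x|) -> L2 g -> L2 f.
Proof. by move=> mf fg; apply: le_L2_ae => //; apply: aeW. Qed.

Lemma L2M f g : L2 f -> L2 g -> intg (fun x => f x * g x).
Proof.
move=> [mf If] [mg Ig]; apply: le_intg (intgD If Ig).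
  exact: measurable_funM.
move=> x; rewrite ler_norml; apply/andP; split; nra.
Qed.

Lemma L2D f g : L2 f -> L2 g -> L2 (fun x => f x + g x).
Proof.
move=> Lf Lg; split; first exact: measurable_funD Lf.1 Lg.1.
apply: intg_eq (intgD (intgD Lf.2 Lg.2) (intgZ 2 (L2M Lf Lg))) => x /=.
ring.
Qed.

Lemma L2Z k f : L2 f -> L2 (fun x => k * f x).
Proof.
move=> Lf; split; first by apply: measurable_funM => //; exact: Lf.1.
by apply: intg_eq (intgZ (k ^+ 2) Lf.2) => x /=; ring.
Qed.

Lemma L2B f g : L2 f -> L2 g -> L2 (fun x => f x - g x).
Proof.
move=> Lf Lg; have [mh Ih] := L2D Lf (L2Z (-1) Lg).
by split; [exact: measurable_funB Lf.1 Lg.1|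
  apply: intg_eq Ih => x /=; ring].
Qed.

Lemma L2_bounded C f g : L2 f -> measurable_fun setT g ->
  {ae m, forall x, `|g x| <= C} -> L2 (fun x => g x * f x).
Proof.
move=> Lf mg gC; apply: (le_L2_ae _ _ (L2Z C Lf)).
  by apply: measurable_funM => //; exact: Lf.1.
apply: filterS gC => x gC; rewrite !normrM ler_wpM2r//.
by rewrite (le_trans gC)// ler_norm.
Qed.

Lemma sqD_le f g : L2 f -> L2 g ->
  sq (fun x => f x + g x) <= 2 * sq f + 2 * sq g.
Proof.
move=> Lf Lg; rewrite /sq -(IntZ _ Lf.2) -(IntZ _ Lg.2).
rewrite -IntD; [|exact: intgZ Lf.2|exact: intgZ Lg.2].
apply: le_Int.
- exact: (L2D Lf Lg).2.
- by apply: intgD; apply: intgZ; [exact: Lf.2|exact: Lg.2].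
- by move=> x; have := sqr_ge0 (f x - g x); nra.
Qed.

(** The quadratic t |-> |f - t g|^2 is nonnegative. When |g| = 0 it is
    affine in t, so its slope must vanish. *)
Lemma cauchy_schwarz f g : L2 f -> L2 g ->
  (\int[m]_x (f x * g x)) ^+ 2 <= sq f * sq g.
Proof.
move=> Lf Lg; set B := \int[m]_x (f x * g x).
have key t : 0 <= sq f - 2 * t * B + t ^+ 2 * sq g.
  have -> : sq f - 2 * t * B + t ^+ 2 * sq g
      = sq (fun x => f x - t * g x).
    rewrite /sq /B -(IntZ _ Lg.2) -(IntZ _ (L2M Lf Lg)).
    rewrite -IntB; [|exact: Lf.2|exact/intgZ/L2M].
    rewrite -IntD; [|exact: intgB Lf.2 (intgZ _ (L2M Lf Lg))|exact: intgZ Lg.2].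
    by apply: eq_Rintegral => x _; ring.
  exact: sq_ge0.
have := sq_ge0 g; rewrite le_eqVlt => /predU1P[g0|g0].
  rewrite -g0 mulr0; have [->|B0] := eqVneq B 0; first by rewrite expr0n.
  have := key ((sq f + 1) / (2 * B)).
  rewrite -g0 mulr0 addr0 [X in X * B](_ : _ = (sq f + 1) / B); last first.
    by field.
  by rewrite divfK// => h; exfalso; lra.
have := key (B / sq g).
have -> : sq f - 2 * (B / sq g) * B + (B / sq g) ^+ 2 * sq g
  = (sq f * sq g - B ^+ 2) / sq g by field; rewrite gt_eqF.
by rewrite pmulr_lge0 ?invr_gt0// subr_ge0.
Qed.

Lemma norm_IntM f g : L2 f -> L2 g ->
  `|\int[m]_x (f x * g x)| <= Num.sqrt (sq f) * Num.sqrt (sq g).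
Proof.
move=> Lf Lg; rewrite -sqrtrM ?sq_ge0// -sqrtr_sqr.
by rewrite ler_wsqrtr// cauchy_schwarz.
Qed.

End square_integrable.

(** * Completeness of L^2 *)

Section L2_completeness.
Context d (T : measurableType d) (R : realType) (m : {measure set T -> \bar R}).
Local Notation sq := (sq m).

Lemma geometric_bound n : \sum_(0 <= k < n) ((2 : R) ^- k) <= 2.
Proof.
suff -> : \sum_(0 <= k < n) ((2 : R) ^- k) = 2 - 2 * 2 ^- n.
  by rewrite gerBl mulr_ge0// invr_ge0 exprn_ge0.
elim: n => [|n IH]; first by rewrite big_geq// expr0 invr1; lra.
rewrite big_nat_recr//= IH exprS invfM.
by rewrite mulrA divff// mul1r; lra.
Qed.

(** Cauchy-Schwarz along a telescoping sum, with weights 2^k: the factor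
    2^-n is what makes the tail of a fast sequence small. *)
Lemma telescope_sq (a : nat -> R) j n :
  (a n - a (n + j)%N) ^+ 2 <=
    2 * 2 ^- n * \sum_(n <= k < n + j) (2 ^+ k * (a k.+1 - a k) ^+ 2).
Proof.
elim: j n => [|j IH] n; first by rewrite addn0 subrr expr0n big_geq// mulr0.
rewrite big_ltn ?addnS ?ltnS ?leq_addr// mulrDr -addSn.
have -> : (2 : R) * 2 ^- n * (2 ^+ n * (a n.+1 - a n) ^+ 2)
    = 2 * (a n.+1 - a n) ^+ 2.
  by field; rewrite expf_neq0.
have := IH n.+1; set s := \sum_(_ <= _ < _) _.
have -> : (2 : R) * 2 ^- n.+1 = 2 ^- n.
  by rewrite exprS invfM mulrA divff// mul1r.
have := sqr_ge0 (a n - a n.+1 - (a n.+1 - a (n.+1 + j)%N)).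
by nra.
Qed.

(** The weighted increments 2^k (f k.+1 - f k)^2 have summable integrals, so
    their sum S is integrable and finite almost everywhere. By [telescope_sq],
    (f n - f m)^2 is at most 2^(1-n) S for m >= n: this gives at once the
    pointwise limit and, by integration, the convergence in L^2. *)
Lemma L2_complete (f : nat -> T -> R) : (forall n, L2 m (f n)) ->
  (forall n, sq (fun x => f n.+1 x - f n x) <= 4 ^- n) ->
  exists g, L2 m g /\ sq (fun x => f n x - g x) @[n --> \oo] --> 0.
Proof.
move=> Lf fast.
pose dd k x := 2 ^+ k * (f k.+1 x - f k x) ^+ 2.
have dd0 k x : 0 <= dd k x by rewrite mulr_ge0 ?sqr_ge0 ?exprn_ge0.
have Idd k : intg m (dd k) by apply: intgZ (L2B (Lf _) (Lf _)).2.
pose S x := (\sum_(0 <= k <oo) (dd k x)%:E)%E.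
have S0 x : (0 <= S x)%E by apply: nneseries_ge0 => k _ _; rewrite lee_fin.
have mdd k : measurable_fun setT (EFin \o dd k).
  exact/measurable_EFinP/(intg_meas (Idd k)).
have mS : measurable_fun setT S.
  by apply: ge0_emeasurable_sum => [k x _ _|k _]; [rewrite lee_fin|exact: mdd].
have intS : (\int[m]_x S x <= 2%:E)%E.
  rewrite /S integral_nneseries//; last by move=> n x _; rewrite lee_fin.
  apply: lime_le.
    by apply: is_cvg_nneseries => n _ _; apply: integral_ge0 => x _; rewrite lee_fin.
  apply: nearW => n; rewrite (eq_bigr (fun k => (\int[m]_x dd k x)%:E)); last first.
    by move=> k _; rewrite intgE.
  rewrite sumEFin lee_fin; apply: le_trans (geometric_bound n).
  apply: ler_sum => k _; rewrite IntZ; last exact: (L2B (Lf _) (Lf _)).2.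
  apply: (@le_trans _ _ (2 ^+ k * 4 ^- k)).
    by rewrite ler_wpM2l ?exprn_ge0// fast.
  have -> : (4 : R) = 2 * 2 by lra.
  by rewrite exprMn invfM mulrA divff ?mul1r ?expf_neq0.
have IS : m.-integrable setT S.
  apply/integrableP; split => //; under eq_integral do rewrite gee0_abs//.
  exact: le_lt_trans intS (ltry _).
pose A := [set x | S x \is a fin_num].
have mA : measurable A.
  by rewrite -[A]setTI; exact: emeasurable_fin_num.
have aeA : {ae m, forall x, A x}.
  by apply: filterS (integrable_ae measurableT IS) => x; apply.
pose s x := fine (S x).
have partial_le x n j : A x ->
    (f n x - f (n + j)%N x) ^+ 2 <= 2 * 2 ^- n * s x.
  move=> Ax; apply: le_trans (telescope_sq (fun k => f k x) j n) _.
  rewrite ler_wpM2l ?mulr_ge0 ?invr_ge0 ?exprn_ge0//.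
  rewrite -lee_fin /s fineK// -sumEFin.
  apply: le_trans (nneseries_lim_ge (n + j) _); last first.
    by move=> k _ _; rewrite lee_fin.
  rewrite [leRHS](big_cat_nat (n := n)) ?leq_addr//= leeDr//.
  by apply: sume_ge0 => k _; rewrite lee_fin.
have s0 x : 0 <= s x by rewrite fine_ge0.
have cv x : A x -> cvgn (fun n => f n x).
  move=> Ax; apply/cauchy_cvgP/cauchy_ballP => e e0.
  have [N Nh] : exists N, forall n, (N <= n)%N -> 2 * 2 ^- n * s x < (e / 2) ^+ 2.
    have : (fun n => 2 * s x * 2 ^- n) n @[n --> \oo] --> 2 * s x * 0.
      apply: cvgM; first exact: cvg_cst.
      under eq_fun do rewrite -exprVn.
      by apply: cvg_expr; rewrite ger0_norm ?invf_lt1 ?ltr1n// invr_ge0.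
    rewrite mulr0 => /cvgrPdist_lt /(_ ((e / 2) ^+ 2)).
    rewrite exprn_gt0 ?divr_gt0// => /(_ isT) [N _ hN]; exists N => n /hN /=.
    by rewrite sub0r normrN => /(le_lt_trans (ler_norm _)); rewrite mulrAC.
  have close n : (N <= n)%N -> `|f N x - f n x| < e / 2.
    move=> Nn; suff : `|f N x - f n x| ^+ 2 < (e / 2) ^+ 2.
      by rewrite ltr_pXn2r// nnegrE// divr_ge0// ltW.
    rewrite real_normK ?num_real//.
    by apply: le_lt_trans (Nh N (leqnn _)); rewrite -(subnKC Nn) partial_le.
  exists ([set a | `|f N x - a| < e / 2], [set a | `|f N x - a| < e / 2]).
    by split; exists N.
  move=> [a b] /= [ha hb]; rewrite /ball /=.
  rewrite (_ : a - b = (f N x - b) - (f N x - a)); last by ring.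
  by rewrite (le_lt_trans (ler_normB _ _))// (splitr e) ltrD.
(* off A the sequence is replaced by 0 to keep the limit measurable *)
pose g x := limn (fun n => (f n \_ A) x).
have gE x : A x -> f n x @[n --> \oo] --> g x.
  move=> Ax; rewrite /g; under [X in limn X]eq_fun do rewrite patchE mem_set//.
  exact: cv.
have mg : measurable_fun setT g.
  apply: (@measurable_fun_cvg _ _ _ _ (fun n => f n \_ A)).
    by move=> n; apply: (measurable_restrictT _ mA).1; apply: measurable_funTS; exact: (Lf n).1.
  move=> x _; have [Ax|nAx] := pselect (A x).
    by under eq_cvg do rewrite patchE mem_set//; exact: gE.
  have fE : (fun n => (f n \_ A) x) = fun=> 0.
    by apply/funext => n; rewrite patchE memNset.
  by rewrite /g fE lim_cst//; exact: cvg_cst.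
have gle x n : A x -> (f n x - g x) ^+ 2 <= 2 * 2 ^- n * s x.
  move=> Ax; have h : (f n x - f (n + j)%N x) ^+ 2 @[j --> \oo] --> (f n x - g x) ^+ 2.
    have c : f n x - f (n + j)%N x @[j --> \oo] --> f n x - g x.
      apply: cvgB; first exact: cvg_cst.
      by have := gE x Ax; rewrite -(cvg_shiftn n); under eq_fun do rewrite addnC.
    by rewrite expr2; under eq_cvg do rewrite expr2; exact: cvgM.
  apply: (cvgr_to_le h).
  by apply: nearW => j; exact: partial_le.
have Is : intg m s.
  have [] // := @intg_le_fin _ _ _ m s 2.
    exact: measurableT_comp.
  apply: le_trans intS; apply: ge0_le_integral => //.
  - by move=> x _; rewrite lee_fin.
  - by apply/measurable_EFinP; exact: measurableT_comp.
  - by move=> x _; rewrite /s; case: (S x) (S0 x) => [r||]//= _; rewrite leey.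
have Lfg n : L2 m (fun x => f n x - g x).
  split; first exact: measurable_funB (Lf n).1 mg.
  apply: (le_intg_ae _ _ (intgZ (2 * 2 ^- n) Is)).
    by apply: measurable_funX; exact: measurable_funB (Lf n).1 mg.
  by apply: filterS aeA => x Ax; rewrite ger0_norm ?sqr_ge0// gle.
exists g; split.
  have [_ h] := L2B (Lf 0%N) (Lfg 0%N); split=> //.
  by apply: intg_eq h => x; congr (_ ^+ 2); ring.
have bound n : sq (fun x => f n x - g x) <= 2 * 2 ^- n * \int[m]_x s x.
  rewrite -IntZ//; apply: le_Int_ae; first exact: (Lfg n).2.
    exact: intgZ.
  by apply: filterS aeA => x Ax; exact: gle.
apply: (@squeeze_cvgr _ _ _ _ (fun=> 0) (fun n => 2 * 2 ^- n * \int[m]_x s x)).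
- by apply: nearW => n; rewrite sq_ge0 bound.
- exact: cvg_cst.
- rewrite -(mul0r (\int[m]_x s x)) -(mulr0 2).
  apply: cvgM; last exact: cvg_cst.
  apply: cvgM; first exact: cvg_cst.
  under eq_fun do rewrite -exprVn.
  by apply: cvg_expr; rewrite ger0_norm ?invf_lt1 ?ltr1n// invr_ge0.
Qed.

End L2_completeness.

(** * Convergence to 0 of Lebesgue norms *)

Section Lnorm_limits.
Local Open Scope ereal_scope.

Lemma cvge0P (R : realType) (a : nat -> \bar R) : (forall n, 0 <= a n) ->
  a n @[n --> \oo] --> 0 <->
  forall e : R, (0 < e)%R -> \forall n \near \oo, a n <= e%:E.
Proof.
move=> a0; split=> [/fine_cvgP[fa /cvgrPdist_le ca] e e0|h].
  apply: filterS2 fa (ca e e0) => n fn /=.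
  rewrite sub0r normrN ger0_norm ?fine_ge0// => le.
  by rewrite -(fineK fn) lee_fin.
apply/fine_cvgP; split.
  apply: filterS (h 1%R ltr01) => n an.
  by rewrite ge0_fin_numE// (le_lt_trans an)// ltry.
apply/cvgrPdist_le => e e0; apply: filterS (h e e0) => n an /=.
rewrite sub0r normrN ger0_norm ?fine_ge0// -lee_fin fineK//.
by rewrite ge0_fin_numE// (le_lt_trans an)// ltry.
Qed.

Context d (T : measurableType d) (R : realType) (m : {measure set T -> \bar R}).

(** Turns the two norms in the definition of D^{1,2} into integrals of
    powers, which are additive and comparable pointwise. *)
Lemma Lnorm_cvg0 (k : nat) (h : nat -> T -> R) : (0 < k)%N ->
  'N[m]_(k%:R%:E)[EFin \o h n] @[n --> \oo] --> 0 <->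
  forall e : R, (0 < e)%R -> \forall n \near \oo,
    \int[m]_x (`|h n x| ^+ k)%:E <= e%:E.
Proof.
move=> k0; have k0' : (k%:R : R) != 0%R by rewrite pnatr_eq0 -lt0n.
have IE n : \int[m]_x (`|h n x| ^+ k)%:E = 'N[m]_(k%:R%:E)[EFin \o h n] `^ k%:R.
  rewrite poweR_Lnorm//; apply: eq_integral => x _ /=.
  by rewrite powR_mulrn.
rewrite cvge0P; last by move=> n; exact: Lnorm_ge0.
split=> H e e0.
  pose dl := Num.min e 1%R.
  have dl0 : (0 < dl)%R by rewrite lt_min e0 ltr01.
  apply: filterS (H dl dl0) => n; rewrite IE.
  have := Lnorm_ge0 m k%:R%:E (EFin \o h n).
  case: ('N[m]_(k%:R%:E)[EFin \o h n]) => [r| |] //; rewrite ?leye_eq//.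
  rewrite !lee_fin /dl le_min => r0 /andP[re r1].
  rewrite powR_mulrn// (le_trans _ re)//.
  by rewrite -[leRHS]expr1 ler_wiXn2l.
apply: filterS (H (e ^+ k)%R (exprn_gt0 _ e0)) => n; rewrite IE.
have := Lnorm_ge0 m k%:R%:E (EFin \o h n).
case: ('N[m]_(k%:R%:E)[EFin \o h n]) => [r| |] //.
- rewrite !lee_fin => r0; rewrite powR_mulrn//.
  by rewrite ler_pXn2r// nnegrE// ltW.
- by rewrite poweRyr// leye_eq.
Qed.

End Lnorm_limits.

(** * Smooth functions and a cutoff *)

Section smooth_functions.
Context (R : realType).
Implicit Types (f g h : R3 R -> R) (S : set (R3 R -> R)).

Definition C1_into (S : set (R3 R -> R)) f := continuous f /\
  forall i, (forall x, derivable f x (basis3 R i)) /\ S (partial i f).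

(** Smoothness read coinductively: it suffices to exhibit a set of functions
    that contains f and is stable under partial derivatives, with no need to
    compute iterated derivatives. *)
Lemma smoothP f : smooth f <-> exists S, S f /\ forall g, S g -> C1_into S g.
Proof.
split=> [sf|[S [Sf clS]]].
  exists [set g | exists s, g = partials s f]; split; first by exists [::].
  move=> _ [s ->]; have [cs ds] := sf s.
  by split => // i; split => //; exists (i :: s).
move=> s; have : S (partials s f).
  elim: s => [|i s IH] //=; have [_ /(_ i)[_]] := clS _ IH; exact.
by move=> /clS[cs ds]; split => // i x; case: (ds i).
Qed.

(** The algebra of functions generated by S. By [gen_C1_into] it is stable
    under partial derivatives as soon as those of the generators lie in it. *)
Inductive gen (S : set (R3 R -> R)) : (R3 R -> R) -> Prop :=
| gen_base f of S f : gen S f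
| gen_cst (k : R) : gen S (fun=> k)
| gen_add f g of gen S f & gen S g : gen S (fun x => f x + g x)
| gen_mul f g of gen S f & gen S g : gen S (fun x => f x * g x).

Lemma partialD f g i : (forall x, derivable f x (basis3 R i)) ->
  (forall x, derivable g x (basis3 R i)) ->
  partial i (fun x => f x + g x) = fun x => partial i f x + partial i g x.
Proof. by move=> df dg; apply/funext => x; apply: deriveD. Qed.

Lemma partialB f g i : (forall x, derivable f x (basis3 R i)) ->
  (forall x, derivable g x (basis3 R i)) ->
  partial i (fun x => f x - g x) = fun x => partial i f x - partial i g x.
Proof. by move=> df dg; apply/funext => x; apply: deriveB. Qed.

Lemma partialM f g i : (forall x, derivable f x (basis3 R i)) ->
  (forall x, derivable g x (basis3 R i)) ->
  partial i (fun x => f x * g x) =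
  fun x => f x * partial i g x + g x * partial i f x.
Proof. by move=> df dg; apply/funext => x; apply: deriveM. Qed.

Lemma gen_C1_into S : (forall f, S f -> C1_into (gen S) f) ->
  forall f, gen S f -> C1_into (gen S) f.
Proof.
move=> clS f; elim=> {f} [f /clS//|k|f g gf [cf df] gg [cg dg]|
    f g gf [cf df] gg [cg dg]].
- split; first by move=> x; exact: cvg_cst.
  move=> i; split; first by move=> x; exact: derivable_cst.
  rewrite (_ : partial i _ = fun=> 0); first exact: gen_cst.
  by apply/funext => x; exact: derive_cst.
- split; first by move=> x; apply: cvgD; [exact: cf|exact: cg].
  move=> i; have [dfi gfi] := df i; have [dgi ggi] := dg i; split.
    by move=> x; apply: derivableD.
  by rewrite partialD//; exact: gen_add.
- split; first by move=> x; apply: cvgM; [exact: cf|exact: cg].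
  move=> i; have [dfi gfi] := df i; have [dgi ggi] := dg i; split.
    by move=> x; apply: derivableM.
  by rewrite partialM//; apply: gen_add; exact: gen_mul.
Qed.

Lemma smooth_gen S f : (forall f, S f -> C1_into (gen S) f) -> gen S f -> smooth f.
Proof. by move=> clS Sf; apply/smoothP; exists (gen S); split => //; exact: gen_C1_into. Qed.

Lemma smooth_gen2 f g h : smooth f -> smooth g ->
  (forall S, S f -> S g -> gen S h) -> smooth h.
Proof.
move=> /smoothP[S [Sf clS]] /smoothP[S' [Sg clS']] /(_ (S `|` S')) H.
apply: (@smooth_gen (S `|` S')); last by apply: H; [left|right].
move=> k [/clS|/clS'] [ck dk]; split=> // i; have [dki Ski] := dk i; split=> //.
  by apply: gen_base; left.
by apply: gen_base; right.
Qed.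

Lemma smoothM f g : smooth f -> smooth g -> smooth (fun x => f x * g x).
Proof.
by move=> sf sg; apply: (smooth_gen2 sf sg) => S Sf Sg; apply: gen_mul; exact: gen_base.
Qed.

Lemma smoothB f g : smooth f -> smooth g -> smooth (fun x => f x - g x).
Proof.
move=> sf sg; apply: (smooth_gen2 sf sg) => S Sf Sg.
rewrite (_ : (fun x => _) = fun x => f x + (-1) * g x); last first.
  by apply/funext => x; rewrite mulN1r.
by apply: gen_add; [exact: gen_base|apply: gen_mul; [exact: gen_cst|exact: gen_base]].
Qed.

Lemma smooth_cst k : smooth (fun _ : R3 R => k).
Proof. by apply: (@smooth_gen set0) => //; exact: gen_cst. Qed.

Lemma smooth_partial f i : smooth f -> smooth (partial i f).
Proof.
move=> /smoothP[S [Sf clS]]; apply/smoothP; exists S; split => //.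
by have [_ /(_ i)[]] := clS _ Sf.
Qed.

Lemma smooth_continuous f : smooth f -> continuous f.
Proof. by move=> /(_ [::])[]. Qed.

Lemma smooth_derivable f : smooth f -> forall i x, derivable f x (basis3 R i).
Proof. by move=> /(_ [::])[]. Qed.

Definition coord (i : 'I_3) (x : R3 R) : R :=
  nth 0 [:: x.1.1; x.1.2; x.2] i.

Lemma coord_shift i j (t : R) (x : R3 R) :
  coord j (t *: basis3 R i + x) = t * (i == j)%:R + coord j x.
Proof.
case: x => [[x1 x2] x3]; rewrite /coord /basis3.
by case: i => [[|[|[|]]]]//= ?; case: j => [[|[|[|]]]]//= ?.
Qed.

Lemma is_derive_coord i j (x : R3 R) :
  is_derive x (basis3 R i) (coord j) (i == j)%:R.
Proof.
have E : (fun h : R => h^-1 *: ((coord j \o shift x) (h *: basis3 R i) - coord j x))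
    @ 0^' --> ((i == j)%:R : R).
  apply: (@cvg_trans _ ((fun=> (i == j)%:R : R) @ 0^')); last exact: cvg_cst.
  apply: near_eq_cvg; near=> h.
  rewrite /= coord_shift addrK /GRing.scale/= mulrA mulVf ?mul1r//.
  by near: h; exact: nbhs_dnbhs_neq.
by split; [apply/cvg_ex; eexists; exact: E|exact: cvg_lim E].
Unshelve. all: by end_near. Qed.

Lemma continuous_coord j : continuous (coord j).
Proof.
move=> [[x1 x2] x3]; rewrite /coord.
have c12 : {for (x1, x2, x3), continuous (fst : R3 R -> _)} by exact: cvg_fst.
case: j => [[|[|[|]]]]//= _; last exact: cvg_snd.
- apply: (@cvg_comp _ _ _ fst fst); first exact: c12; exact: cvg_fst.
- apply: (@cvg_comp _ _ _ fst snd); first exact: c12; exact: cvg_snd.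
Qed.

Section cutoff.
Variable e : R.
Hypothesis e0 : 0 < e.

(** A rational profile rather than a compactly supported one: its derivative
    is a polynomial in t and the profile itself, so that smoothness is an
    algebraic fact, and it is at most sqrt e times the profile. *)
Definition bump1 (t : R) : R := (1 + e * t ^+ 2)^-1.

Lemma bump1_den t : 0 < 1 + e * t ^+ 2.
Proof. by rewrite ltr_pwDl// mulr_ge0 ?sqr_ge0// ltW. Qed.

Definition bump (x : R3 R) : R := \prod_(j < 3) bump1 (coord j x).

Lemma is_derive_den i j (x : R3 R) :
  is_derive x (basis3 R i) (fun y => 1 + e * coord j y ^+ 2)
    (2 * e * coord j x * (i == j)%:R).
Proof.
have dcoord := is_derive_coord i j x.
apply: is_derive_eq.
by rewrite /GRing.scale/=; ring.
Qed.

Lemma C1_bump1 j :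
  C1_into (gen [set f | exists j, f = coord j \/ f = bump1 \o coord j])
     (bump1 \o coord j).
Proof.
set S := [set f | _].
have nz x : 1 + e * coord j x ^+ 2 != 0 by rewrite gt_eqF// bump1_den.
split.
  move=> x; apply: cvgV; first exact: nz.
  apply: cvgD; first exact: cvg_cst.
  apply: cvgM; first exact: cvg_cst.
  by rewrite expr2; under eq_cvg do rewrite expr2; apply: cvgM; exact: continuous_coord.
move=> i; split.
  by move=> x; apply: derivableV => //; case: (is_derive_den i j x).
rewrite (_ : partial i _ = fun x => (- (2 * e * (i == j)%:R)) *
    (coord j x * ((bump1 \o coord j) x * (bump1 \o coord j) x))).
  apply: gen_mul; first exact: gen_cst.
  apply: gen_mul; first by apply: gen_base; exists j; left.
  by apply: gen_mul; apply: gen_base; exists j; right.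
apply/funext => x; have [d1 d2] := is_derive_den i j x.
rewrite /partial /bump1 /comp deriveV//= d2 /GRing.scale/=.
by field.
Qed.

Lemma smooth_bump : smooth bump.
Proof.
apply: (@smooth_gen [set f | exists j, f = coord j \/ f = bump1 \o coord j]).
  move=> f [j [->|->]]; last exact: C1_bump1.
  split; first exact: continuous_coord.
  move=> i; split; first by move=> x; have [] := is_derive_coord i j x.
  rewrite (_ : partial i _ = fun=> (i == j)%:R); first exact: gen_cst.
  by apply/funext => x; have [] := is_derive_coord i j x.
rewrite (_ : bump = fun x => (bump1 \o coord ord0) x *
  ((bump1 \o coord (lift ord0 ord0)) x * ((bump1 \o coord (lift ord0 (lift ord0 ord0))) x))).
  by repeat (apply: gen_mul; last first); apply: gen_base; eexists; right.
by apply/funext => x; rewrite /bump !big_ord_recl big_ord0 mulr1.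
Qed.

Lemma bump1_gt0 t : 0 < bump1 t.
Proof. by rewrite invr_gt0 bump1_den. Qed.

Lemma bump1_le1 t : bump1 t <= 1.
Proof. by rewrite invf_le1 ?bump1_den// lerDl mulr_ge0 ?sqr_ge0// ltW. Qed.

Lemma bump_gt0 x : 0 < bump x.
Proof. by apply: prodr_gt0 => j _; exact: bump1_gt0. Qed.

Lemma bump_le1 x : bump x <= 1.
Proof. by apply: prodr_ile1 => j _; rewrite ltW ?bump1_gt0 ?bump1_le1. Qed.

Lemma bump_le_coord j x : bump x <= bump1 (coord j x).
Proof.
rewrite /bump (bigD1 j)//= ler_piMr ?(ltW (bump1_gt0 _))//.
by apply: prodr_ile1 => k _; rewrite ltW ?bump1_gt0 ?bump1_le1.
Qed.

(** 2 s |t| <= 1 + s^2 t^2 with s = sqrt e. *)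
Lemma bump1_slope t : `|2 * e * t * bump1 t| <= Num.sqrt e.
Proof.
have ee : e = Num.sqrt e ^+ 2 by rewrite sqr_sqrtr// ltW.
have s0 : 0 < Num.sqrt e by rewrite sqrtr_gt0.
rewrite normrM (gtr0_norm (bump1_gt0 t)) ler_pdivrMr ?bump1_den//.
set s := Num.sqrt e in ee s0 *; rewrite ee ler_norml; apply/andP.
have h1 := sqr_ge0 (1 - s * t); have h2 := sqr_ge0 (1 + s * t).
split; rewrite -subr_ge0.
  have := mulr_ge0 (ltW s0) h2; nra.
have := mulr_ge0 (ltW s0) h1; nra.
Qed.

(** Only one factor of the product varies along a coordinate line, so the
    bound on the logarithmic derivative of the profile passes to [bump]. *)
Lemma partial_bump_le i x : `|partial i bump x| <= Num.sqrt e * bump x.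
Proof.
suff -> : partial i bump x = - (2 * e * coord i x * bump1 (coord i x)) * bump x.
  rewrite normrM normrN (gtr0_norm (bump_gt0 x)) ler_wpM2r ?(ltW (bump_gt0 x))//.
  exact: bump1_slope.
have bE y : bump y = bump1 (coord i y) * \prod_(j < 3 | j != i) bump1 (coord j y).
  by rewrite /bump (bigD1 i).
have lin (h : R) : bump (h *: basis3 R i + x) = bump1 (h + coord i x) *
    \prod_(j < 3 | j != i) bump1 (coord j x).
  rewrite bE coord_shift eqxx mulr1; congr (_ * _); apply: eq_bigr => j ji.
  by rewrite coord_shift eq_sym (negbTE ji) mulr0 add0r.
set C := \prod_(j < 3 | j != i) bump1 (coord j x) in lin.
have [_ /(_ i)[dcoord _]] := C1_bump1 i.
rewrite (_ : partial i bump x = partial i (fun y => C * (bump1 \o coord i) y) x).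
  rewrite /partial deriveZ//.
  rewrite (_ : 'D_(basis3 R i) (bump1 \o coord i) x =
    - (2 * e * coord i x * bump1 (coord i x)) * bump1 (coord i x)); last first.
    have nz : 1 + e * coord i x ^+ 2 != 0 by rewrite gt_eqF// bump1_den.
    have [d1 d2] := is_derive_den i i x.
    rewrite /bump1 /comp deriveV//= d2 eqxx /GRing.scale/=.
    by field.
  by rewrite bE -/C /GRing.scale/=; ring.
have E : (fun h : R => h^-1 *: ((bump \o shift x) (h *: basis3 R i) - bump x)) =
    (fun h : R => h^-1 *: (((fun y => C * (bump1 \o coord i) y) \o shift x)
      (h *: basis3 R i) - C * (bump1 \o coord i) x)).
  apply/funext => h; congr (_ *: (_ - _)).
    by rewrite /= lin coord_shift eqxx mulr1 mulrC.
  by rewrite /= bE mulrC.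
by rewrite /partial /derive E.
Qed.

End cutoff.

End smooth_functions.

(** * Measurability and test functions on R^3 *)

Section continuous_measurable3.
Context (R : realType).

Definition rect (I J K : set R) : set (R3 R) := (I `*` J) `*` K.

Lemma measurable_rect (I J K : set R) : measurable I -> measurable J ->
  measurable K -> measurable (rect I J K).
Proof. by move=> mI mJ mK; apply: measurableX => //; exact: measurableX. Qed.

Lemma leb3_rect (I J K : set R) : measurable I -> measurable J ->
  measurable K -> (leb3 R (rect I J K) =
    lebesgue_measure I * lebesgue_measure J * lebesgue_measure K)%E.
Proof.
move=> mI mJ mK; rewrite /leb3 /rect.
transitivity (((@lebesgue_measure R \x @lebesgue_measure R) (I `*` J)
   * lebesgue_measure K)%E).
  by apply: product_measure1E => //; exact: measurableX.
by congr (_ * _)%E; exact: product_measure1E.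
Qed.

(** The measurable structure of R^3 is a product one: an open set is the
    countable union of the boxes of rational centers and sizes 1 / (k + 1)
    that it contains. *)
Lemma measurable_open3 (U : set (R3 R)) : open U -> measurable U.
Proof.
move=> oU.
pose bx (q : rat * rat * rat * nat) : set (R3 R) :=
  rect (ball (ratr q.1.1.1 : R) q.2.+1%:R^-1) (ball (ratr q.1.1.2 : R) q.2.+1%:R^-1)
    (ball (ratr q.1.2 : R) q.2.+1%:R^-1).
have mbx q : measurable (bx q).
  by apply: measurable_rect; exact: measurable_ball.
pose F q := if `[< bx q `<=` U >] then bx q else set0.
have -> : U = \bigcup_q F q.
  apply/seteqP; split=> [[[x1 x2] x3] Ux|x [q _]]; last first.
    by rewrite /F; case: asboolP => // qU; exact: qU.
  have /nbhs_ballP[e /= e0 xeU] := open_nbhs_nbhs (conj oU Ux).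
  have [k ke] : exists k : nat, (k.+1%:R^-1 : R) < e / 2.
    exists (Num.truncn (e / 2)^-1); rewrite invf_plt ?posrE ?divr_gt0 ?ltr0n//.
    exact: truncnS_gt.
  have approx (y : R) : exists q : rat, ball (ratr q : R) k.+1%:R^-1 y.
    have c0 : 0 < k.+1%:R^-1 :> R by rewrite invr_gt0.
    set c := _^-1 in c0 *.
    have [|q] := @rat_in_itvoo R (y - c) (y + c); first by lra.
    rewrite in_itv/= => /andP[h1 h2]; exists q.
    by rewrite /ball/= ltr_norml; apply/andP; split; lra.
  have [q1 h1] := approx x1; have [q2 h2] := approx x2; have [q3 h3] := approx x3.
  exists (q1, q2, q3, k) => //; rewrite /F asboolT//.
  move=> [[y1 y2] y3] [[/= g1 g2] g3]; apply: xeU.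
  have tri (a b c : R) : ball c k.+1%:R^-1 a -> ball c k.+1%:R^-1 b -> ball a e b.
    rewrite /ball/= => ha hb; rewrite (_ : a - b = (c - b) - (c - a)); last by ring.
    apply: le_lt_trans (ler_normB _ _) _.
    by rewrite (splitr e) ltrD// (lt_trans _ ke).
  by split; [split|]; rewrite /=; apply: tri; eassumption.
apply: countable_bigcupT_measurable; first exact: countableP.
by move=> q; rewrite /F; case: ifP.
Qed.

Lemma continuous_measurable3 (f : R3 R -> R) : continuous f ->
  measurable_fun setT f.
Proof.
move=> /continuousP cf; apply: (measurability _ (RGenOpens.measurableE R)).
move=> _ [_ [a [b ->] <-]]; rewrite setTI; apply: measurable_open3.
exact/cf/interval_open.
Qed.

Lemma norm3_le (x : R3 R) i : `|coord i x| <= `|x|.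
Proof.
case: x => [[x1 x2] x3]; rewrite /coord prod_normE/= prod_normE/=.
by case: i => [[|[|[|]]]]//= _; rewrite !le_max lexx ?orbT.
Qed.

(** Half-open, so that bisection produces disjoint pieces. *)
Definition cube (N : R) : set (R3 R) :=
  let I := `[- N, N[%classic in rect I I I.

Lemma measurable_cube N : measurable (cube N).
Proof. by apply: measurable_rect; exact: measurable_itv. Qed.

Lemma cube_lty N : (leb3 R (cube N) < +oo)%E.
Proof.
pose I : set R := `[- N, N[%classic.
have mI : measurable I by exact: measurable_itv.
rewrite leb3_rect//.
have h : (lebesgue_measure I < +oo)%E.
  by rewrite lebesgue_measure_itv/=; case: ifP => // _; rewrite -EFinD ltry.
have h0 := measure_ge0 (@lebesgue_measure R) I.
have h' : lebesgue_measure I \is a fin_num by rewrite ge0_fin_numE.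
by rewrite -ge0_fin_numE ?mule_ge0// !fin_numM.
Qed.

Lemma cubeN N x : ~ cube N x -> exists i, N <= `|coord i x|.
Proof.
move=> nx; apply: contrapT => h; apply: nx.
have {}h i : `|coord i x| < N by rewrite ltNge; apply/negP => ?; apply: h; exists i.
have h0 := h (inord 0); have h1 := h (inord 1); have h2 := h (inord 2).
move: h0 h1 h2; rewrite /coord !inordK//= !ltr_norml.
move=> /andP[a0 b0] /andP[a1 b1] /andP[a2 b2].
by split; [split|]; rewrite /= in_itv/= ?b0 ?b1 ?b2 ltW.
Qed.

End continuous_measurable3.

Section finite_sets.
Context d (T : measurableType d) (R : realType) (m : {measure set T -> \bar R}).

Lemma intg_indic (A : set T) : measurable A -> (m A < +oo)%E -> intg m \1_A.
Proof.
move=> mA Afin; apply/integrableP; split; first exact/measurable_EFinP.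
rewrite (eq_integral (fun x => (\1_A x)%:E)); last first.
  by move=> t _; rewrite gee0_abs// lee_fin.
by rewrite integral_indic// setIT.
Qed.

Lemma intg_bounded_support (A : set T) C (f : T -> R) : measurable A ->
  (m A < +oo)%E -> measurable_fun setT f ->
  (forall x, `|f x| <= C) -> (forall x, ~ A x -> f x = 0) -> intg m f.
Proof.
move=> mA Afin mf fC f0; apply: (le_intg mf _ (intgZ C (intg_indic mA Afin))).
move=> x; rewrite indicE; have [Ax|nAx] := pselect (A x).
  by rewrite mem_set// mulr1.
by rewrite memNset// f0// normr0 mulr0.
Qed.

End finite_sets.

Section test_functions.
Context (R : realType).
Implicit Types (f g h : R3 R -> R).
Local Notation m := (leb3 R).

Lemma test_support f g : test_function f -> smooth g ->
  (forall x, ~ closure [set x | f x != 0] x -> g x = 0) -> test_function g.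
Proof.
move=> [sf cf] sg fg; split=> //; apply: subclosed_compact cf _.
  exact: closed_closure.
rewrite [X in _ `<=` X]((closure_id _).1 (@closed_closure _ _)).
apply: closure_subset => x /= gx; apply: contrapT => /fg g0.
by rewrite g0 eqxx in gx.
Qed.

Lemma testM f h : test_function f -> smooth h ->
  test_function (fun x => f x * h x).
Proof.
move=> tf sh; apply: (test_support tf); first exact: smoothM tf.1 sh.
move=> x nx; rewrite (_ : f x = 0) ?mul0r//; apply: contrapT => /eqP fx.
by apply: nx; exact: subset_closure.
Qed.

Lemma testB f g : test_function f -> test_function g ->
  test_function (fun x => f x - g x).
Proof.
move=> [sf cf] [sg cg]; split; first exact: smoothB.
have := compactU cf cg; rewrite -closureU => cfg.
apply: subclosed_compact cfg _; first exact: closed_closure.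
apply: closure_subset => x /= fgx; apply: contrapT => /not_orP[/negP].
rewrite negbK => /eqP f0 /negP; rewrite negbK => /eqP g0.
by rewrite f0 g0 subrr eqxx in fgx.
Qed.

Lemma test_partial f i : test_function f -> test_function (partial i f).
Proof.
move=> tf; apply: (test_support tf); first exact: smooth_partial tf.1.
move=> x nx; have oC : open (~` closure [set x | f x != 0]).
  by apply: closed_openC; exact: closed_closure.
rewrite /partial (@near_eq_derive _ _ _ f (fun=> 0)).
  exact: derive_cst.
have : nbhs x (~` closure [set x | f x != 0]) by exact: open_nbhs_nbhs.
apply: filterS => y ny; apply: contrapT => /eqP fy.
by apply: ny; exact: subset_closure.
Qed.

Lemma test_bounded f : test_function f ->
  exists C N, (forall x, `|f x| <= C) /\ forall x, ~ cube N x -> f x = 0.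
Proof.
move=> [sf cf].
have cont := smooth_continuous sf.
have [M [_ hM]] := compact_bounded cf.
have cfi : compact (f @` closure [set x | f x != 0]).
  by apply: continuous_compact cf; exact: continuous_subspaceT.
have [C [_ hC]] := compact_bounded cfi.
exists (`|C| + 1), (`|M| + 2); split.
  move=> x; have [->|fx] := eqVneq (f x) 0; first by rewrite normr0 addr_ge0.
  apply: hC; first by rewrite ltr_pwDr// ler_norm.
  by exists x => //; exact: subset_closure.
move=> x /cubeN[i hi]; apply: contrapT => /eqP fx.
have : `|x| <= `|M| + 1.
  by apply: hM; [rewrite ltr_pwDr// ler_norm|exact: subset_closure].
by have := norm3_le x i; lra.
Qed.

Lemma test_meas f : test_function f -> measurable_fun setT f.
Proof. by move=> [/smooth_continuous /continuous_measurable3]. Qed.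

Lemma test_L2 f : test_function f -> L2 m f.
Proof.
move=> tf; have [C [N [fC f0]]] := test_bounded tf.
have mf := test_meas tf.
split=> //; apply: (@intg_bounded_support _ _ _ _ (cube N) (C ^+ 2)).
- exact: measurable_cube.
- exact: cube_lty.
- exact: measurable_funX.
- move=> x; rewrite normrX ler_sqr ?nnegrE//.
  by rewrite (le_trans _ (fC x)).
- by move=> x /f0 ->; rewrite expr0n.
Qed.

End test_functions.

(** * Tonelli's theorem in three variables *)

Section product_measure.
Local Open Scope ereal_scope.
Context d1 d2 (T1 : measurableType d1) (T2 : measurableType d2) (R : realType).
Variables (m1 : {sigma_finite_measure set T1 -> \bar R})
  (m2 : {sigma_finite_measure set T2 -> \bar R}).

(** The measure defining [leb3] is an iterated product; to apply Tonelli's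
    theorem to it, its inner product is needed as a sigma-finite measure. *)
Definition prodm : set (T1 * T2) -> \bar R := m1 \x m2.

HB.instance Definition _ := Measure.on prodm.

Let prodm_sigma_finite : sigma_finite setT prodm.
Proof.
have /sigma_finiteP[F [TF ndF Foo]] := sigma_finiteT m1.
have /sigma_finiteP[G [TG ndG Goo]] := sigma_finiteT m2.
exists (fun n => F n `*` G n).
  rewrite -setXTT TF TG predeqE => -[x y]; split.
    move=> [/= [n _ Fnx] [k _ Gky]]; exists (maxn n k) => //; split.
    - by move: x Fnx; exact/subsetPset/ndF/leq_maxl.
    - by move: y Gky; exact/subsetPset/ndG/leq_maxr.
  by move=> [n _ []/= ? ?]; split; exists n.
move=> k; have [? ?] := Foo k; have [? ?] := Goo k.
split; first exact: measurableX.
by rewrite /prodm product_measure1E// lte_mul_pinfty// ge0_fin_numE.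
Qed.

HB.instance Definition _ := Measure_isSigmaFinite.Build _ _ _ prodm
  prodm_sigma_finite.

End product_measure.

Section triple_product.
Local Open Scope ereal_scope.
Context d1 d2 d3 (T1 : measurableType d1) (T2 : measurableType d2) 
  (T3 : measurableType d3) (R : realType).
Variables (m1 : {sigma_finite_measure set T1 -> \bar R})
  (m2 : {sigma_finite_measure set T2 -> \bar R})
  (m3 : {sigma_finite_measure set T3 -> \bar R}).

Lemma triple_tonelli (f : T1 * T2 * T3 -> \bar R) : measurable_fun setT f ->
  (forall x, 0 <= f x) ->
  \int[(m1 \x m2) \x m3]_x f x = \int[m1]_x \int[m2]_y \int[m3]_z f ((x, y), z).
Proof.
move=> mf f0.
have E1 := @fubini_tonelli1 _ _ _ _ R (prodm m1 m2) m3 f mf f0.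
have mF := @measurable_fun_fubini_tonelli_F _ _ _ _ R m3 f mf f0.
have F0 x : 0 <= fubini_F m3 f x by apply: integral_ge0.
have E2 := @fubini_tonelli1 _ _ _ _ R m1 m2 _ mF F0.
exact: etrans E1 E2.
Qed.

End triple_product.

Section lebesgue3.
Context (R : realType).
Local Notation mu := (@lebesgue_measure R).
Lemma tonelli3 (f : R3 R -> \bar R) : measurable_fun setT f ->
  (forall x, 0 <= f x)%E ->
  (\int[leb3 R]_x f x = \int[mu]_x \int[mu]_y \int[mu]_z f ((x, y), z))%E.
Proof.
move=> mf f0.
have H := @triple_tonelli _ _ _ _ _ _ _ mu mu mu f mf f0.
exact: H.
Qed.

End lebesgue3.

(** * The space D^{1,2} *)

Section bump_integrable.
Context (R : realType).
Variable e : R.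
Hypothesis e0 : 0 < e.
Local Notation mu := (@lebesgue_measure R).

(** The primitive of 1 / (1 + t^2) is the bounded function atan. *)
Lemma integral_bump1_one_lty : (\int[mu]_t (bump1 1 t)%:E < +oo)%E.
Proof.
have b0 (t : R) : 0 < 1 + 1 * t ^+ 2 by exact: bump1_den.
have cb : continuous (bump1 1 : R -> R).
  move=> t; apply: cvgV; first by rewrite gt_eqF.
  apply: cvgD; first exact: cvg_cst.
  apply: cvgM; first exact: cvg_cst.
  exact: exprn_continuous.
rewrite ge0_symfun_integralT//; last 2 first.
- by move=> t; rewrite ltW// bump1_gt0.
- by move=> t; rewrite /bump1/= sqrrN.
rewrite -set_itvcy (@ge0_continuous_FTC2y _ _ (@atan R) 0 (pi / 2)).
- by rewrite -EFinB -EFinM ltry.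
- by move=> t _; rewrite ltW// bump1_gt0.
- by apply: continuous_subspaceT.
- exact: cvgy_atan.
- by move=> t _; exact: derivable_atan.
- apply: cvg_at_right_filter; exact: continuous_atan.
- by move=> t _; rewrite derive1_atan /bump1 mul1r.
Qed.

Lemma integral_bump1_lty : (\int[mu]_t (bump1 e t)%:E < +oo)%E.
Proof.
have mb (c : R) : 0 < c -> measurable_fun setT (bump1 c : R -> R).
  move=> c0; apply: continuous_measurable_fun => t.
  apply: cvgV; first by rewrite gt_eqF// bump1_den.
  apply: cvgD; first exact: cvg_cst.
  apply: cvgM; first exact: cvg_cst.
  exact: exprn_continuous.
pose C := 1 + e^-1.
have C0 : 0 < C by rewrite addr_gt0// invr_gt0.
apply: (@le_lt_trans _ _ (\int[mu]_t (C%:E * (bump1 1 t)%:E))%E).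
  apply: ge0_le_integral => //.
  - by move=> t _; rewrite lee_fin ltW// bump1_gt0.
  - by apply/measurable_EFinP; exact: mb.
  - by apply: measurable_funeM; apply/measurable_EFinP; exact: mb.
  - move=> t _; rewrite -EFinM lee_fin /bump1.
    have -> : C * (1 + 1 * t ^+ 2)^-1 = (1 + e * t ^+ 2)^-1 *
        (C * (1 + e * t ^+ 2) / (1 + 1 * t ^+ 2)).
      by field; rewrite !gt_eqF// ?bump1_den//; have := sqr_ge0 t; lra.
    rewrite ler_peMr ?invr_ge0 ?(ltW (bump1_den e0 _))//.
    rewrite ler_pdivlMr ?bump1_den// !mul1r /C.
    have -> : (1 + e^-1) * (1 + e * t ^+ 2) =
        1 + t ^+ 2 + (e * t ^+ 2 + e^-1) by field; rewrite gt_eqF.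
    rewrite lerDl; apply: addr_ge0; last by rewrite invr_ge0 ltW.
    by rewrite mulr_ge0 ?sqr_ge0// ltW.
rewrite ge0_integralZl//; last 2 first.
- by move=> t _; rewrite lee_fin ltW// bump1_gt0.
- by rewrite lee_fin ltW.
- by rewrite lte_mul_pinfty ?lee_fin ?(ltW C0)// integral_bump1_one_lty.
- by apply/measurable_EFinP; exact: mb.
Qed.

Lemma intg_bump : intg (leb3 R) (bump e).
Proof.
have mbump := continuous_measurable3 (smooth_continuous (smooth_bump e0)).
pose b := bump1 e.
have b0 t : 0 <= b t by rewrite ltW// bump1_gt0.
have mb : measurable_fun setT b.
  apply: continuous_measurable_fun => t.
  apply: cvgV; first by rewrite gt_eqF// bump1_den.
  apply: cvgD; first exact: cvg_cst.
  apply: cvgM; first exact: cvg_cst.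
  exact: exprn_continuous.
have Eb : (\int[mu]_t (b t)%:E < +oo)%E := integral_bump1_lty.
set J := (\int[mu]_t (b t)%:E)%E in Eb.
have J0 : (0 <= J)%E by apply: integral_ge0 => t _; rewrite lee_fin.
have m1 : measurable_fun setT (fun t => (b t)%:E) by exact/measurable_EFinP.
have Z (k : R) : 0 <= k -> (\int[mu]_t (k * b t)%:E = k%:E * J)%E.
  move=> k0; under eq_integral do rewrite EFinM.
  by rewrite ge0_integralZl// => t _; rewrite lee_fin.
have bE x y z : bump e (x, y, z) = b x * b y * b z.
  by rewrite /bump !big_ord_recl big_ord0 mulr1 mulrA /coord /=.
have E3 : (\int[leb3 R]_x (bump e x)%:E = J * J * J)%E.
  rewrite tonelli3; last 2 first.
  - exact/measurable_EFinP.
  - by move=> x; rewrite lee_fin ltW// bump_gt0.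
  transitivity (\int[mu]_x ((b x)%:E * J * J))%E.
    apply: eq_integral => x _.
    transitivity (\int[mu]_y ((b x * b y)%:E * J))%E.
      apply: eq_integral => y _; rewrite -Z ?mulr_ge0//.
      by apply: eq_integral => z _; rewrite bE.
    by rewrite ge0_integralZr//; [rewrite Z|exact/measurable_EFinP/measurable_funM
      |move=> y _; rewrite lee_fin mulr_ge0].
  rewrite ge0_integralZr//; [rewrite ge0_integralZr//| |].
  - by move=> t _; rewrite lee_fin.
  - by apply: emeasurable_funM.
  - by move=> t _; rewrite mule_ge0// lee_fin.
have Jf : J \is a fin_num by rewrite ge0_fin_numE.
have [] // := @intg_le_fin _ _ _ (leb3 R) (bump e) (fine (J * J * J)).
  by move=> x; rewrite ltW// bump_gt0.
by rewrite E3 fineK// !fin_numM.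
Qed.

End bump_integrable.

Section D12_theory.
Context (R : realType).
Local Notation m := (leb3 R).
Local Notation sq := (sq m).
Implicit Types (u v w : gfun R).

Lemma small_invn (e : R) : 0 < e -> exists N, forall n, (N <= n)%N -> n.+1%:R^-1 <= e.
Proof.
move=> e0; exists (Num.truncn e^-1) => n Nn.
rewrite invf_ple ?posrE ?ltr0n//.
apply: ltW; apply: lt_le_trans (truncnS_gt _) _.
by rewrite ler_nat ltnS.
Qed.

(** f approximates u to within e in the two norms that define D^{1,2}. *)
Definition D12_close u e f := [/\ test_function f,
  intg m (fun x => (f x - u.1 x) ^+ 6),
  \int[m]_x ((f x - u.1 x) ^+ 6) <= e &
  forall i, L2 m (fun x => partial i f x - u.2 i x) /\
    sq (fun x => partial i f x - u.2 i x) <= e].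

Lemma norm6 (a : R) : `|a| ^+ 6 = a ^+ 6.
Proof. by rewrite -normrX ger0_norm// exprn_even_ge0. Qed.

Lemma norm2 (a : R) : `|a| ^+ 2 = a ^+ 2.
Proof. by rewrite real_normK// num_real. Qed.

Lemma pow6_ge0 (a : R) : 0 <= a ^+ 6.
Proof. by rewrite exprn_even_ge0. Qed.

Lemma Lnorm6_cvg0 (h : nat -> R3 R -> R) : (forall n, measurable_fun setT (h n)) ->
  'N[m]_(6%:E)[EFin \o h n]%E @[n --> \oo] --> 0%E <->
  forall e, 0 < e -> \forall n \near \oo,
    intg m (fun x => h n x ^+ 6) /\ \int[m]_x (h n x ^+ 6) <= e.
Proof.
move=> mh; rewrite (@Lnorm_cvg0 _ _ _ m 6 h isT).
split=> H e e0; apply: filterS (H e e0) => n.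
  under eq_integral do rewrite norm6.
  by apply: intg_le_fin => [|x]; [exact: measurable_funX|exact: pow6_ge0].
move=> [Ih le]; under eq_integral do rewrite norm6.
by rewrite intgE.
Qed.

Lemma Lnorm2_cvg0 (h : nat -> R3 R -> R) : (forall n, measurable_fun setT (h n)) ->
  'N[m]_(2%:E)[EFin \o h n]%E @[n --> \oo] --> 0%E <->
  forall e, 0 < e -> \forall n \near \oo, L2 m (h n) /\ sq (h n) <= e.
Proof.
move=> mh; rewrite (@Lnorm_cvg0 _ _ _ m 2 h isT).
split=> H e e0; apply: filterS (H e e0) => n.
  under eq_integral do rewrite norm2.
  move=> /intg_le_fin[||I le].
  - exact: measurable_funX.
  - by move=> x; exact: sqr_ge0.
  - by split.
move=> [[_ Ih] le]; under eq_integral do rewrite norm2.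
by rewrite intgE.
Qed.

Lemma D12P u : D12 u <-> [/\ measurable_fun setT u.1,
  forall i, measurable_fun setT (u.2 i) &
  forall e, 0 < e -> exists f, D12_close u e f].
Proof.
split=> [[m1 m2 [f [tf f6 f2]]]|[m1 m2 H]]; split=> //.
  move=> e e0.
  have {}f6 := (Lnorm6_cvg0 (fun n => measurable_funB (test_meas (tf n)) m1)).1 f6 e e0.
  have {}f2 i := (Lnorm2_cvg0 (fun n => measurable_funB
    (test_meas (test_partial i (tf n))) (m2 i))).1 (f2 i) e e0.
  have : \forall n \near \oo, D12_close u e (f n).
    near=> n; split => //.
    - by have [] : _ /\ _ := near f6 n _.
    - by have [] : _ /\ _ := near f6 n _.
    - move=> i; move: i; near: n; apply: filter_forall => i; exact: f2.
  by move=> [N _ /(_ N (leqnn _))]; exists (f N).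
have {}H n : exists f, D12_close u n.+1%:R^-1 f by apply: H; rewrite invr_gt0 ltr0n.
have [f hf] := choice H.
have tf n : test_function (f n) by have [] := hf n.
exists f; split => //.
  apply/(Lnorm6_cvg0 (fun n => measurable_funB (test_meas (tf n)) m1)) => e e0.
  have [N hN] := small_invn e0; exists N => // n /= /hN ne.
  by have [_ I6 le6 _] := hf n; split => //; exact: le_trans ne.
move=> i; apply/(Lnorm2_cvg0 (fun n => measurable_funB
    (test_meas (test_partial i (tf n))) (m2 i))) => e e0.
have [N hN] := small_invn e0; exists N => // n /= /hN ne.
by have [_ _ _ /(_ i)[I2 le2]] := hf n; split => //; exact: le_trans ne.
Unshelve. all: by end_near. Qed.

Lemma D12_meas1 u : D12 u -> measurable_fun setT u.1.
Proof. by move=> []. Qed.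

Lemma D12_grad_L2 u i : D12 u -> L2 m (u.2 i).
Proof.
move=> /D12P[_ m2 /(_ 1 ltr01)[f [tf _ _ /(_ i)[Lf _]]]].
have [_ I] := L2B (test_L2 (test_partial i tf)) Lf; split => //.
by apply: intg_eq I => x /=; congr (_ ^+ 2); ring.
Qed.

Lemma pow6D (a b : R) : (a + b) ^+ 6 <= 32 * a ^+ 6 + 32 * b ^+ 6.
Proof.
have sq_le (x y : R) : 0 <= x -> 0 <= y -> (x + y) ^+ 3 <= 4 * x ^+ 3 + 4 * y ^+ 3.
  move=> x0 y0; rewrite -subr_ge0.
  have -> : 4 * x ^+ 3 + 4 * y ^+ 3 - (x + y) ^+ 3 = 3 * ((x + y) * (x - y) ^+ 2) by ring.
  by rewrite mulr_ge0// mulr_ge0 ?sqr_ge0// addr_ge0.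
have -> : (a + b) ^+ 6 = ((a + b) ^+ 2) ^+ 3 by rewrite -exprM.
have a0 : 0 <= 2 * a ^+ 2 by rewrite pmulr_rge0 ?sqr_ge0.
have b0 : 0 <= 2 * b ^+ 2 by rewrite pmulr_rge0 ?sqr_ge0.
apply: (@le_trans _ _ ((2 * a ^+ 2 + 2 * b ^+ 2) ^+ 3)).
  rewrite ler_pXn2r ?nnegrE ?sqr_ge0 ?addr_ge0//.
  by have := sqr_ge0 (a - b); nra.
apply: (le_trans (sq_le _ _ a0 b0)).
by rewrite le_eqVlt; apply/orP; left; apply/eqP; ring.
Qed.

Lemma intg6D (f g : R3 R -> R) : measurable_fun setT f -> measurable_fun setT g ->
  intg m (fun x => f x ^+ 6) -> intg m (fun x => g x ^+ 6) ->
  intg m (fun x => (f x + g x) ^+ 6) /\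
  \int[m]_x ((f x + g x) ^+ 6) <=
    32 * \int[m]_x (f x ^+ 6) + 32 * \int[m]_x (g x ^+ 6).
Proof.
move=> mf mg If Ig; have I := intgD (intgZ 32 If) (intgZ 32 Ig).
have Ifg : intg m (fun x => (f x + g x) ^+ 6).
  apply: (le_intg _ _ I); first by apply: measurable_funX; exact: measurable_funD.
  by move=> x; rewrite ger0_norm ?pow6_ge0// pow6D.
split=> //; rewrite -!IntZ// -IntD; [|exact: intgZ|exact: intgZ].
by apply: le_Int => // x; exact: pow6D.
Qed.

(** If v is close to u, a test function close to v is close to u. *)
Lemma D12_closed u : measurable_fun setT u.1 ->
  (forall i, measurable_fun setT (u.2 i)) ->
  (forall e, 0 < e -> exists v, [/\ D12 v, intg m (fun x => (v.1 x - u.1 x) ^+ 6),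
    \int[m]_x ((v.1 x - u.1 x) ^+ 6) <= e &
    forall i, L2 m (fun x => v.2 i x - u.2 i x) /\
      sq (fun x => v.2 i x - u.2 i x) <= e]) ->
  D12 u.
Proof.
move=> m1 m2 H; apply/D12P; split=> // e e0.
have e64 : 0 < e / 64 by rewrite divr_gt0.
have [v [Dv I6 le6 I2]] := H _ e64.
have [mv1 mv2 /(_ _ e64)[f [tf J6 je6 J2]]] := (D12P v).1 Dv.
exists f; split=> //.
- have [I _] := intg6D (measurable_funB (test_meas tf) mv1)
    (measurable_funB mv1 m1) J6 I6.
  by apply: intg_eq I => x /=; congr (_ ^+ 6); ring.
- have [_] := intg6D (measurable_funB (test_meas tf) mv1)
    (measurable_funB mv1 m1) J6 I6.
  under eq_Rintegral do rewrite addrA subrK.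
  by move/le_trans; apply; lra.
- move=> i; have [K2 ke2] := I2 i; have [L2' le2] := J2 i.
  have [mA A2] := L2D L2' K2.
  have B2 : L2 m (fun x => partial i f x - u.2 i x).
    split; first exact: measurable_funB (test_meas (test_partial i tf)) (m2 i).
    by apply: intg_eq A2 => x /=; congr (_ ^+ 2); ring.
  split=> //.
  have := sqD_le L2' K2.
  rewrite (_ : (fun x => _ + _) = fun x => partial i f x - u.2 i x); last first.
    by apply/funext => x; ring.
  by move/le_trans; apply; lra.
Qed.

Lemma D12B u v : D12 u -> D12 v -> D12 (u - v).
Proof.
move=> /D12P[mu1 mu2 hu] /D12P[mv1 mv2 hv]; apply/D12P; split.
- exact: measurable_funB.
- by move=> i; exact: measurable_funB.
move=> e e0; have e64 : 0 < e / 64 by rewrite divr_gt0.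
have [f [tf I6 le6 I2]] := hu _ e64.
have [g [tg J6 je6 J2]] := hv _ e64.
have J6' : intg m (fun x => (v.1 x - g x) ^+ 6).
  by apply: intg_eq J6 => x; ring.
have je6' : \int[m]_x (v.1 x - g x) ^+ 6 <= e / 64.
  by apply: le_trans je6; rewrite le_eqVlt; apply/orP; left; apply/eqP;
    apply: eq_Rintegral => x _; ring.
have fgE : (fun x => f x - u.1 x + (v.1 x - g x)) = fun x => f x - g x - (u - v).1 x.
  by apply/funext => x /=; rewrite !fctE; ring.
have [K6 ke6] := intg6D (measurable_funB (test_meas tf) mu1)
    (measurable_funB mv1 (test_meas tg)) I6 J6'.
exists (fun x => f x - g x); split.
- exact: testB.
- by apply: intg_eq K6 => x; have /(congr1 (fun h => h x ^+ 6)) := fgE.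
- rewrite (_ : (fun x => (f x - g x - (u - v).1 x) ^+ 6) =
    fun x => (f x - u.1 x + (v.1 x - g x)) ^+ 6); last first.
    by apply/funext => x; have /(congr1 (fun h => h x ^+ 6)) := fgE.
  by apply: le_trans ke6 _; lra.
- move=> i; have [LI leI] := I2 i; have [LJ leJ] := J2 i.
  rewrite partialB; [|exact: smooth_derivable tf.1 _|exact: smooth_derivable tg.1 _].
  rewrite (_ : (fun x => _ - (u - v).2 i x) = fun x => (partial i f x - u.2 i x)
    - (partial i g x - v.2 i x)); last first.
    by apply/funext => x /=; rewrite !fctE; ring.
  split; first exact: L2B.
  have := sqD_le LI (L2Z (-1) LJ).
  rewrite (_ : sq (fun x => -1 * _) = sq (fun x => partial i g x - v.2 i x)); last first.
    by apply: eq_Rintegral => x _; ring.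
  rewrite (_ : (fun x => _ + -1 * _) = fun x => (partial i f x - u.2 i x)
    - (partial i g x - v.2 i x)); last by apply/funext => x; ring.
  by move/le_trans; apply; lra.
Qed.

(** The product h u with the gradient that Leibniz's rule gives it. *)
Definition gmul (h : R3 R -> R) u : gfun R :=
  (fun x => u.1 x * h x, fun i x => u.1 x * partial i h x + h x * u.2 i x).

(** If f approximates u, then f h approximates h u: the critical term is
    (f - u) grad h, where f - u is small in L^6 only. Where (f - u)^2 <= s its
    square is at most s |grad h|^2, and elsewhere it is at most
    (B / s)^2 (f - u)^6; both integrals are small for a good choice of s. *)
Lemma D12_gmul h B u : smooth h -> (forall x, `|h x| <= 1) -> 0 < B ->
  (forall i x, `|partial i h x| <= B) -> (forall i, L2 m (partial i h)) ->
  D12 u -> D12 (gmul h u).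
Proof.
move=> sh h1 B0 dhB Ldh /D12P[m1 m2 H]; apply/D12P.
have mh := continuous_measurable3 (smooth_continuous sh).
have mdh i := continuous_measurable3 (smooth_continuous (smooth_partial i sh)).
split => [|i|e e0].
- exact: measurable_funM.
- by apply: measurable_funD; apply: measurable_funM.
pose S := 1 + \sum_(i < 3) sq (partial i h).
have S1 : 1 <= S by rewrite lerDl sumr_ge0// => i _; exact: sq_ge0.
have S0 : 0 < S by exact: lt_le_trans S1.
have Si i : sq (partial i h) <= S.
  by rewrite /S (bigD1 i)//= addrCA lerDl addr_ge0// sumr_ge0// => j _; exact: sq_ge0.
(* s is the threshold separating small and large values of (f - u)^2; t is
   the precision that the large values require *)
pose s := e / (8 * S).
have s0 : 0 < s by rewrite divr_gt0// mulr_gt0.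
pose t := Num.min (e / 4) (e * s ^+ 2 / (8 * B ^+ 2)).
have t0 : 0 < t.
  rewrite lt_min divr_gt0//= divr_gt0// mulr_gt0// exprn_gt0//.
have t1 : t <= e / 4 by rewrite ge_min lexx.
have t2 : t <= e * s ^+ 2 / (8 * B ^+ 2) by rewrite ge_min lexx orbT.
have [f [tf I6 le6 I2]] := H t t0.
exists (fun x => f x * h x); split.
- exact: testM.
- apply: (le_intg _ _ I6) => [|x].
    by apply: measurable_funX; apply: measurable_funB; apply: measurable_funM => //;
      exact: test_meas.
  rewrite ger0_norm ?pow6_ge0// /= -mulrBl exprMn ler_piMr ?pow6_ge0//.
  by rewrite -norm6 exprn_ile1.
- apply: le_trans (_ : t <= e); last by apply: (le_trans t1); lra.
  apply: le_trans le6; apply: le_Int => //; last first.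
    move=> x; rewrite /= -mulrBl exprMn ler_piMr ?pow6_ge0//.
    by rewrite -norm6 exprn_ile1.
  apply: (le_intg _ _ I6) => [|x].
    by apply: measurable_funX; apply: measurable_funB; apply: measurable_funM => //;
      exact: test_meas.
  rewrite ger0_norm ?pow6_ge0// /= -mulrBl exprMn ler_piMr ?pow6_ge0//.
  by rewrite -norm6 exprn_ile1.
- move=> i; have [LI leI] := I2 i.
  rewrite partialM; [|exact: smooth_derivable tf.1 _|exact: smooth_derivable sh _].
  rewrite (_ : (fun x => _ - _) = fun x => h x * (partial i f x - u.2 i x)
    + (f x - u.1 x) * partial i h x); last by apply/funext => x /=; ring.
  have mf1 : measurable_fun setT (fun x => f x - u.1 x).
    by apply: measurable_funB => //; exact: test_meas.
  have L1 : L2 m (fun x => h x * (partial i f x - u.2 i x)).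
    by apply: (L2_bounded LI mh) (aeW _ _) => x; exact: h1.
  have key x : ((f x - u.1 x) * partial i h x) ^+ 2 <=
      s * partial i h x ^+ 2 + B ^+ 2 / s ^+ 2 * (f x - u.1 x) ^+ 6.
    set a := f x - u.1 x; set b := partial i h x.
    have bB : b ^+ 2 <= B ^+ 2.
      by rewrite -norm2 ler_pXn2r ?nnegrE ?normr_ge0 ?(ltW B0) ?dhB.
    have b2 := sqr_ge0 b; have a2 := sqr_ge0 a.
    rewrite exprMn; have [as_|sa] := leP (a ^+ 2) s.
      rewrite -[leLHS]addr0 lerD ?ler_wpM2r// mulr_ge0 ?pow6_ge0//.
      by rewrite divr_ge0// exprn_ge0// ltW.
    rewrite -[leLHS]add0r lerD//; first by rewrite mulr_ge0// ltW.
    apply: (@le_trans _ _ (a ^+ 2 * B ^+ 2)); first by rewrite ler_wpM2l.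
    rewrite [leRHS]mulrAC ler_pdivlMr ?exprn_gt0//.
    have -> : a ^+ 6 = a ^+ 2 * (a ^+ 2) ^+ 2 by ring.
    rewrite [X in X * _]mulrC -mulrA ler_wpM2l ?sqr_ge0// ler_wpM2l//.
    by rewrite ler_sqr ?nnegrE// ltW.
  have I3 : intg m (fun x => s * partial i h x ^+ 2
      + B ^+ 2 / s ^+ 2 * (f x - u.1 x) ^+ 6).
    by apply: intgD; apply: intgZ => //; exact: (Ldh i).2.
  have L2' : L2 m (fun x => (f x - u.1 x) * partial i h x).
    split; first exact: measurable_funM.
    apply: (le_intg _ _ I3) => [|x].
      by apply: measurable_funX; exact: measurable_funM.
    by rewrite ger0_norm ?sqr_ge0.
  split; first exact: L2D.
  apply: le_trans (sqD_le L1 L2') _.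
  have le1 : sq (fun x => h x * (partial i f x - u.2 i x)) <= t.
    apply: le_trans leI; apply: le_Int; [exact: L1.2|exact: LI.2|].
    by move=> x; rewrite exprMn ler_piMl ?sqr_ge0// -norm2 exprn_ile1.
  have le2 : sq (fun x => (f x - u.1 x) * partial i h x) <=
      s * S + B ^+ 2 / s ^+ 2 * t.
    apply: (@le_trans _ _ (\int[m]_x (s * partial i h x ^+ 2
      + B ^+ 2 / s ^+ 2 * (f x - u.1 x) ^+ 6))).
      by apply: le_Int => //; exact: L2'.2.
    rewrite IntD; [|exact: intgZ (Ldh i).2|exact: intgZ].
    rewrite !IntZ//; last exact: (Ldh i).2.
    apply: lerD; first by rewrite ler_wpM2l ?(ltW s0)//; exact: Si.
    by rewrite ler_wpM2l// divr_ge0// exprn_ge0// ltW.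
  have E1 : s * S = e / 8 by rewrite /s; field; rewrite gt_eqF.
  have E2 : B ^+ 2 / s ^+ 2 * t <= e / 8.
    apply: (@le_trans _ _ (B ^+ 2 / s ^+ 2 * (e * s ^+ 2 / (8 * B ^+ 2)))).
      by rewrite ler_wpM2l// divr_ge0// exprn_ge0// ltW.
    rewrite le_eqVlt; apply/orP; left; apply/eqP; field.
    by rewrite !gt_eqF.
  rewrite E1 in le2; lra.
Qed.

End D12_theory.

(** * Oscillation and iterated integrals *)

Section one_variable_averages.
Context d (T : measurableType d) (R : realType) (m : {measure set T -> \bar R}).
Variables (A : set T) (h : R).
Hypotheses (mA : measurable A) (Ah : m A = h%:E).

Lemma bounded_int C (f : T -> R) : measurable_fun setT f -> (forall x, `|f x| <= C) ->
  m.-integrable A (EFin \o f) /\ `|\int[m]_(x in A) f x| <= C * h.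
Proof.
move=> mf fC; have Aoo : (m A < +oo)%E by rewrite Ah ltry.
have If : m.-integrable A (EFin \o f).
  apply: measurable_bounded_integrable => //; first exact: measurable_funTS.
  exists C; split; first exact: num_real.
  by move=> M CM x _ /=; rewrite (le_trans (fC x))// ltW.
split=> //; rewrite -lee_fin EFin_normr_Rintegral//.
apply: le_trans (le_abse_integral _ mA _) _.
  by apply/measurable_EFinP; exact: measurable_funTS.
apply: (@le_trans _ _ (\int[m]_(x in A) (cst C%:E) x)%E); last first.
  by rewrite integral_cst// Ah EFinM.
apply: ge0_le_integral => //.
  by apply: measurableT_comp => //; apply/measurable_EFinP; exact: measurable_funTS.
by move=> x _; rewrite lee_fin.
Qed.

Lemma integral_shift c (f : T -> R) : m.-integrable A (EFin \o f) ->
  (\int[m]_(x in A) (f x + c)%:E = (\int[m]_(x in A) f x + c * h)%:E)%E.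
Proof.
move=> If.
have Ic : m.-integrable A (EFin \o cst c).
  apply: measurable_bounded_integrable => //.
    by rewrite Ah ltry.
  exists `|c|; split; first exact: num_real.
  by move=> M cM x _ /=; rewrite ltW.
have If' : m.-integrable A (fun x => (f x + c)%:E) by exact: (integrableD mA If Ic).
rewrite -(fineK (integrable_fin_num mA If')); congr (_%:E).
rewrite -[LHS]/(\int[m]_(x in A) (f x + c)) RintegralD//.
by rewrite Rintegral_cst// Ah.
Qed.

(** h f(s) is the integral of f plus that of t |-> f(s) - f(t), which is at
    most h c; integrate over s. *)
Lemma integral_oscillation (f : T -> R) (c : \bar R) : 0 < h ->
  m.-integrable A (EFin \o f) -> (0 <= c)%E ->
  (forall s t, A s -> A t -> (`|f s - f t|%:E <= c)%E) ->
  (\int[m]_(x in A) `|f x|%:E <= `|\int[m]_(x in A) f x|%:E + h%:E * c)%E.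
Proof.
move=> h0 If c0 fc.
case: c c0 fc => [c| |]// c0 fc; last by rewrite gt0_muley ?lte_fin// addey ?leey.
set F := \int[m]_(x in A) f x.
have mf : measurable_fun A f by apply/measurable_EFinP; exact: measurable_int If.
have Icst k : m.-integrable A (EFin \o cst k).
  apply: measurable_bounded_integrable => //.
    by rewrite Ah ltry.
  exists `|k|; split; first exact: num_real.
  by move=> M cM x _ /=; rewrite ltW.
have pt s : A s -> h * `|f s| <= `|F| + h * c.
  move=> As; have -> : h * `|f s| = `|\int[m]_(t in A) f s|.
    by rewrite Rintegral_cst// Ah/= normrM (gtr0_norm h0) mulrC.
  have Id : m.-integrable A (EFin \o (fun t => f s - f t)).
    exact: (integrableB mA (Icst (f s)) If).
  have -> : \int[m]_(t in A) f s = F + \int[m]_(t in A) (f s - f t).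
    by rewrite /F -RintegralD//; apply: eq_Rintegral => t _; ring.
  rewrite (le_trans (ler_normD _ _))// lerD2l.
  apply: le_trans (le_normr_Rintegral mA Id) _.
  apply: (@le_trans _ _ (\int[m]_(t in A) c)); last first.
    by rewrite Rintegral_cst// Ah mulrC.
  apply: le_Rintegral => //; first exact: integrable_norm.
  - exact: Icst.
  - by move=> t At; rewrite -lee_fin; exact: fc.
apply: (@le_trans _ _ (\int[m]_(x in A) (cst (`|F| / h + c)%:E x))%E).
  apply: ge0_le_integral => //.
  - by apply/measurable_EFinP; exact: measurableT_comp.
  - move=> x Ax; rewrite lee_fin -(ler_pM2l h0) mulrDr mulrCA divff ?gt_eqF// mulr1.
    exact: pt.
rewrite integral_cst// Ah -EFinM -EFinM -EFinD lee_fin le_eqVlt; apply/orP; left.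
by apply/eqP; field; rewrite gt_eqF.
Qed.

End one_variable_averages.

Section parametric_integrals.
Context d1 d2 (X : measurableType d1) (Y : measurableType d2) (R : realType).
Variable m2 : {sigma_finite_measure set Y -> \bar R}.

Lemma measurable_section1 (g : X * Y -> R) x : measurable_fun setT g ->
  measurable_fun setT (fun y => g (x, y)).
Proof. by move=> mg; apply: (measurableT_comp mg); exact: measurable_pair1. Qed.

Lemma measurable_param_int (B : set Y) (f : X * Y -> \bar R) : measurable B ->
  measurable_fun setT f -> (forall x, 0 <= f x)%E ->
  measurable_fun setT (fun x => \int[m2]_(y in B) f (x, y))%E.
Proof.
move=> mB mf f0; pose g := f \_ (setT `*` B).
have mg : measurable_fun setT g.
  apply: (measurable_restrictT _ _).1; first exact: measurableX.
  exact: measurable_funTS.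
have g0 x : (0 <= g x)%E by apply: erestrict_ge0.
have := measurable_fun_fubini_tonelli_F (m2 := m2) g mg g0.
apply: eq_measurable_fun => x _; rewrite /fubini_F [RHS]integral_mkcond.
apply: eq_integral => y _; rewrite /g !patchE.
by rewrite in_setX in_setT.
Qed.

Lemma measurable_param_Rint (B : set Y) (f : X * Y -> R) : measurable B ->
  measurable_fun setT f ->
  measurable_fun setT (fun x => \int[m2]_(y in B) f (x, y)).
Proof.
move=> mB mf; apply: measurableT_comp => //.
rewrite (_ : (fun x => _) = (fun x => \int[m2]_(y in B) ((EFin \o f)^\+ (x, y))
   - \int[m2]_(y in B) ((EFin \o f)^\- (x, y)))%E); last first.
  apply/funext => x; rewrite [LHS]integralE.
  by congr (_ - _)%E; apply: eq_integral => y _; rewrite ?funeposE ?funenegE.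
have mEf : measurable_fun setT (EFin \o f) by exact/measurable_EFinP.
apply: emeasurable_funB; apply: measurable_param_int => //.
- exact: measurable_funepos.
- exact: measurable_funeneg.
Qed.

Variable m1 : {sigma_finite_measure set X -> \bar R}.

Lemma integral_mkcond2 (A : set X) (B : set Y) (f : X * Y -> \bar R) :
  (\int[m1]_(x in A) \int[m2]_(y in B) f (x, y) =
   \int[m1]_x \int[m2]_y (f \_ (A `*` B)) (x, y))%E.
Proof.
rewrite integral_mkcond; apply: eq_integral => x _; rewrite patchE.
case: ifPn => xA.
  rewrite integral_mkcond; apply: eq_integral => y _; rewrite !patchE.
  by rewrite in_setX xA.
rewrite integral0_eq// => y _; rewrite patchE in_setX (negbTE xA)//.
Qed.

Lemma tonelli_swap (A : set X) (B : set Y) (f : X * Y -> \bar R) :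
  measurable A -> measurable B ->
  measurable_fun setT f -> (forall x, 0 <= f x)%E ->
  (\int[m1]_(x in A) \int[m2]_(y in B) f (x, y) =
   \int[m2]_(y in B) \int[m1]_(x in A) f (x, y))%E.
Proof.
move=> mA mB mf f0; rewrite integral_mkcond2.
pose g := f \_ (A `*` B).
have mg : measurable_fun setT g.
  apply: (measurable_restrictT _ _).1; first exact: measurableX.
  exact: measurable_funTS.
have g0 x : (0 <= g x)%E by apply: erestrict_ge0.
rewrite (fubini_tonelli (m1 := m1) (m2 := m2) g mg g0).
rewrite [RHS]integral_mkcond; apply: eq_integral => y _; rewrite patchE.
case: ifPn => yB.
  rewrite [RHS]integral_mkcond; apply: eq_integral => x _; rewrite /g !patchE.
  by rewrite in_setX yB andbT.
by rewrite integral0_eq// => x _; rewrite /g patchE in_setX (negbTE yB) andbF.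
Qed.

End parametric_integrals.

(** * Poincare's inequality for test functions *)

Section oscillation_on_lines.
Context (R : realType).
Local Notation mu := (@lebesgue_measure R).
Variables (i : 'I_3) (p : R -> R3 R).
(** p runs along a line parallel to the i-th axis. *)
Hypothesis pline : forall h r, p (h + r) = h *: basis3 R i + p r.

Lemma line_derive (f : R3 R -> R) : smooth f -> forall r,
  derivable (f \o p) r 1 /\ derive1 (f \o p) r = partial i f (p r).
Proof.
move=> sf r.
have E : (fun h : R => h^-1 *: (((f \o p) \o shift r) (h *: (1 : R)) - (f \o p) r)) =
   (fun h : R => h^-1 *: ((f \o shift (p r)) (h *: basis3 R i) - f (p r))).
  apply/funext => h; congr (_ *: (_ - _)).
  rewrite /= -pline; congr (f (p (_ + _))).
  by rewrite /GRing.scale/= mulr1.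
split.
  by rewrite /derivable E; exact: smooth_derivable sf i (p r).
by rewrite derive1E /partial /derive E.
Qed.

Lemma line_continuous (f : R3 R -> R) : smooth f -> continuous (f \o p).
Proof.
move=> sf r; apply/differentiable_continuous/derivable1_diffP.
by have [] := line_derive sf r.
Qed.

(** The fundamental theorem of calculus on the line. *)
Lemma oscillation_line (f : R3 R -> R) a b s t : smooth f ->
  `[a, b[%classic s -> `[a, b[%classic t ->
  (`|f (p s) - f (p t)|%:E <=
    \int[mu]_(r in `[a, b[) `|partial i f (p r)|%:E)%E.
Proof.
move=> sf.
have cD := line_continuous (smooth_partial i sf).
have cN : continuous (fun r => `|partial i f (p r)|).
  by move=> r; apply: cvg_norm; exact: cD.
have mN : measurable_fun setT (fun r => `|partial i f (p r)|%:E).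
  by apply/measurable_EFinP; exact: continuous_measurable_fun.
wlog st : s t / s < t.
  move=> H As At; have [st|ts|->] := ltgtP s t.
  - exact: H.
  - by rewrite distrC; exact: H.
  - by rewrite subrr normr0; apply: integral_ge0 => r _; rewrite lee_fin.
rewrite /= !in_itv/= => /andP[as_ sb] /andP[at_ tb].
have FTC : (\int[mu]_(r in `[s, t]) (partial i f (p r))%:E =
    (f (p t))%:E - (f (p s))%:E)%E.
  apply: (@continuous_FTC2 _ (fun r => partial i f (p r)) (f \o p)) => //.
  - exact: continuous_subspaceT.
  - split.
    + by move=> r _; case: (line_derive sf r).
    + by apply: cvg_at_right_filter; exact: line_continuous.
    + by apply: cvg_at_left_filter; exact: line_continuous.
  - by move=> r _; case: (line_derive sf r).
rewrite distrC -abse_EFin EFinB -FTC.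
apply: le_trans (le_abse_integral _ _ _) _ => //.
  apply/measurable_EFinP; apply: measurable_funTS.
  exact: continuous_measurable_fun.
apply: ge0_subset_integral => //.
- exact: measurable_funTS.
- by move=> r; rewrite /= !in_itv/= => /andP[sr rt]; rewrite (le_trans as_)//= (le_lt_trans rt).
Qed.

End oscillation_on_lines.

Lemma sume_ord3 (R : realType) (a : 'I_3 -> \bar R) :
  (\sum_(i < 3) a i = a (inord 0) + (a (inord 1) + a (inord 2)))%E.
Proof.
rewrite !big_ord_recl big_ord0 adde0.
have i0 : inord 0 = ord0 :> 'I_3 by apply/val_inj; rewrite /= inordK.
have i1 : inord 1 = lift ord0 ord0 :> 'I_3 by apply/val_inj; rewrite /= inordK.
have i2 : inord 2 = lift ord0 (lift ord0 ord0) :> 'I_3 by apply/val_inj; rewrite /= inordK.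
by rewrite i0 i1 i2.
Qed.

Lemma distr3 (R : realType) (h : R) (a g0 g1 g2 : \bar R) : 0 <= h ->
  (0 <= g0 -> 0 <= g1 -> 0 <= g2 ->
   a + h%:E * g0 + h%:E * g1 + h%:E * g2 = a + h%:E * (g0 + (g1 + g2)))%E.
Proof. by move=> h0 g00 g10 g20; rewrite !ge0_muleDr ?adde_ge0// !addeA. Qed.

Section poincare_cube.
Context (R : realType).
Local Notation mu := (@lebesgue_measure R).
Local Notation m := (leb3 R).
Local Notation RM := (measurableTypeR R).

Lemma rect_tonelli (I J K : set RM) (f : R3 R -> \bar R) : measurable I ->
  measurable J -> measurable K -> measurable_fun setT f -> (forall x, 0 <= f x)%E ->
  (\int[m]_(x in rect I J K) f x =
   \int[mu]_(x in I) \int[mu]_(y in J) \int[mu]_(z in K) f (x, y, z))%E.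
Proof.
move=> mI mJ mK mf f0; pose g := f \_ (rect I J K).
have mg : measurable_fun setT g.
  apply: (measurable_restrictT _ _).1; first exact: measurable_rect.
  exact: measurable_funTS.
have g0 x : (0 <= g x)%E by apply: erestrict_ge0.
rewrite integral_mkcond (tonelli3 mg g0).
rewrite [RHS]integral_mkcond; apply: eq_integral => x _; rewrite patchE.
have gE y z : g (x, y, z) = if (x \in I) && (y \in J) && (z \in K) then f (x, y, z) else 0%E.
  by rewrite /g patchE /rect !in_setX.
case: ifPn => xI; last first.
  rewrite integral0_eq// => y _; rewrite integral0_eq// => z _.
  by rewrite gE (negbTE xI).
rewrite [RHS]integral_mkcond; apply: eq_integral => y _; rewrite patchE.
case: ifPn => yJ; last first.
  by rewrite integral0_eq// => z _; rewrite gE (negbTE yJ) andbF.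
rewrite [RHS]integral_mkcond; apply: eq_integral => z _; rewrite patchE.
by rewrite gE xI yJ.
Qed.

Definition grad1 (D : 'I_3 -> R3 R -> R) (x : R3 R) : R := \sum_(i < 3) `|D i x|.

Variables (h : R) (a b c : R).
Hypothesis h0 : 0 < h.
Let I : set RM := `[a, a + h[%classic.
Let J : set RM := `[b, b + h[%classic.
Let K : set RM := `[c, c + h[%classic.

Let side (t : R) : mu `[t, t + h[%classic = h%:E.
Proof.
rewrite lebesgue_measure_itv/= lte_fin ltrDl h0 -EFinD; congr (_%:E); ring.
Qed.

Let mI : measurable I. Proof. exact: measurable_itv. Qed.
Let mJ : measurable J. Proof. exact: measurable_itv. Qed.
Let mK : measurable K. Proof. exact: measurable_itv. Qed.
Let hI : mu I = h%:E := side a.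
Let hJ : mu J = h%:E := side b.
Let hK : mu K = h%:E := side c.

Let shift3 (k x1 x2 x3 y1 y2 y3 : R) :
  k *: ((x1, x2, x3) : R3 R) + (y1, y2, y3) = (k * x1 + y1, k * x2 + y2, k * x3 + y3).
Proof. by []. Qed.

(** Poincare's inequality on a cube of side h. The function f is averaged over
    the last variable, then over the second one, then over the first one. Each
    averaging costs, by [integral_oscillation], the oscillation along a line,
    hence h times the integral of the partial derivative in that direction.
    Tonelli's theorem puts the iterated integrals back together. *)
Lemma poincare_test (f : R3 R -> R) : test_function f ->
  (\int[m]_(x in rect I J K) `|f x|%:E <=
     `|\int[m]_(x in rect I J K) f x|%:E
     + h%:E * \int[m]_(x in rect I J K) (grad1 (fun i => partial i f) x)%:E)%E.
Proof.
move=> tf; have [sf _] := tf.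
have [C [N [fC _]]] := test_bounded tf.
have mf := test_meas tf.
have C0 : 0 <= C by exact: le_trans (fC (0, 0, 0)).
have mD i : measurable_fun setT (fun x => `|partial i f x|%:E).
  by apply/measurable_EFinP; apply: measurableT_comp => //; exact: test_meas (test_partial i tf).
have D0 i x : (0 <= `|partial i f x|%:E)%E by rewrite lee_fin.
have mfe : measurable_fun setT (fun x => `|f x|%:E).
  by apply/measurable_EFinP; exact: measurableT_comp.
have fe0 x : (0 <= `|f x|%:E)%E by rewrite lee_fin.
(* F3 and F2 integrate f over the last variable and over the last two; up to
   powers of h they are its successive averages *)
pose F3 (q : RM * RM) := \int[mu]_(z in K) f (q, z).
pose F2 (x : RM) := \int[mu]_(y in J) F3 (x, y).
have mF3 : measurable_fun setT F3 by apply: measurable_param_Rint.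
have F3C q : `|F3 q| <= C * h.
  by have [] := bounded_int mK hK (measurable_section1 q mf) (fun z => fC (q, z)).
have mF2 : measurable_fun setT F2 by apply: measurable_param_Rint.
have F2C x : `|F2 x| <= C * h * h.
  by have [] := bounded_int mJ hJ (measurable_section1 x mF3) (fun y => F3C (x, y)).
have If q : mu.-integrable K (EFin \o (fun z => f (q, z))).
  by have [] := bounded_int mK hK (measurable_section1 q mf) (fun z => fC (q, z)).
have IF3 x : mu.-integrable J (EFin \o (fun y => F3 (x, y))).
  by have [] := bounded_int mJ hJ (measurable_section1 x mF3) (fun y => F3C (x, y)).
have IF2 : mu.-integrable I (EFin \o F2).
  by have [] := bounded_int mI hI mF2 F2C.
(* f is bounded, so Fubini for f follows from Tonelli for f + C >= 0 *)
have mIJK : measurable (rect I J K) by exact: measurable_rect.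
have hQ : m (rect I J K) = (h * h * h)%:E by rewrite leb3_rect// hI hJ hK.
have [IfQ _] := bounded_int mIJK hQ mf fC.
have FE : \int[m]_(x in rect I J K) f x = \int[mu]_(x in I) F2 x.
  have fp x : (0 <= (f x + C)%:E)%E.
    by rewrite lee_fin; have := fC x; rewrite ler_norml; lra.
  have := integral_shift mIJK hQ C IfQ; rewrite rect_tonelli//; last first.
    by apply/measurable_EFinP; exact: measurable_funD.
  rewrite (_ : (\int[mu]_(x in I) _)%E =
    (\int[mu]_(x in I) (F2 x + C * h * h)%:E)%E); last first.
    apply: eq_integral => x _.
    rewrite -(integral_shift mJ hJ (C * h) (IF3 x)); apply: eq_integral => y _.
    exact: (integral_shift mK hK C (If (x, y))).
  rewrite (integral_shift mI hI (C * h * h) IF2) => -[].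
  by rewrite !mulrA => /addIr.
pose P i (q : RM * RM) := (\int[mu]_(z in K) `|partial i f (q, z)|%:E)%E.
have mP i : measurable_fun setT (P i).
  exact: (measurable_param_int _ (f := fun x : R3 R => `|partial i f x|%:E) mK (mD _)).
have P0 i q : (0 <= P i q)%E by apply: integral_ge0.
have mPx i x : measurable_fun setT (fun y => P i (x, y)).
  by apply: (measurableT_comp (mP i)); exact: measurable_pair1.
pose Q i (x : RM) := (\int[mu]_(y in J) P i (x, y))%E.
have mQ i : measurable_fun setT (Q i) by exact: measurable_param_int.
have Q0 i x : (0 <= Q i x)%E by apply: integral_ge0.
pose G i := (\int[mu]_(x in I) Q i x)%E.
have step3 q : (\int[mu]_(z in K) `|f (q, z)|%:E <=
    `|F3 q|%:E + h%:E * \int[mu]_(z in K) `|partial (inord 2) f (q, z)|%:E)%E.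
  apply: (integral_oscillation mK hK h0 (If q)) => [|s t Ks Kt].
    by apply: integral_ge0.
  apply: (@oscillation_line _ (inord 2) (fun z => (q, z))) => // r s'.
  by case: q => q1 q2; rewrite /basis3 inordK//= shift3 !mulr0 mulr1 !add0r.
(* the oscillation of F3 in its last variable is estimated under the integral,
   for each fixed z, before exchanging the integrals over y and z *)
have mpair2 (x : RM) : measurable_fun setT (fun q : RM * RM => (x, q.1, q.2)).
  apply: measurable_fun_pair => /=; last exact: measurable_snd.
  by apply: measurable_fun_pair => //; exact: measurable_fst.
have mP2 x : measurable_fun setT (fun q : RM * RM => `|partial (inord 1) f (x, q.1, q.2)|%:E).
  exact: (measurableT_comp (mD (inord 1)) (mpair2 x)).
have mf2 x : measurable_fun setT (fun q : RM * RM => f (x, q.1, q.2)).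
  exact: (measurableT_comp mf (mpair2 x)).
have diffF3 q q' : (`|F3 q - F3 q'|%:E <= \int[mu]_(z in K) `|f (q, z) - f (q', z)|%:E)%E.
  rewrite /F3 -RintegralB// EFin_normr_Rintegral//; last exact: (integrableB mK (If q) (If q')).
  apply: le_abse_integral => //; apply/measurable_EFinP; apply: measurable_funTS.
  by apply: measurable_funB; exact: measurable_section1.
have step2 x : (\int[mu]_(y in J) `|F3 (x, y)|%:E <=
    `|F2 x|%:E + h%:E * \int[mu]_(y in J) \int[mu]_(z in K)
       `|partial (inord 1) f (x, y, z)|%:E)%E.
  apply: (integral_oscillation mJ hJ h0 (IF3 x)) => [|s t Js Jt].
    by apply: integral_ge0 => y _; apply: integral_ge0.
  apply: (le_trans (diffF3 _ _)).
  rewrite (tonelli_swap mu mu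
    (f := fun q : RM * RM => `|partial (inord 1) f (x, q.1, q.2)|%:E) mJ mK)//.
  apply: ge0_le_integral => //.
  - apply/measurable_EFinP/measurable_funTS/measurableT_comp => //.
    by apply: measurable_funB; exact: measurable_section1.
  - apply: measurable_funTS.
    apply: (measurable_param_int mu (f := fun q : RM * RM => `|partial (inord 1) f (x, q.2, q.1)|%:E) mJ) => //.
    apply: (measurableT_comp (mD (inord 1))).
    apply: measurable_fun_pair => /=; last exact: measurable_fst.
    by apply: measurable_fun_pair => //; exact: measurable_snd.
  - move=> z _; apply: (@oscillation_line _ (inord 1) (fun y => (x, y, z))) => // r s'.
    by rewrite /basis3 inordK//= shift3 !mulr0 mulr1 !add0r.
have diffF2 x x' : (`|F2 x - F2 x'|%:E <=
    \int[mu]_(y in J) \int[mu]_(z in K) `|f (x, y, z) - f (x', y, z)|%:E)%E.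
  rewrite /F2 -RintegralB// EFin_normr_Rintegral//; last first.
    exact: (integrableB mJ (IF3 x) (IF3 x')).
  apply: (@le_trans _ _ (\int[mu]_(y in J) `|F3 (x, y) - F3 (x', y)|%:E)%E).
    apply: le_abse_integral => //; apply/measurable_EFinP; apply: measurable_funTS.
    by apply: measurable_funB; exact: measurable_section1.
  apply: ge0_le_integral => //.
  - apply/measurable_EFinP/measurable_funTS/measurableT_comp => //.
    by apply: measurable_funB; exact: measurable_section1.
  - apply: measurable_funTS.
    apply: (measurable_param_int mu (f := fun q : RM * RM =>
      `|f (x, q.1, q.2) - f (x', q.1, q.2)|%:E) mK) => //.
    by apply/measurable_EFinP/measurableT_comp => //; exact: measurable_funB.
have step1 : (\int[mu]_(x in I) `|F2 x|%:E <=
    `|\int[mu]_(x in I) F2 x|%:E + h%:E * G (inord 0))%E.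
  apply: (integral_oscillation mI hI h0 IF2) => [|s t Is It].
    by apply: integral_ge0 => x _; apply: integral_ge0 => y _.
  apply: (le_trans (diffF2 _ _)).
  rewrite /G (tonelli_swap mu mu (f := P (inord 0)) mI mJ)//.
  apply: ge0_le_integral => //.
  - by move=> y _; apply: integral_ge0.
  - apply: measurable_funTS.
    apply: (measurable_param_int mu (f := fun q : RM * RM =>
      `|f (s, q.1, q.2) - f (t, q.1, q.2)|%:E) mK) => //.
    by apply/measurable_EFinP/measurableT_comp => //; exact: measurable_funB.
  - apply: measurable_funTS.
    apply: (measurable_param_int mu (f := fun q : RM * RM => P (inord 0) (q.2, q.1)) mI) => //.
    by apply: (measurableT_comp (mP (inord 0))); exact: measurable_swap.
  move=> y _; rewrite /P.
  have mD0 : measurable_fun setT (fun q : RM * RM => `|partial (inord 0) f (q.1, y, q.2)|%:E).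
    apply: (measurableT_comp (mD (inord 0))).
    apply: measurable_fun_pair => /=; last exact: measurable_snd.
    by apply: measurable_fun_pair => //; exact: measurable_fst.
  rewrite (tonelli_swap mu mu
    (f := fun q : RM * RM => `|partial (inord 0) f (q.1, y, q.2)|%:E) mI mK)//.
  apply: ge0_le_integral => //.
  - apply/measurable_EFinP/measurable_funTS/measurableT_comp => //.
    by apply: measurable_funB; exact: measurable_section1.
  - apply: measurable_funTS.
    apply: (measurable_param_int mu (f := fun q : RM * RM => `|partial (inord 0) f (q.2, y, q.1)|%:E) mI) => //.
    apply: (measurableT_comp (mD (inord 0))).
    apply: measurable_fun_pair => /=; last exact: measurable_fst.
    by apply: measurable_fun_pair => //; exact: measurable_snd.
  - move=> z _; apply: (@oscillation_line _ (inord 0) (fun x => (x, y, z))) => // r s'.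
    by rewrite /basis3 inordK//= shift3 !mulr0 mulr1 !add0r.
have intDZ (A : set RM) (u v : RM -> \bar R) : measurable A ->
    measurable_fun setT u -> measurable_fun setT v ->
    (forall x, 0 <= u x)%E -> (forall x, 0 <= v x)%E ->
    (\int[mu]_(x in A) (u x + h%:E * v x) =
     \int[mu]_(x in A) u x + h%:E * \int[mu]_(x in A) v x)%E.
  move=> mA mu_ mv u0 v0; rewrite ge0_integralD//.
  - congr (_ + _)%E; rewrite ge0_integralZl//; first exact: measurable_funTS.
    by rewrite lee_fin ltW.
  - exact: measurable_funTS.
  - by move=> x _; rewrite mule_ge0// lee_fin ltW.
  - by apply: measurable_funeM; exact: measurable_funTS.
have GE i : (\int[m]_(x in rect I J K) `|partial i f x|%:E = G i)%E.
  exact: (rect_tonelli mI mJ mK (mD i) (D0 i)).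
have sum3 : (\int[m]_(x in rect I J K) (grad1 (fun i => partial i f) x)%:E =
    G (inord 0) + (G (inord 1) + G (inord 2)))%E.
  transitivity (\sum_(i < 3) G i)%E.
    rewrite -(eq_bigr _ (fun i _ => GE i)) -ge0_integral_sum//; last first.
      by move=> i; apply: measurable_funTS.
    by apply: eq_integral => x _; rewrite /grad1 sumEFin.
  exact: sume_ord3.
rewrite (rect_tonelli mI mJ mK mfe fe0) sum3 FE.
have chain2 x : (\int[mu]_(y in J) \int[mu]_(z in K) `|f (x, y, z)|%:E <=
    `|F2 x|%:E + h%:E * Q (inord 1) x + h%:E * Q (inord 2) x)%E.
  have m3 : measurable_fun setT (fun y : RM => `|F3 (x, y)|%:E).
    apply/measurable_EFinP/measurableT_comp => //; exact: measurable_section1.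
  have mhP : measurable_fun setT (fun y : RM => h%:E * P (inord 2) (x, y))%E.
    by apply: measurable_funeM; exact: mPx.
  apply: (@le_trans _ _ (\int[mu]_(y in J) (`|F3 (x, y)|%:E + h%:E * P (inord 2) (x, y)))%E).
    apply: ge0_le_integral; [exact: mJ| | | |by move=> y _; exact: step3].
    - by move=> y _; apply: integral_ge0.
    - apply: measurable_funTS.
      exact: (measurable_param_int mu (f := fun q : RM * RM => `|f (x, q.1, q.2)|%:E) mK
        (measurableT_comp mfe (mpair2 x))).
    - by apply: measurable_funTS; exact: (emeasurable_funD m3 mhP).
  have p3 y : (0 <= `|F3 (x, y)|%:E)%E by rewrite lee_fin.
  have E := intDZ J _ _ mJ m3 (mPx (inord 2) x) p3 (fun y => P0 (inord 2) (x, y)).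
  by rewrite E; exact: (leeD (step2 x) (lexx _)).
have mF2e : measurable_fun setT (fun x : RM => `|F2 x|%:E).
  by apply/measurable_EFinP/measurableT_comp.
have mhQ i : measurable_fun setT (fun x => h%:E * Q i x)%E.
  by apply: measurable_funeM; exact: mQ.
have hQ0 i x : (0 <= h%:E * Q i x)%E by rewrite mule_ge0// lee_fin ltW.
have F2e0 x : (0 <= `|F2 x|%:E)%E by rewrite lee_fin.
pose U (x : RM) := (`|F2 x|%:E + h%:E * Q (inord 1) x)%E.
have mU : measurable_fun setT U by exact: emeasurable_funD.
have U0 x : (0 <= U x)%E by exact: adde_ge0.
have E1 := intDZ I U (Q (inord 2)) mI mU (mQ _) U0 (Q0 _).
have E2 := intDZ I _ (Q (inord 1)) mI mF2e (mQ _) F2e0 (Q0 _).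
apply: (@le_trans _ _ (\int[mu]_(x in I) (U x + h%:E * Q (inord 2) x))%E).
  apply: ge0_le_integral; [exact: mI| | | |by move=> x _; exact: chain2].
  - by move=> x _; apply: integral_ge0 => y _; apply: integral_ge0.
  - apply: measurable_funTS.
    apply: (measurable_param_int mu (f := fun q : RM * RM => (\int[mu]_(z in K) `|f (q, z)|%:E)%E) mJ).
      exact: (measurable_param_int mu (f := fun q : R3 R => `|f q|%:E) mK mfe fe0).
    by move=> q; apply: integral_ge0.
  - by apply: measurable_funTS; exact: (emeasurable_funD mU (mhQ _)).
have G0 i : (0 <= G i)%E by apply: integral_ge0.
have E12 : (\int[mu]_(x in I) (U x + h%:E * Q (inord 2) x) =
    \int[mu]_(x in I) `|F2 x|%:E + h%:E * G (inord 1) + h%:E * G (inord 2))%E.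
  exact: (etrans E1 (congr1 (fun w => w + h%:E * G (inord 2))%E E2)).
rewrite E12 -(distr3 _ (ltW h0) (G0 (inord 0)) (G0 (inord 1)) (G0 (inord 2))).
exact: (leeD (leeD step1 (lexx _)) (lexx _)).
Qed.
End poincare_cube.

(** * Poincare's inequality in D^{1,2} *)

Section set_integrals.
Context d (T : measurableType d) (R : realType) (m : {measure set T -> \bar R}).

Lemma intg_setS (f : T -> R) Q : measurable Q -> intg m f ->
  m.-integrable Q (EFin \o f).
Proof. by move=> mQ; apply: integrableS. Qed.

(** On a set of finite measure an L^k bound gives an L^1 bound: s absorbs
    the small values of f and c g the large ones. *)
Lemma integral_control (Q : set T) (v s c : R) (f g : T -> R) : measurable Q ->
  m Q = v%:E -> measurable_fun setT f -> intg m g -> (forall x, 0 <= g x) ->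
  0 <= c -> 0 <= s -> (forall x, `|f x| <= s + c * g x) ->
  m.-integrable Q (EFin \o f) /\
  \int[m]_(x in Q) `|f x| <= s * v + c * \int[m]_x g x.
Proof.
move=> mQ mv mf Ig g0 c0 s0 fg.
have Is : m.-integrable Q (EFin \o cst s).
  apply: measurable_bounded_integrable => //; first by rewrite mv ltry.
  exists `|s|; split; first exact: num_real.
  by move=> M cM x _ /=; rewrite ltW.
have Icg : m.-integrable Q (EFin \o (fun x => c * g x)).
  by apply: intg_setS => //; exact: intgZ.
have Isg : m.-integrable Q (EFin \o (fun x => s + c * g x)).
  exact: (integrableD mQ Is Icg).
have If : m.-integrable Q (EFin \o f).
  apply: (le_integrable mQ _ _ Isg).
    by apply/measurable_EFinP; exact: measurable_funTS.
  by move=> x _; rewrite /= lee_fin (le_trans (fg x))// ler_norm.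
split=> //.
apply: (@le_trans _ _ (\int[m]_(x in Q) (s + c * g x))).
  by apply: le_Rintegral => //; exact: integrable_norm.
rewrite RintegralD// Rintegral_cst// mv lerD2l.
rewrite RintegralZl//; last exact: intg_setS.
rewrite ler_wpM2l// /Rintegral fine_le//.
- by apply: integrable_fin_num => //; exact: intg_setS.
- exact: integrable_fin_num.
- apply: ge0_subset_integral => //; first exact: measurable_int Ig.
  by move=> x _; rewrite lee_fin.
Qed.

Lemma L2_integrable Q v (f : T -> R) : measurable Q -> m Q = v%:E -> L2 m f ->
  m.-integrable Q (EFin \o f).
Proof.
move=> mQ mv [mf If].
have [||||I _] := @integral_control Q v 1 1 f (fun x => f x ^+ 2) mQ mv mf If.
- by move=> x; exact: sqr_ge0.
- exact: ler01.
- exact: ler01.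
- move=> x; rewrite mul1r -[f x ^+ 2]real_normK ?num_real//.
  have := sqr_ge0 (`|f x| - 1); have := normr_ge0 (f x); nra.
- exact: I.
Qed.

End set_integrals.

(** Either |a| <= s, or (|a| / s)^k >= 1. *)
Lemma young_pow (R : realType) (s a : R) k : 0 < s ->
  `|a| <= s + s ^- k * `|a| ^+ k.+1.
Proof.
move=> s0; have [as_|sa] := leP `|a| s.
  by rewrite (le_trans as_)// lerDl mulr_ge0 ?invr_ge0 ?exprn_ge0// ltW.
rewrite (le_trans _ (_ : s ^- k * `|a| ^+ k.+1 <= _))//; last by rewrite lerDr ltW.
rewrite exprSr mulrA ler_peMl// mulrC ler_pdivlMr ?exprn_gt0// mul1r.
by rewrite lerXn2r ?nnegrE// ltW.
Qed.

Section poincare_D12.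
Context (R : realType).
Local Notation m := (leb3 R).
Local Notation RM := (measurableTypeR R).

Definition box (a b c h : R) : set (R3 R) :=
  rect (`[a, a + h[%classic : set RM) `[b, b + h[%classic `[c, c + h[%classic.

Lemma measurable_box a b c h : measurable (box a b c h).
Proof. by apply: measurable_rect; exact: measurable_itv. Qed.

Lemma side_measure (h t : R) : 0 < h ->
  @lebesgue_measure R (`[t, t + h[%classic) = h%:E.
Proof.
by move=> h0; rewrite lebesgue_measure_itv/= lte_fin ltrDl h0 -EFinD; congr (_%:E); ring.
Qed.

Lemma box_measure a b c h : 0 < h -> m (box a b c h) = (h * h * h)%:E.
Proof.
by move=> h0; rewrite leb3_rect ?side_measure//; exact: measurable_itv.
Qed.

Lemma intg_grad1 (D : 'I_3 -> R3 R -> R) Q v : measurable Q -> m Q = v%:E ->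
  (forall i, L2 m (D i)) -> m.-integrable Q (EFin \o grad1 D).
Proof.
move=> mQ mv LD.
have E : EFin \o grad1 D = (fun x => \sum_(i < 3) (`|D i x|%:E))%E.
  by apply/funext => x; rewrite /grad1 /= sumEFin.
rewrite E; apply: integrable_sum => // i _.
exact: (integrable_norm (L2_integrable mQ mv (LD i))).
Qed.

Lemma Rint_grad1 (D : 'I_3 -> R3 R -> R) Q v : measurable Q -> m Q = v%:E ->
  (forall i, L2 m (D i)) ->
  \int[m]_(x in Q) grad1 D x = \sum_(i < 3) \int[m]_(x in Q) `|D i x|.
Proof.
move=> mQ mv LD; have ID i := integrable_norm (L2_integrable mQ mv (LD i)).
rewrite /Rintegral; under eq_integral do rewrite /grad1 -sumEFin.
rewrite integral_sum//.
rewrite (eq_bigr (fun i => (\int[m]_(x in Q) `|D i x|)%:E)); first by rewrite sumEFin.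
by move=> i _; rewrite /Rintegral fineK//; exact: (integrable_fin_num mQ (ID i)).
Qed.

(** The inequality for test functions passes to D^{1,2}: on a box of finite
    measure, closeness in L^6 of functions and in L^2 of gradients implies
    closeness in L^1 by [integral_control] and [young_pow]. *)
Lemma poincare_box a b c h (w : gfun R) : 0 < h -> D12 w -> L2 m w.1 ->
  \int[m]_(x in box a b c h) `|w.1 x| <=
    `|\int[m]_(x in box a b c h) w.1 x| + h * \int[m]_(x in box a b c h) grad1 w.2 x.
Proof.
move=> h0 Dw Lw; set Q := box a b c h.
have mQ : measurable Q by exact: measurable_box.
have mv : m Q = (h * h * h)%:E by exact: box_measure.
set v := h * h * h in mv.
have v0 : 0 < v by rewrite !mulr_gt0.
apply/ler_addgt0Pr => dl dl0.
(* the approximation costs C s + B e: s is chosen first, then the precision e,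
   since B depends on s *)
pose C := 2 * v + 3 * h * v.
have C0 : 0 < C by rewrite /C; have := mulr_gt0 h0 v0; nra.
pose s := dl / (2 * C).
have s0 : 0 < s by rewrite divr_gt0// mulr_gt0.
pose B := 2 * s ^- 5 + 3 * h * s ^- 1.
have B0 : 0 < B by rewrite addr_gt0// !mulr_gt0// invr_gt0 exprn_gt0.
pose e := dl / (2 * B).
have e0 : 0 < e by rewrite divr_gt0// mulr_gt0.
have [mw mw2 /(_ e e0)[f [tf I6 le6 I2]]] := (D12P w).1 Dw.
have mf := test_meas tf.
have [IQ1 leQ1] : m.-integrable Q (EFin \o (fun x => f x - w.1 x)) /\
    \int[m]_(x in Q) `|f x - w.1 x| <= s * v + s ^- 5 * e.
  have [||||I1 le1] := @integral_control _ _ _ m Q v s (s ^- 5) (fun x => f x - w.1 x)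
    (fun x => (f x - w.1 x) ^+ 6) mQ mv (measurable_funB mf mw) I6.
  - by move=> x; exact: pow6_ge0.
  - by rewrite invr_ge0 exprn_ge0// ltW.
  - exact: ltW.
  - by move=> x; rewrite -norm6; exact: young_pow.
  split=> //; apply: (le_trans le1); rewrite lerD2l ler_wpM2l//.
  by rewrite invr_ge0 exprn_ge0// ltW.
have leQ2 i : \int[m]_(x in Q) `|partial i f x - w.2 i x| <= s * v + s ^- 1 * e.
  have [Lp lep] := I2 i.
  have [||||_ le1] := @integral_control _ _ _ m Q v s (s ^- 1) (fun x => partial i f x - w.2 i x)
    (fun x => (partial i f x - w.2 i x) ^+ 2) mQ mv Lp.1 Lp.2.
  - by move=> x; exact: sqr_ge0.
  - by rewrite invr_ge0 exprn_ge0// ltW.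
  - exact: ltW.
  - by move=> x; rewrite -norm2; exact: young_pow.
  apply: (le_trans le1); rewrite lerD2l ler_wpM2l//.
  by rewrite invr_ge0 exprn_ge0// ltW.
have Lf := test_L2 tf.
have LDf i : L2 m (partial i f) by exact: test_L2 (test_partial i tf).
have LDw i : L2 m (w.2 i) by exact: D12_grad_L2.
have If := L2_integrable mQ mv Lf.
have Iw := L2_integrable mQ mv Lw.
have IGf := intg_grad1 mQ mv LDf.
have P : \int[m]_(x in Q) `|f x| <= `|\int[m]_(x in Q) f x|
    + h * \int[m]_(x in Q) grad1 (fun i => partial i f) x.
  have := poincare_test a b c h0 tf; rewrite -/(box a b c h) -/Q.
  have E1 : (\int[m]_(x in Q) `|f x|%:E)%E = (\int[m]_(x in Q) `|f x|)%:E.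
    by rewrite fineK//; apply: integrable_fin_num => //; exact: integrable_norm.
  have E2 : (\int[m]_(x in Q) (grad1 (fun i => partial i f) x)%:E)%E =
      (\int[m]_(x in Q) grad1 (fun i => partial i f) x)%:E.
    by rewrite fineK//; exact: integrable_fin_num.
  by rewrite E1 E2 -EFinM -EFinD lee_fin.
have nf := integrable_norm If; have nw := integrable_norm Iw.
have nfw := integrable_norm IQ1.
have A1 : \int[m]_(x in Q) `|w.1 x| <= \int[m]_(x in Q) `|f x|
    + \int[m]_(x in Q) `|f x - w.1 x|.
  rewrite -RintegralD//; apply: le_Rintegral => //; first exact: (integrableD mQ nf nfw).
  by move=> x _; have := ler_normB (f x) (f x - w.1 x); rewrite subKr.
have A2 : `|\int[m]_(x in Q) f x| <= `|\int[m]_(x in Q) w.1 x|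
    + \int[m]_(x in Q) `|f x - w.1 x|.
  have -> : \int[m]_(x in Q) f x = \int[m]_(x in Q) w.1 x + \int[m]_(x in Q) (f x - w.1 x).
    by rewrite -RintegralD//; apply: eq_Rintegral => x _; ring.
  by rewrite (le_trans (ler_normD _ _))// lerD2l le_normr_Rintegral.
have A3 : \int[m]_(x in Q) grad1 (fun i => partial i f) x <=
    \int[m]_(x in Q) grad1 w.2 x + 3 * (s * v + s ^- 1 * e).
  rewrite !(Rint_grad1 mQ mv)//.
  have -> : 3 * (s * v + s ^- 1 * e) = \sum_(i < 3) (s * v + s ^- 1 * e).
    by rewrite sumr_const card_ord mulr_natl.
  rewrite -big_split/=; apply: ler_sum => i _.
  apply: (le_trans _ (lerD (lexx _) (leQ2 i))).
  have n1 := integrable_norm (L2_integrable mQ mv (LDf i)).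
  have n2 := integrable_norm (L2_integrable mQ mv (LDw i)).
  have n3 := integrable_norm (L2_integrable mQ mv (I2 i).1).
  rewrite -RintegralD//; apply: le_Rintegral => //; first exact: (integrableD mQ n2 n3).
  move=> x _; rewrite [X in `|X| <= _](_ : _ = w.2 i x + (partial i f x - w.2 i x)).
    by rewrite ler_normD.
  by ring.
have A3' := ler_wpM2l (ltW h0) A3.
have Es : C * s = dl / 2 by rewrite /s; field; rewrite gt_eqF.
have Ee : B * e = dl / 2 by rewrite /e; field; rewrite gt_eqF.
rewrite /C in Es; rewrite /B in Ee.
move: leQ1 A1 A2 A3' P Es Ee.
set x1 := \int[m]_(x in Q) `|w.1 x|; set x2 := \int[m]_(x in Q) `|f x|.
set x3 := \int[m]_(x in Q) `|f x - w.1 x|; set x4 := `|_|; set x5 := `|_|.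
set x6 := \int[m]_(x in Q) grad1 _ x; set x7 := \int[m]_(x in Q) grad1 _ x.
move=> leQ1 A1 A2 A3' P Es Ee.
have E : 2 * (s * v + s ^- 5 * e) + 3 * h * (s * v + s ^- 1 * e) = dl.
  rewrite [LHS](_ : _ = (2 * v + 3 * h * v) * s + (2 * s ^- 5 + 3 * h * s ^- 1) * e).
    by rewrite Es Ee; lra.
  by ring.
lra.
Qed.

End poincare_D12.

(** * Control of the L^1 norm by finitely many averages *)

Section small_boxes.
Context (R : realType).
Local Notation m := (leb3 R).
Implicit Types (Q : set (R3 R)) (h : R).

(** Up to finitely many averages, chosen independently of w, the L^1 norm on
    Q is controlled by h times that of the gradient: this is what compactness
    in L^1 needs, for bounded gradients and h small. *)
Definition tame Q h := [/\ measurable Q, (exists v, m Q = v%:E) &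
  exists n (L : nat -> set (R3 R)),
    (forall i, measurable (L i) /\ exists v, m (L i) = v%:E) /\
    forall w : gfun R, D12 w -> L2 m w.1 ->
      \int[m]_(x in Q) `|w.1 x| <=
        \sum_(0 <= i < n) `|\int[m]_(x in L i) w.1 x|
        + h * \int[m]_(x in Q) grad1 w.2 x].

Lemma tame_box a b c h : 0 < h -> tame (box a b c h) h.
Proof.
move=> h0; split; [exact: measurable_box|by exists (h * h * h); exact: box_measure|].
exists 1%N, (fun=> box a b c h); split=> [_|w Dw Lw].
  split; first exact: measurable_box.
  by exists (h * h * h); exact: box_measure.
by rewrite big_nat1; exact: poincare_box.
Qed.

Lemma tameU Q1 Q2 h : tame Q1 h -> tame Q2 h -> [disjoint Q1 & Q2] ->
  tame (Q1 `|` Q2) h.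
Proof.
move=> [m1 [v1 e1] [n1 [L1 [mL1 H1]]]] [m2 [v2 e2] [n2 [L2_ [mL2 H2]]]] dis.
have mU : measurable (Q1 `|` Q2) by exact: measurableU.
have vU : m (Q1 `|` Q2) = (v1 + v2)%:E.
  by rewrite EFinD -e1 -e2 measureU//; exact/disj_set2P.
split => //; first by exists (v1 + v2).
exists (n1 + n2)%N, (fun i => if (i < n1)%N then L1 i else L2_ (i - n1)%N); split.
  by move=> i; case: ifP.
move=> w Dw Lw; have LDw i : L2 m (w.2 i) by exact: D12_grad_L2.
rewrite !Rintegral_setU//; last 2 first.
- exact: intg_grad1 mU vU LDw.
- exact: (integrable_norm (L2_integrable mU vU Lw)).
rewrite (big_cat_nat (n := n1)) ?leq_addr//=.
rewrite (eq_big_nat _ _ (F2 := fun i => `|\int[m]_(x in L1 i) w.1 x|)); last first.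
  by move=> i /andP[_ ->].
rewrite [X in _ + X + _](_ : _ = \sum_(0 <= i < n2) `|\int[m]_(x in L2_ i) w.1 x|).
  by have := H1 w Dw Lw; have := H2 w Dw Lw; rewrite mulrDr; lra.
rewrite -{1}[n1]add0n big_addn addKn; apply: eq_big_nat => i _.
by rewrite ltnNge leq_addl/= addnK.
Qed.

Lemma itv_split (a h : R) : 0 < h -> `[a, a + (h + h)[%classic =
  (`[a, a + h[ `|` `[a + h, a + h + h[)%classic :> set (measurableTypeR R).
Proof.
move=> h0; apply/seteqP; split=> x /=; rewrite !in_itv/=.
  move=> /andP[ax xb]; have [xh|hx] := ltP x (a + h); [left|right].
    by rewrite ax.
  by rewrite addrA in xb.
by move=> [|] /andP[h1 h2]; apply/andP; split; lra.
Qed.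

Lemma itv_disj (a h : R) : `[a, a + h[ `&` `[a + h, a + h + h[ = set0 :> set (measurableTypeR R).
Proof.
apply/seteqP; split=> x //=; rewrite !in_itv/= => -[/andP[_ h1] /andP[h2 _]].
by have := lt_le_trans h1 h2; rewrite ltxx.
Qed.

Lemma rectU1 (A B J K : set (measurableTypeR R)) :
  rect (A `|` B) J K = rect A J K `|` rect B J K.
Proof. by apply/seteqP; split=> x; rewrite /rect /setX /setU /=; tauto. Qed.

Lemma rectU2 (I A B K : set (measurableTypeR R)) :
  rect I (A `|` B) K = rect I A K `|` rect I B K.
Proof. by apply/seteqP; split=> x; rewrite /rect /setX /setU /=; tauto. Qed.

Lemma rectU3 (I J A B : set (measurableTypeR R)) :
  rect I J (A `|` B) = rect I J A `|` rect I J B.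
Proof. by apply/seteqP; split=> x; rewrite /rect /setX /setU /=; tauto. Qed.

Lemma tame_double h s : 0 < h -> (forall a b c, tame (box a b c h) s) ->
  forall a b c, tame (box a b c (h + h)) s.
Proof.
move=> h0 H.
pose I (t l : R) : set (measurableTypeR R) := `[t, t + l[%classic.
have step1 a b c : tame (rect (I a (h + h)) (I b h) (I c h)) s.
  rewrite [X in rect X]/I itv_split// rectU1.
  apply: tameU; [exact: H|exact: H|].
  by apply/disj_set2P; rewrite /rect -!setXI itv_disj !set0X.
have step2 a b c : tame (rect (I a (h + h)) (I b (h + h)) (I c h)) s.
  rewrite [X in rect _ X]/I itv_split// rectU2.
  apply: tameU; [exact: step1|exact: step1|].
  by apply/disj_set2P; rewrite /rect -!setXI itv_disj setX0 set0X.
move=> a b c; rewrite /box [X in rect _ _ X]itv_split// rectU3.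
apply: tameU; [exact: step2|exact: step2|].
by apply/disj_set2P; rewrite /rect -!setXI itv_disj setX0.
Qed.

(** Bisect the cube until the boxes have side at most h, and use Poincare's
    inequality on each of them. *)
Lemma tame_cube N h : 0 < N -> 0 < h -> exists2 s, s <= h & tame (cube N) s.
Proof.
move=> N0 h0.
have [n hn] : exists n, (2 * N) / 2 ^+ n <= h.
  exists (Num.truncn (2 * N / h)).+1.
  rewrite ler_pdivrMr ?exprn_gt0// -ler_pdivrMl// mulrC.
  apply: (le_trans (ltW (truncnS_gt _))).
  by rewrite -natrX ler_nat ltnW// ltn_expl.
exists (2 * N / 2 ^+ n) => //.
have s0 : 0 < 2 * N / 2 ^+ n by rewrite divr_gt0 ?mulr_gt0// exprn_gt0.
have H k : forall a b c, tame (box a b c (2 * N / 2 ^+ n * 2 ^+ k)) (2 * N / 2 ^+ n).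
  elim: k => [|k IH] a b c; first by rewrite expr0 mulr1; exact: tame_box.
  have -> : 2 * N / 2 ^+ n * 2 ^+ k.+1 =
     2 * N / 2 ^+ n * 2 ^+ k + 2 * N / 2 ^+ n * 2 ^+ k by rewrite exprS; ring.
  by apply: tame_double => //; rewrite mulr_gt0// exprn_gt0.
have := H n (- N) (- N) (- N); rewrite divfK ?expf_neq0//.
by rewrite /box (_ : - N + 2 * N = N)//; ring.
Qed.

End small_boxes.

(** * Compactness in L^2 along an ultrafilter *)

Section rellich.
Context (R : realType).
Local Notation m := (leb3 R).
Local Notation sq := (sq m).

Lemma ultra_bounded_cvg (F : set_system R) (UF : UltraFilter F) (a : R -> R) (M : R) :
  F [set l | `|a l| <= M] -> exists c, forall e, 0 < e -> F [set l | `|a l - c| <= e].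
Proof.
move=> FM.
have FF : ProperFilter F by exact: ultra_proper.
have cM : compact (`[- M, M]%classic : set R) by exact: segment_compact.
have GA : (a @ F) (`[- M, M]%classic : set R).
  rewrite nbhs_filterE /fmap/=; apply: filterS FM => l /= h.
  by rewrite in_itv/= -ler_norml.
have [c [_ cl]] := cM (a @ F) _ GA.
exists c => e e0.
have [//|FC] := @in_ultra_setVsetC _ F [set l | `|a l - c| <= e] UF.
exfalso.
have nb : nbhs c (ball c e) by exact: nbhsx_ballx.
have GC : (a @ F) [set y | e < `|y - c|].
  by rewrite nbhs_filterE /fmap/=; apply: filterS FC => l /= /negP; rewrite -ltNge.
have [x []] := cl [set y | e < `|y - c|] (ball c e) GC nb.
by rewrite /ball /= distrC => h1 h2; have := lt_trans h1 h2; rewrite ltxx.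
Qed.

(** An ultrafilter replaces the extraction of subsequences: every bounded
    quantity converges along it. Applied to the finitely many averages that
    control the L^1 norm on a large cube ([tame_cube]), this makes the family
    Cauchy in L^1 of the cube, hence in L^2 of the cube because the functions
    are bounded by K. Tightness takes care of the complement. *)
Lemma rellich (F : set_system R) (UF : UltraFilter F) (D : set R)
    (v : R -> gfun R) (K C : R) :
  F D ->
  (forall l, D l -> [/\ D12 (v l), L2 m (v l).1,
     {ae m, forall x, `|(v l).1 x| <= K}, sq (v l).1 <= C &
     forall i, sq ((v l).2 i) <= C]) ->
  (forall e, 0 < e -> exists2 N, 0 < N & forall l, D l ->
     \int[m]_(x in ~` cube N) ((v l).1 x ^+ 2) <= e) ->
  forall e, 0 < e -> exists A, [/\ F A, A `<=` D & forall l l', A l -> A l' ->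
     sq (fun x => (v l).1 x - (v l').1 x) <= e].
Proof.
move=> FD bd tight e e0.
have FF : ProperFilter F by exact: ultra_proper.
have [l0 Dl0] := filter_ex FD.
have C0 : 0 <= C by have [_ _ _ + _] := bd _ Dl0; apply: le_trans; exact: sq_ge0.
pose K' := `|K| + 1.
have K0 : 0 < K' by rewrite ltr_wpDl.
have [N N0 tN] := tight (e / 8) ltac:(by rewrite divr_gt0).
pose B := cube N.
have mB : measurable B by exact: measurable_cube.
have [V BV] : exists V, m B = V%:E.
  exists (fine (m B)); rewrite fineK// ge0_fin_numE ?measure_ge0//.
  exact: cube_lty.
have V0 : 0 <= V by rewrite -lee_fin -BV measure_ge0.
(* eta is the target for the L1 norm on the cube: the averages and the gradient
   term contribute eta each, and 2 K' (2 eta) = e / 2 *)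
pose eta := e / (8 * K').
have eta0 : 0 < eta by rewrite divr_gt0// mulr_gt0.
pose W := 3 * (V + 4 * C) + 1.
have W0 : 0 < W by rewrite /W; lra.
have [s sh [_ _ [n [L [mL HL]]]]] := tame_cube N0 (divr_gt0 eta0 W0).
have control Q q : measurable Q -> m Q = q%:E -> forall f, L2 m f ->
    \int[m]_(x in Q) `|f x| <= q + sq f.
  move=> mQ Qq f [mf If].
  have [||||_] := @integral_control _ _ _ m Q q 1 1 f (fun x => f x ^+ 2) mQ Qq mf If.
  - by move=> x; exact: sqr_ge0.
  - exact: ler01.
  - exact: ler01.
  - move=> x; rewrite mul1r -[f x ^+ 2]real_normK ?num_real//.
    by move: (sqr_ge0 (`|f x| - 1)) (normr_ge0 (f x)); clear; nra.
  - by rewrite !mul1r.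
have lim i : exists c, forall e, 0 < e ->
    F [set l | `|\int[m]_(x in L i) (v l).1 x - c| <= e].
  have [mLi [q Lq]] := mL i.
  apply: (@ultra_bounded_cvg _ _ _ (q + C)).
  apply: filterS FD => l /= /bd[_ Lv _ sC _].
  apply: (le_trans (le_normr_Rintegral _ (L2_integrable mLi Lq Lv))) => //.
  by apply: (le_trans (control _ _ mLi Lq _ Lv)); rewrite lerD2l.
have {lim} [cc hcc] := choice lim.
pose dl := eta / (2 * n.+1%:R).
have dl0 : 0 < dl by rewrite divr_gt0// mulr_gt0.
pose A := D `&` [set l | forall i : 'I_n, `|\int[m]_(x in L i) (v l).1 x - cc i| <= dl].
exists A; split.
- apply: filterI => //; apply: filter_forall => i; exact: hcc.
- by move=> l [].
move=> l l' [Dl Al] [Dl' Al'].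
have [D1 L1 K1 s1 g1] := bd _ Dl; have [D2 L2' K2 s2 g2] := bd _ Dl'.
pose w : gfun R := v l - v l'.
have Dw : D12 w by exact: D12B.
have Lw : L2 m w.1 by exact: L2B.
have gw i : sq (w.2 i) <= 4 * C.
  have := sqD_le (D12_grad_L2 i D1) (L2Z (-1) (D12_grad_L2 i D2)).
  rewrite (_ : sq (fun x => -1 * _) = sq ((v l').2 i)); last first.
    by apply: eq_Rintegral => x _; ring.
  rewrite (_ : sq _ = sq (w.2 i)).
    by move/le_trans; apply; move: (g1 i) (g2 i); clear; lra.
  by apply: eq_Rintegral => x _; rewrite /w /= !fctE; ring.
have IwB : m.-integrable B (EFin \o w.1) by exact: L2_integrable mB BV Lw.
have nB : \int[m]_(x in B) `|w.1 x| <= 2 * eta.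
  apply: (le_trans (HL w Dw Lw)).
  have S1 : \sum_(0 <= i < n) `|\int[m]_(x in L i) w.1 x| <= eta.
    apply: (@le_trans _ _ (\sum_(0 <= i < n) (2 * dl))).
      apply: ler_sum_nat => i /andP[_ ilt].
      have [mLi [q Lq]] := mL i.
      have -> : \int[m]_(x in L i) w.1 x =
          (\int[m]_(x in L i) (v l).1 x - cc i) - (\int[m]_(x in L i) (v l').1 x - cc i).
        rewrite opprB addrA subrK -RintegralB//.
        - exact: L2_integrable mLi Lq L1.
        - exact: L2_integrable mLi Lq L2'.
      rewrite (le_trans (ler_normB _ _))//.
      by move: (Al (Ordinal ilt)) (Al' (Ordinal ilt)) => /=; clear; lra.
    have -> : \sum_(0 <= i < n) (2 * dl) = eta * (n%:R / n.+1%:R).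
      have k0 : (n.+1%:R : R) != 0 by rewrite pnatr_eq0.
      by rewrite sumr_const_nat subn0 -[LHS]mulr_natr /dl; move: _%:R k0 => k k0; field.
    by rewrite ler_piMr ?(ltW eta0)// ler_pdivrMr ?ltr0n// mul1r ler_nat.
  have LDw i : L2 m (w.2 i) by exact: D12_grad_L2.
  have S2 : \int[m]_(x in B) grad1 w.2 x <= W.
    rewrite (Rint_grad1 mB BV)//.
    apply: (@le_trans _ _ (\sum_(i < 3) (V + 4 * C))).
      apply: ler_sum => i _; apply: (le_trans (control _ _ mB BV _ (LDw i))).
      by rewrite lerD2l.
    by rewrite sumr_const card_ord -[leLHS]mulr_natl /W lerDl.
  have G0 : 0 <= \int[m]_(x in B) grad1 w.2 x.
    by apply: Rintegral_ge0 => x _; apply: sumr_ge0.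
  have S3 : s * \int[m]_(x in B) grad1 w.2 x <= eta.
    apply: (@le_trans _ _ (eta / W * \int[m]_(x in B) grad1 w.2 x)).
      by rewrite ler_wpM2r.
    rewrite -[leRHS](divfK (lt0r_neq0 W0)) ler_wpM2l// divr_ge0// ltW//.
  by apply: (le_trans (lerD S1 S3)); rewrite mulr_natl mulr2n.
have mBc : measurable (~` B) by exact: measurableC.
have Ia : intg m (fun x => w.1 x ^+ 2) := Lw.2.
have split_w : sq w.1 = \int[m]_(x in B) (w.1 x ^+ 2) + \int[m]_(x in ~` B) (w.1 x ^+ 2).
  rewrite /(sq _) -(setvU B) setUC Rintegral_setU//.
  - by rewrite setUC setvU.
  - by apply/disj_set2P; rewrite setICr.
have aew : {ae m, forall x, `|w.1 x| <= 2 * K'}.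
  move: K1 K2; apply: filterS2 => x k1 k2; rewrite /w /= !fctE.
  rewrite (le_trans (ler_normB _ _))// /K'.
  by move: (ler_norm K) k1 k2; clear; lra.
have inner : \int[m]_(x in B) (w.1 x ^+ 2) <= 2 * K' * \int[m]_(x in B) `|w.1 x|.
  rewrite Rintegral_mkcond [in leRHS]Rintegral_mkcond.
  have Iw1 : intg m ((fun x => `|w.1 x|) \_ B).
    rewrite /intg -restrict_EFin.
    exact: ((integrable_mkcond _ mB).1 (integrable_norm IwB)).
  have Iw2 : intg m ((fun x => w.1 x ^+ 2) \_ B).
    rewrite /intg -restrict_EFin.
    exact: ((integrable_mkcond _ mB).1 (intg_setS mB Ia)).
  rewrite -IntZ//; apply: le_Int_ae => //; first exact: intgZ.
  apply: filterS aew => x hx; rewrite !patchE; case: ifP => _; last by rewrite mulr0.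
  by rewrite -[leLHS]real_normK ?num_real// expr2 ler_wpM2r.
have outer : \int[m]_(x in ~` B) (w.1 x ^+ 2) <= e / 2.
  have I1 := intg_setS mBc L1.2; have I2 := intg_setS mBc L2'.2.
  apply: (@le_trans _ _ (\int[m]_(x in ~` B) (2 * (v l).1 x ^+ 2 + 2 * (v l').1 x ^+ 2))).
    apply: le_Rintegral => //; first exact: intg_setS.
      by apply: intg_setS => //; apply: intgD; apply: intgZ; [exact: L1.2|exact: L2'.2].
    move=> x _; rewrite /w /= !fctE.
    by move: (sqr_ge0 ((v l).1 x + (v l').1 x)); clear; nra.
  rewrite RintegralD//; last 2 first.
  - by apply: intg_setS => //; apply: intgZ; exact: L1.2.
  - by apply: intg_setS => //; apply: intgZ; exact: L2'.2.
  rewrite !RintegralZl//.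
  by move: (tN _ Dl) (tN _ Dl'); rewrite -/B; clear; lra.
rewrite -[X in X <= _]/(sq w.1) split_w.
have : 2 * K' * \int[m]_(x in B) `|w.1 x| <= 2 * K' * (2 * eta).
  by rewrite ler_wpM2l// mulr_ge0// ltW.
have -> : 2 * K' * (2 * eta) = e / 2 by rewrite /eta; field; rewrite gt_eqF.
by move: inner outer; clear; lra.
Qed.

End rellich.

(** * The nonlinearity and the potential well *)

Section nonlinearity.
Context (R : realType) (p : R).
Hypothesis p1 : 1 < p.

Definition nl (s : R) : R := `|s| `^ (p - 1) * s.

Let p10 : 0 < p - 1. Proof. by rewrite subr_gt0. Qed.

Lemma nl_ge0 s : 0 <= s -> nl s = s `^ p.
Proof. by move=> s0; rewrite /nl ger0_norm// mulrC mulr_powRB1// (lt_trans ltr01). Qed.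

Lemma nlN s : nl (- s) = - nl s.
Proof. by rewrite /nl normrN mulrN. Qed.

Lemma nl_bound K s : `|s| <= K -> `|nl s| <= K `^ (p - 1) * `|s|.
Proof.
move=> sK; have K0 : 0 <= K by exact: le_trans sK.
rewrite /nl normrM (ger0_norm (powR_ge0 _ _)) ler_wpM2r//.
by apply: ge0_ler_powR => //; rewrite ?nnegrE// ltW.
Qed.

(** The mean value theorem on the positive half-line, where the nonlinearity
    is s^p; it is odd, and across 0 the bound |nl s| <= K^(p-1) |s| suffices. *)
Lemma nl_lipschitz K a b : `|a| <= K -> `|b| <= K ->
  `|nl a - nl b| <= p * K `^ (p - 1) * `|a - b|.
Proof.
have p0 : 0 < p by exact: lt_trans ltr01 p1.
have one (x : R) : 0 <= x -> K `^ (p - 1) * x <= p * K `^ (p - 1) * x.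
  by move=> x0; rewrite ler_wpM2r// ler_peMl ?powR_ge0// ltW.
have pos x y : 0 <= x -> x <= y -> y <= K ->
    `|nl y - nl x| <= p * K `^ (p - 1) * `|y - x|.
  move=> x0 xy yK; have y0 : 0 <= y by exact: le_trans xy.
  have [x00|xn0] := eqVneq x 0.
    have -> : nl x = 0 by rewrite /nl x00 mulr0.
    rewrite x00 !subr0; apply: (le_trans (nl_bound (K := K) _)); last exact: one.
    by rewrite ger0_norm.
  have xgt : 0 < x by rewrite lt_neqAle eq_sym xn0.
  have [->|xny] := eqVneq x y.
    by rewrite !subrr !normr0 mulr0.
  have xlt : x < y by rewrite lt_neqAle xny.
  rewrite !nl_ge0//.
  have inr c : c \in `]x, y[%R -> c \in `]0, +oo[%R.
    by rewrite !in_itv/= andbT => /andP[xc _]; exact: lt_trans xc.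
  have der c : c \in `]x, y[%R -> is_derive c 1 (fun t => t `^ p) (p * c `^ (p - 1)).
    move=> cx; apply: DeriveDef; first exact: derivable_powR (inr _ cx).
    by rewrite -derive1E powR_derive1//; exact: inr.
  have cont : {within `[x, y], continuous (fun t => t `^ p)}.
    apply: continuous_in_subspaceT => z; rewrite inE/= in_itv/= => /andP[xz _].
    apply/differentiable_continuous/derivable1_diffP/derivable_powR.
    by rewrite in_itv/= andbT (lt_le_trans xgt).
  have [c cxy ->] := MVT xlt der cont.
  move: cxy; rewrite in_itv/= => /andP[xc cy].
  rewrite normrM (ger0_norm (mulr_ge0 (ltW p0) (powR_ge0 _ _))) ler_wpM2r//.
  rewrite ler_pM2l//; apply: ge0_ler_powR; rewrite ?nnegrE.
  + exact: ltW.
  + by rewrite ltW// (lt_trans xgt).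
  + by rewrite (le_trans y0).
  + by rewrite (le_trans (ltW cy)).
have posneg x y : 0 <= x -> 0 <= y -> x <= K -> y <= K ->
    `|nl x - nl (- y)| <= p * K `^ (p - 1) * `|x - - y|.
  move=> x0 y0 xK yK; rewrite nlN !opprK.
  rewrite (ger0_norm (addr_ge0 x0 y0)) mulrDr.
  apply: (le_trans (ler_normD _ _)); apply: lerD.
    by apply: (le_trans (nl_bound (K := K) _)); rewrite ger0_norm//; exact: one.
  by apply: (le_trans (nl_bound (K := K) _)); rewrite ger0_norm//; exact: one.
have pos2 x y : 0 <= x -> 0 <= y -> x <= K -> y <= K ->
    `|nl y - nl x| <= p * K `^ (p - 1) * `|y - x|.
  move=> x0 y0 xK yK; have [xy|yx] := leP x y; first exact: pos.
  by rewrite distrC [in leRHS]distrC; apply: pos => //; exact: ltW.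
move=> aK bK.
have [a0|a0] := leP 0 a; have [b0|b0] := leP 0 b.
- by apply: pos2 => //; rewrite -[X in X <= _]ger0_norm.
- rewrite -[b]opprK; apply: posneg => //; first by rewrite oppr_ge0 ltW.
    by rewrite -[X in X <= _]ger0_norm.
  by rewrite -(ltr0_norm b0).
- rewrite distrC [in leRHS]distrC -[a]opprK; apply: posneg => //.
  + by rewrite oppr_ge0 ltW.
  + by rewrite -[X in X <= _]ger0_norm.
  + by rewrite -(ltr0_norm a0).
- have -> : nl a - nl b = nl (- b) - nl (- a) by rewrite !nlN; ring.
  have -> : a - b = - b - - a by ring.
  apply: pos2; rewrite ?oppr_ge0 ?(ltW a0) ?(ltW b0)//.
    by rewrite -(ltr0_norm a0).
  by rewrite -(ltr0_norm b0).
Qed.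

Lemma measurable_nl : measurable_fun setT nl.
Proof.
apply: measurable_funM => //.
apply: (@measurableT_comp _ _ _ _ _ _ (@powR R ^~ (p - 1))) => //.
Qed.

End nonlinearity.

Section potential_well.
Context (R : realType) (g : R3 R -> R).
Hypothesis wg : well g.
Local Notation m := (leb3 R).

Lemma well_ge0 x : 0 <= g x.
Proof. by case: wg. Qed.

Lemma well_meas : measurable_fun setT g.
Proof.
by case: wg => + _ _ _ _; rewrite inE => /andP[/set_mem].
Qed.

Lemma well_bounded : exists2 G, 0 <= G & {ae m, forall x, g x <= G}.
Proof.
case: wg => + _ _ _ _; rewrite inE => /andP[_ /set_mem]; rewrite /= /finite_norm.
rewrite unlock /Lnorm; case: ifPn => [mpos|m0] fin.
  have [G Gle] : exists G : R, (ess_sup m (abse \o (EFin \o g)) <= G%:E)%E.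
    move: fin; case: ess_sup => [r _|//|_]; first by exists r.
    by exists 0; rewrite leNye.
  exists (Num.max G 0); first by rewrite le_max lexx orbT.
  move/ess_supP : Gle; apply: filterS => x /=.
  by rewrite lee_fin ger0_norm ?well_ge0// le_max => ->.
have mT0 : m setT = 0 by apply/eqP; rewrite eq_le measure_ge0 andbT leNgt.
exists 0 => //; exists setT; split => //.
Qed.

Lemma well_far e : 0 < e -> exists r, forall x, r < `|x| -> 1 - e <= g x.
Proof.
move=> e0; case: wg => _ _ _ _; rewrite limf_einfE => supE.
have : ((1 - e)%:E < 1%:E :> \bar R)%E by rewrite lte_fin ltrBlDr ltrDl.
rewrite -supE => /ereal_sup_gt[_ [V [r hV] <-]] inf.
exists r => x rx; rewrite -lee_fin.
apply/ltW/(lt_le_trans inf)/ereal_inf_lbound; exists x => //; exact: hV.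
Qed.

End potential_well.

(** * The energy space D_V *)

Section energy_space.
Context (R : realType) (g : R3 R -> R) (mu : R).
Hypotheses (wg : well g) (mu0 : 0 < mu).
Local Notation m := (leb3 R).
Local Notation sq := (sq m).
Local Notation V := (Vpot g mu).
Implicit Types (u v w : gfun R).

Lemma Vpot_ge1 x : 1 <= V x.
Proof. by rewrite /Vpot lerDl mulr_ge0 ?(ltW mu0)// (well_ge0 wg). Qed.

Lemma Vpot_meas : measurable_fun setT V.
Proof.
by apply: measurable_funD => //; apply: measurable_funM => //; exact: well_meas.
Qed.

Lemma Vpot_bounded : exists2 G, 0 <= G & {ae m, forall x, `|V x| <= G}.
Proof.
have [G G0 gG] := well_bounded wg.
exists (1 + mu * G); first by rewrite addr_ge0// mulr_ge0// ltW.
apply: filterS gG => x gx; rewrite ger0_norm.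
  by rewrite lerD2l ler_wpM2l// ltW.
by rewrite (le_trans ler01)// Vpot_ge1.
Qed.

Lemma L2_Vpot f : L2 m f -> L2 m (fun x => V x * f x).
Proof.
move=> Lf; have [G _ VG] := Vpot_bounded.
exact: (L2_bounded Lf Vpot_meas VG).
Qed.

(** V is bounded and bounded below by 1. *)
Lemma DVP u : DV g mu u <-> D12 u /\ L2 m u.1.
Proof.
have V0 x : 0 <= V x by rewrite (le_trans ler01)// Vpot_ge1.
split=> [[Du fin]|[Du Lu]]; split=> //.
- have mu1 := D12_meas1 Du; split => //.
  have I : intg m (fun x => V x * u.1 x ^+ 2).
    apply/integrableP; split.
      apply/measurable_EFinP; apply: measurable_funM; first exact: Vpot_meas.
      exact: measurable_funX.
    apply: le_lt_trans fin; rewrite le_eqVlt; apply/orP; left; apply/eqP.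
    by apply: eq_integral => x _; rewrite /= ger0_norm// mulr_ge0 ?sqr_ge0.
  apply: (le_intg _ _ I); first exact: measurable_funX.
  by move=> x; rewrite ger0_norm ?sqr_ge0// ler_peMl ?sqr_ge0// Vpot_ge1.
- have I := L2M Lu (L2_Vpot Lu).
  rewrite [X in (X < _)%E](_ : _ = (\int[m]_x (u.1 x * (V x * u.1 x))%:E)%E).
    by rewrite intgE// ltry.
  by apply: eq_integral => x _; congr (_%:E); ring.
Qed.

(** The inner product of D_V. *)
Definition dv u v : R := \int[m]_x (gdot u v x + V x * u.1 x * v.1 x).

Lemma intg_gdot u v : D12 u -> D12 v -> intg m (gdot u v).
Proof. by move=> Du Dv; apply: intg_sum => i; apply: L2M; exact: D12_grad_L2. Qed.

Lemma intg_pot u v : L2 m u.1 -> L2 m v.1 -> intg m (fun x => V x * u.1 x * v.1 x).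
Proof. by move=> Lu Lv; exact: L2M (L2_Vpot Lu) Lv. Qed.

Lemma intg_dv u v : DV g mu u -> DV g mu v ->
  intg m (fun x => gdot u v x + V x * u.1 x * v.1 x).
Proof.
move=> /DVP[Du Lu] /DVP[Dv Lv].
by apply: intgD; [exact: intg_gdot|exact: intg_pot].
Qed.

Lemma DVB u v : DV g mu u -> DV g mu v -> DV g mu (u - v).
Proof.
move=> /DVP[Du Lu] /DVP[Dv Lv]; apply/DVP; split; first exact: D12B.
exact: L2B.
Qed.

Lemma gdotB u w v x : gdot (u - w) v x = gdot u v x - gdot w v x.
Proof.
rewrite /gdot -sumrB; apply: eq_bigr => i _.
by rewrite /= !fctE mulrBl.
Qed.

Lemma dvB u w v : DV g mu u -> DV g mu w -> DV g mu v ->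
  dv (u - w) v = dv u v - dv w v.
Proof.
move=> Du Dw Dv; rewrite /dv -IntB; [|exact: intg_dv|exact: intg_dv].
apply: eq_Rintegral => x _; rewrite gdotB /= !fctE; ring.
Qed.

Lemma DV_normE u : DV_norm g mu u = Num.sqrt (dv u u).
Proof.
rewrite /DV_norm; congr Num.sqrt; apply: eq_Rintegral => x _; congr (_ + _); ring.
Qed.

Lemma dvE u v : DV g mu u -> DV g mu v ->
  dv u v = \sum_(i < 3) \int[m]_x (u.2 i x * v.2 i x) + \int[m]_x (V x * u.1 x * v.1 x).
Proof.
move=> /DVP[Du Lu] /DVP[Dv Lv].
rewrite /dv IntD; [|exact: intg_gdot|exact: intg_pot]; congr (_ + _).
have I i : intg m (fun x => u.2 i x * v.2 i x) by apply: L2M; exact: D12_grad_L2.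
rewrite /gdot !big_ord_recl big_ord0 addr0.
under eq_Rintegral do rewrite !big_ord_recl big_ord0 addr0.
by rewrite IntD ?IntD//; exact: intgD.
Qed.

Lemma dv_ge0 u : 0 <= dv u u.
Proof.
apply: Int_ge0 => x; rewrite addr_ge0//.
  by apply: sumr_ge0 => i _; rewrite -expr2 sqr_ge0.
by rewrite -mulrA mulr_ge0 -?expr2 ?sqr_ge0// (le_trans ler01)// Vpot_ge1.
Qed.

Lemma sq_le_pot u : L2 m u.1 -> sq u.1 <= \int[m]_x (V x * u.1 x * u.1 x).
Proof.
move=> Lu; apply: le_Int; [exact: Lu.2|exact: intg_pot|] => x.
by rewrite -mulrA -expr2 ler_peMl ?sqr_ge0// Vpot_ge1.
Qed.

Lemma dv_control u : DV g mu u -> \sum_(i < 3) sq (u.2 i) + sq u.1 <= dv u u.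
Proof.
move=> Du; rewrite dvE//; apply: lerD; last by apply: sq_le_pot; have /DVP[] := Du.
by apply: ler_sum => i _; under eq_Rintegral do rewrite -expr2.
Qed.

Lemma dv_control1 u : DV g mu u -> sq u.1 <= dv u u.
Proof.
move=> Du; apply: le_trans (dv_control Du); rewrite lerDr.
by apply: sumr_ge0 => i _; exact: sq_ge0.
Qed.

Lemma dv_control2 u i : DV g mu u -> sq (u.2 i) <= dv u u.
Proof.
move=> Du; apply: le_trans (dv_control Du); rewrite (bigD1 i)//= -addrA lerDl.
by rewrite addr_ge0 ?sq_ge0//; apply: sumr_ge0 => j _; exact: sq_ge0.
Qed.

Lemma dv_bound u v : DV g mu u -> DV g mu v ->
  `|dv u v| <= \sum_(i < 3) Num.sqrt (sq (u.2 i)) * Num.sqrt (sq (v.2 i))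
    + Num.sqrt (sq u.1) * Num.sqrt (sq (fun x => V x * v.1 x)).
Proof.
move=> Du Dv; rewrite dvE//.
have /DVP[Du1 Lu] := Du; have /DVP[Dv1 Lv] := Dv.
apply: (le_trans (ler_normD _ _)); apply: lerD.
  apply: (le_trans (ler_norm_sum _ _ _)); apply: ler_sum => i _.
  by apply: norm_IntM; exact: D12_grad_L2.
rewrite [X in `|X| <= _](_ : _ = \int[m]_x (u.1 x * (V x * v.1 x))).
  by apply: norm_IntM => //; exact: L2_Vpot.
by apply: eq_Rintegral => x _; ring.
Qed.

End energy_space.

(** * Uniform estimates for the solutions *)

Lemma normM_le_sq (R : realType) (a b : R) : `|a * b| <= a ^+ 2 + b ^+ 2.
Proof. by rewrite ler_norml; apply/andP; split; nra. Qed.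

Lemma cross_term (R : realType) (a b t d : R) : 0 < t ->
  - (2 * t) <= d -> d <= 2 * t -> - (t * (a ^+ 2 + b ^+ 2)) <= a * b * d.
Proof.
move=> t0 d1 d2; have [ab|ab] := leP 0 (a * b).
  apply: (@le_trans _ _ (a * b * - (2 * t))); last exact: ler_wpM2l.
  rewrite -subr_ge0 (_ : _ - _ = t * (a - b) ^+ 2); last by ring.
  by apply: mulr_ge0; [exact: ltW|exact: sqr_ge0].
apply: (@le_trans _ _ (a * b * (2 * t))).
  rewrite -subr_ge0 (_ : _ - _ = t * (a + b) ^+ 2); last by ring.
  by apply: mulr_ge0; [exact: ltW|exact: sqr_ge0].
by rewrite ler_nM2l.
Qed.

Section real_arithmetic.
Context (R : realType).
Implicit Types d k y z c t : R.

Lemma far_bound mu d k y z : 2 * d = 1 + mu - k -> mu - d <= y -> z <= k ->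
  d <= 1 + y - z.
Proof. lra. Qed.

Lemma near_bound d k y c : (d + k) * y <= c -> d * y - c <= - k * y.
Proof. by rewrite mulrDl; lra. Qed.

Lemma add_bounds t s a c A lg vu lphi nlu : - t * s - 3 * t * a <= lg ->
  A - c * a <= vu - nlu -> 0 <= lphi ->
  A - (c + 3 * t) * a - t * s <= lg + vu + lphi - nlu :> R.
Proof. by rewrite mulrDl; lra. Qed.

Lemma sum_bounds A c t a s b w : A - (c + 3 * t) * a - t * s <= 0 ->
  (c + 3 * t) * a <= (c + 3 * t) * b -> t * s <= t * b -> c * b <= w ->
  A <= w + 4 * t * b :> R.
Proof. by rewrite !mulrDl; lra. Qed.

End real_arithmetic.

Section solutions.
Context (R : realType) (p : R) (g : R3 R -> R) (mu K P B : R).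
Hypotheses (p1 : 1 < p) (wg : well g) (mu0 : 0 < mu) (K0 : 0 < K) (P0 : 0 <= P).
Local Notation m := (leb3 R).
Local Notation sq := (sq m).
Local Notation V := (Vpot g mu).
Local Notation dv := (dv g mu).
Local Notation nl := (nl p).

(** A weak solution for the parameter lam, with the a priori bounds K, P and B
    that are common to all small lam. All estimates see the potential phi only
    through its sign and its bound, so these stand for the equation of phi. *)
Definition sol (lam : R) (u phi : gfun R) :=
  [/\ [/\ 0 < lam, DV g mu u & measurable_fun setT phi.1],
      {ae m, forall x, `|u.1 x| <= K},
      {ae m, forall x, 0 <= phi.1 x <= P},
      dv u u <= B &
      forall v, DV g mu v -> dv u v + lam * (\int[m]_x (phi.1 x * u.1 x * v.1 x))
        - \int[m]_x (nl (u.1 x) * v.1 x) = 0].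

Lemma L2_nl u : L2 m u -> {ae m, forall x, `|u x| <= K} -> L2 m (fun x => nl (u x)).
Proof.
move=> Lu uK; apply: (le_L2_ae _ _ (L2Z (K `^ (p - 1)) Lu)).
  by apply: measurableT_comp; [exact: measurable_nl|exact: Lu.1].
apply: filterS uK => x uK.
by rewrite [leRHS]normrM (ger0_norm (powR_ge0 _ _)); exact: nl_bound.
Qed.

Lemma sol_phi lam u phi : sol lam u phi -> L2 m (fun x => phi.1 x * u.1 x).
Proof.
move=> [[_ /(DVP wg mu0)[_ Lu] mphi] _ aephi _ _].
apply: (L2_bounded Lu mphi (C := P)).
by apply: filterS aephi => x /andP[h0 hP]; rewrite ger0_norm.
Qed.

Lemma sol_sq lam u phi : sol lam u phi -> sq u.1 <= B.
Proof. by move=> [[_ Du _] _ _ uB _]; exact: le_trans (dv_control1 wg mu0 Du) uB. Qed.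

Lemma sol_L2 lam u phi : sol lam u phi -> L2 m u.1.
Proof. by move=> [[_ /(DVP wg mu0)[]]]. Qed.

Lemma sol_phi_bound lam u phi w : sol lam u phi -> L2 m w ->
  `|\int[m]_x (phi.1 x * u.1 x * w x)| <= P * (sq u.1 + sq w).
Proof.
move=> S Lw; have Lu := sol_L2 S; have Lpu := sol_phi S.
have [_ _ aephi _ _] := S.
apply: (le_trans (le_norm_Int (L2M Lpu Lw))).
rewrite -IntD; [|exact: Lu.2|exact: Lw.2].
rewrite -IntZ; last exact: intgD Lu.2 Lw.2.
apply: le_Int_ae; [exact: intg_abs (L2M Lpu Lw)|exact: intgZ (intgD Lu.2 Lw.2)|].
apply: filterS aephi => x /andP[h0 hP].
rewrite -mulrA normrM (ger0_norm h0).
apply: (@le_trans _ _ (P * `|u.1 x * w x|)); first by rewrite ler_wpM2r.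
by rewrite ler_wpM2l// normM_le_sq.
Qed.

(** Subtract the two equations and test with u - u': the potentials come with
    the factors lam and lam', and the nonlinearity is Lipschitz on [-K, K]. So
    the distance in D_V is controlled by that in L^2, up to O(lam + lam'). *)
Lemma cauchy_estimate lam u phi lam' u' phi' : sol lam u phi -> sol lam' u' phi' ->
  dv (u - u') (u - u') <= p * K `^ (p - 1) * sq (u - u').1
    + (lam + lam') * (P * (5 * B)).
Proof.
move=> S S'; have [[l0 Du mphi] uK aephi uB eqn] := S.
have [[l0' Du' mphi'] uK' aephi' uB' eqn'] := S'.
set w := u - u'; have Dw : DV g mu w by exact: DVB.
have Lw : L2 m w.1 by have /(DVP wg mu0)[] := Dw.
have Lu := sol_L2 S; have Lu' := sol_L2 S'.
rewrite {1}/w (dvB wg mu0)//.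
have E := eqn w Dw; have E' := eqn' w Dw.
have sw : sq w.1 <= 4 * B.
  have := sqD_le Lu (L2Z (-1) Lu').
  rewrite (_ : sq (fun x => -1 * _) = sq u'.1); last first.
    by apply: eq_Rintegral => x _; ring.
  rewrite (_ : sq _ = sq w.1); last first.
    by apply: eq_Rintegral => x _; rewrite /w /= !fctE; ring.
  by move: (sol_sq S) (sol_sq S'); clear -p1 wg mu0 K0 P0 B; lra.
have b1 := sol_phi_bound S Lw; have b2 := sol_phi_bound S' Lw.
have c1 : P * (sq u.1 + sq w.1) <= P * (5 * B).
  by rewrite ler_wpM2l//; move: (sol_sq S) sw; clear -p1 wg mu0 K0 P0 B; lra.
have c2 : P * (sq u'.1 + sq w.1) <= P * (5 * B).
  by rewrite ler_wpM2l//; move: (sol_sq S') sw; clear -p1 wg mu0 K0 P0 B; lra.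
have Ln := L2_nl Lu uK; have Ln' := L2_nl Lu' uK'.
have N : \int[m]_x (nl (u.1 x) * w.1 x) - \int[m]_x (nl (u'.1 x) * w.1 x)
    <= p * K `^ (p - 1) * sq w.1.
  rewrite -IntB; [|exact: L2M|exact: L2M]; rewrite -IntZ; last exact: Lw.2.
  apply: le_Int_ae; [by apply: intgB; exact: L2M|exact: intgZ Lw.2|].
  move: uK uK'; apply: filterS2 => x h1 h2.
  rewrite -mulrBl (le_trans (ler_norm _))// normrM.
  rewrite -[X in _ <= _ * X]real_normK ?num_real// expr2 mulrA ler_wpM2r//.
  exact: nl_lipschitz.
set J := \int[m]_x (phi.1 x * u.1 x * w.1 x) in E b1.
set J' := \int[m]_x (phi'.1 x * u'.1 x * w.1 x) in E' b2.
have d1 : - (lam * J) <= lam * (P * (5 * B)).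
  rewrite -mulrN ler_pM2l//; apply: le_trans c1; apply: le_trans b1.
  by rewrite -normrN ler_norm.
have d2 : lam' * J' <= lam' * (P * (5 * B)).
  rewrite ler_pM2l//; apply: le_trans c2; apply: le_trans b2.
  exact: ler_norm.
move: E E' N d1 d2; clear -p1 wg mu0 K0 P0 B; lra.
Qed.

Hypothesis gap : K `^ (p - 1) < 1 + mu.

(** Half of the gap: V - |u|^(p-1) >= d0 where |u| <= K and mu g >= mu - d0. *)
Let d0 := (1 + mu - K `^ (p - 1)) / 2.

Let d00 : 0 < d0. Proof. by rewrite divr_gt0// subr_gt0. Qed.

(** Vanishes at the origin and tends to 1 at infinity, with partial
    derivatives at most t. *)
Definition eta (t : R) (x : R3 R) : R := 1 - bump (t ^+ 2) x.

Lemma cutoff_props t : 0 < t ->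
  let h := fun x => eta t x * eta t x in
  [/\ smooth h, forall x, 0 <= eta t x <= 1,
      forall i x, `|partial i h x| <= 2 * t,
      forall i, L2 m (partial i h) &
      (forall x i, t^-1 <= `|coord i x| -> 1 / 4 <= h x) /\
      (forall x, h x <= 3 * t ^+ 2 * `|x| ^+ 2)].
Proof.
move=> t0 h; have e0 : 0 < t ^+ 2 by rewrite exprn_gt0.
have st : Num.sqrt (t ^+ 2) = t by rewrite sqrtr_sqr gtr0_norm.
have sb := smooth_bump e0.
have se : smooth (eta t) by exact: (smoothB (smooth_cst 1) sb).
have sh : smooth h by exact: smoothM.
have eta01 x : 0 <= eta t x <= 1.
  by rewrite /eta subr_ge0 bump_le1// gerBl ltW// bump_gt0.
have dh i x : partial i h x = - (2 * eta t x) * partial i (bump (t ^+ 2)) x.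
  rewrite /h partialM; [|exact: smooth_derivable se _|exact: smooth_derivable se _].
  rewrite /eta partialB; [|by move=> y; exact: derivable_cst|exact: smooth_derivable sb _].
  rewrite (_ : partial i (fun=> 1) x = 0); first by ring.
  exact: derive_cst.
have dhb i x : `|partial i h x| <= 2 * t * bump (t ^+ 2) x.
  have /andP[h0 h1] := eta01 x.
  rewrite dh normrM normrN (ger0_norm (mulr_ge0 _ h0))//.
  apply: (@le_trans _ _ (2 * `|partial i (bump (t ^+ 2)) x|)).
    by rewrite ler_wpM2r// ler_piMr.
  by rewrite -mulrA ler_wpM2l// -{2}st; exact: partial_bump_le.
split => //.
- move=> i x; apply: (le_trans (dhb i x)); rewrite ler_piMr ?mulr_ge0 ?(ltW t0)//.
  exact: bump_le1.
- move=> i; split.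
    exact: continuous_measurable3 (smooth_continuous (smooth_partial i sh)).
  apply: (le_intg _ _ (intgZ (4 * t ^+ 2) (intg_bump e0))).
    apply: measurable_funX.
    exact: continuous_measurable3 (smooth_continuous (smooth_partial i sh)).
  move=> x; rewrite ger0_norm ?sqr_ge0// -norm2.
  apply: (@le_trans _ _ ((2 * t * bump (t ^+ 2) x) ^+ 2)).
    by rewrite ler_pXn2r ?nnegrE// ?mulr_ge0 ?(ltW t0) ?(ltW (bump_gt0 e0 x)).
  rewrite exprMn (_ : (2 * t) ^+ 2 = 4 * t ^+ 2); last by ring.
  have q0 : 0 <= 4 * t ^+ 2 by rewrite pmulr_rge0// sqr_ge0.
  apply: (ler_wpM2l q0); rewrite expr2.
  by apply: ler_piMl; [rewrite ltW// bump_gt0|exact: bump_le1].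
- split.
    move=> x i tx.
    have b2 : bump (t ^+ 2) x <= 1 / 2.
      apply: (le_trans (bump_le_coord e0 i x)).
      rewrite /bump1 -[coord i x ^+ 2]real_normK ?num_real// div1r.
      rewrite lef_pV2 ?posrE//; last by rewrite ltr_pwDl// mulr_ge0 ?sqr_ge0.
      have h1 : 1 <= t * `|coord i x|.
        by rewrite -(mulfV (lt0r_neq0 t0)) ler_pM2l.
      rewrite -exprMn -[2](_ : 1 + 1 = _)// lerD2l.
      exact: exprn_ege1.
    by rewrite /h /eta; move: b2; clear -p1 wg mu0 K0 P0 B gap d0 d00; nra.
  move=> x; have /andP[h0 h1] := eta01 x.
  apply: (@le_trans _ _ (eta t x)); first by rewrite /h ler_piMl.
  have b01 (s : R) : 0 <= bump1 (t ^+ 2) s <= 1.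
    by rewrite (ltW (bump1_gt0 e0 s)) bump1_le1.
  have b_ge (s : R) : `|s| <= `|x| -> 1 - bump1 (t ^+ 2) s <= t ^+ 2 * `|x| ^+ 2.
    move=> sx; apply: (@le_trans _ _ (t ^+ 2 * s ^+ 2)).
      rewrite lerBlDr -lerBlDl /bump1.
      have den := bump1_den e0 s.
      rewrite -[X in _ <= X]div1r ler_pdivlMr//.
      move: (t ^+ 2 * s ^+ 2) => q; rewrite -subr_ge0.
      by rewrite (_ : 1 - _ = q ^+ 2) ?sqr_ge0//; ring.
    rewrite ler_pM2l// -norm2.
    by rewrite ler_pXn2r ?nnegrE.
  rewrite /eta /bump !big_ord_recl big_ord0 mulr1.
  set a := bump1 _ _; set b := bump1 _ _; set c := bump1 _ _.
  have Ha : 1 - a <= t ^+ 2 * `|x| ^+ 2 by apply: b_ge; exact: norm3_le.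
  have Hb : 1 - b <= t ^+ 2 * `|x| ^+ 2 by apply: b_ge; exact: norm3_le.
  have Hc : 1 - c <= t ^+ 2 * `|x| ^+ 2 by apply: b_ge; exact: norm3_le.
  have /andP[a0 a1] : 0 <= a <= 1 by exact: b01.
  have /andP[b0 b1] : 0 <= b <= 1 by exact: b01.
  have /andP[c0 c1] : 0 <= c <= 1 by exact: b01.
  rewrite -mulrA; move: (t ^+ 2 * _) Ha Hb Hc => q Ha Hb Hc.
  have : 1 - a * (b * c) = (1 - a) + a * (1 - b) + a * b * (1 - c) by ring.
  have : a * (1 - b) <= 1 - b by rewrite ler_piMl// subr_ge0.
  have : a * b * (1 - c) <= 1 - c by rewrite ler_piMl ?subr_ge0// mulr_ile1.
  by move: Ha Hb Hc; clear -p1 wg mu0 K0 P0 B gap d0 d00; lra.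
Qed.

(** Test the equation with eta^2 u. Far out, V - |u|^(p-1) >= d0 by the gap,
    because liminf g = 1; near the origin eta^2 is O(t^2); the gradient of
    eta^2 is O(t). So d0 times the integral of eta^2 u^2 is O(t), and eta is
    bounded below outside the cube of half-side 1 / t. The potential term is
    nonnegative and can be dropped. *)
Lemma tightness e : 0 < e -> exists2 N, 0 < N & forall lam u phi, sol lam u phi ->
  \int[m]_(x in ~` cube N) (u.1 x ^+ 2) <= e.
Proof.
move=> e0.
have [r0 far] := well_far wg (divr_gt0 d00 mu0).
pose r := `|r0|.
pose Kp := K `^ (p - 1).
have Kp0 : 0 <= Kp by exact: powR_ge0.
pose B' := `|B| + 1.
have B'0 : 0 < B' by rewrite ltr_wpDl.
pose W := 3 * (d0 + Kp) * r ^+ 2 + 4.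
have W0 : 0 < W.
  by rewrite ltr_wpDl// mulr_ge0 ?sqr_ge0// mulr_ge0// addr_ge0// ltW.
(* the error terms add up to at most t B' W *)
pose t := Num.min 1 (e * d0 / (4 * (B' * W))).
have t0 : 0 < t.
  rewrite lt_min ltr01/=; apply: divr_gt0; first exact: mulr_gt0 e0 d00.
  by rewrite pmulr_rgt0//; exact: mulr_gt0.
have t1 : t <= 1 by rewrite ge_min lexx.
have te : t <= e * d0 / (4 * (B' * W)) by rewrite ge_min lexx orbT.
exists t^-1; first by rewrite invr_gt0.
move=> lam u phi S.
have [sh eta01 dhb Ldh [hfar hnear]] := cutoff_props t0.
set h := (fun x => eta t x * eta t x) in sh dhb Ldh hfar hnear.
have h0 x : 0 <= h x by have /andP[? _] := eta01 x; rewrite mulr_ge0.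
have h1 x : h x <= 1 by have /andP[? ?] := eta01 x; rewrite mulr_ile1.
have nh x : `|h x| <= 1 by rewrite ger0_norm.
have mh := continuous_measurable3 (smooth_continuous sh).
have [[l0 Du mphi] uK aephi uB eqn] := S.
have Lu := sol_L2 S; have Lpu := sol_phi S; have Ln := L2_nl Lu uK.
have /(DVP wg mu0)[D12u _] := Du.
pose v := gmul h u.
have Lv : L2 m v.1.
  apply: (le_L2 _ _ Lu); first by apply: measurable_funM => //; exact: Lu.1.
  by move=> x; rewrite /v/= normrM ler_piMr.
have Dv : DV g mu v.
  apply/(DVP wg mu0); split => //.
  by apply: (D12_gmul sh nh _ dhb Ldh D12u); rewrite mulr_gt0.
have Ihu : intg m (fun x => h x * u.1 x ^+ 2).
  apply: (le_intg _ _ Lu.2).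
    by apply: measurable_funM => //; apply: measurable_funX; exact: Lu.1.
  move=> x; rewrite normrM (ger0_norm (h0 x)) (ger0_norm (sqr_ge0 _)).
  by apply: ler_piMl; [exact: sqr_ge0|exact: h1].
have Ig : intg m (fun x => \sum_(i < 3) u.2 i x ^+ 2).
  by apply: intg_sum => i; exact: (D12_grad_L2 i D12u).2.
(* T is the integrand of the equation tested with h u, Lw a lower bound of it;
   c2 u^2 pays for the ball of radius r, where V - |u|^(p-1) may be negative *)
pose T x := (gdot u v x + V x * u.1 x * v.1 x) + lam * (phi.1 x * u.1 x * v.1 x)
  - nl (u.1 x) * v.1 x.
pose c2 := (d0 + Kp) * (3 * t ^+ 2 * r ^+ 2).
pose Lw x := d0 * (h x * u.1 x ^+ 2) - (c2 + 3 * t) * u.1 x ^+ 2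
  - t * \sum_(i < 3) u.2 i x ^+ 2.
have Idv := intg_dv wg mu0 Du Dv.
have Iphi : intg m (fun x => lam * (phi.1 x * u.1 x * v.1 x)) by exact/intgZ/L2M.
have Inl : intg m (fun x => nl (u.1 x) * v.1 x) by exact: L2M.
have IT : intg m T by apply: intgB => //; exact: intgD.
have T0 : \int[m]_x T x = 0.
  rewrite -(eqn v Dv) /T IntB//; last exact: intgD.
  by rewrite IntD// IntZ//; exact: L2M.
have I1 := intgZ d0 Ihu; have I2 := intgZ (c2 + 3 * t) Lu.2; have I3 := intgZ t Ig.
have ILw : intg m Lw by apply: intgB => //; exact: intgB.
have LwE : \int[m]_x Lw x = d0 * \int[m]_x (h x * u.1 x ^+ 2)
    - (c2 + 3 * t) * sq u.1 - t * \sum_(i < 3) sq (u.2 i).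
  rewrite /Lw IntB//; last exact: intgB.
  rewrite IntB// !IntZ//; last exact: Lu.2.
  congr (_ - t * _); rewrite !big_ord_recl big_ord0 addr0.
  under eq_Rintegral do rewrite !big_ord_recl big_ord0 addr0.
  have I i := (D12_grad_L2 i D12u).2.
  by rewrite IntD ?IntD//; exact: intgD.
have lower : {ae m, forall x, Lw x <= T x}.
  move: uK aephi; apply: filterS2 => x ux /andP[phi0 _].
  have a0 := sqr_ge0 (u.1 x).
  have Kx : `|u.1 x| `^ (p - 1) <= Kp.
    apply: ge0_ler_powR; rewrite ?nnegrE//; first by rewrite subr_ge0 ltW.
    exact: ltW.
  have grad : - t * (\sum_(i < 3) u.2 i x ^+ 2) - 3 * t * u.1 x ^+ 2 <= gdot u v x.
    have -> : - t * (\sum_(i < 3) u.2 i x ^+ 2) - 3 * t * u.1 x ^+ 2 =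
        \sum_(i < 3) - (t * (u.2 i x ^+ 2 + u.1 x ^+ 2)).
      by rewrite !big_ord_recl !big_ord0; ring.
    rewrite /gdot; apply: ler_sum => i _; rewrite /v/=.
    have := dhb i x; have hx := h0 x; rewrite ler_norml => /andP[d1 d2].
    have q := mulr_ge0 hx (sqr_ge0 (u.2 i x)).
    apply: (le_trans (cross_term (u.2 i x) (u.1 x) t0 d1 d2)).
    by rewrite -subr_ge0 (_ : _ - _ = h x * u.2 i x ^+ 2) //; ring.
  have pot : d0 * (h x * u.1 x ^+ 2) - c2 * u.1 x ^+ 2 <=
      V x * u.1 x * v.1 x - nl (u.1 x) * v.1 x.
    have -> : V x * u.1 x * v.1 x - nl (u.1 x) * v.1 x =
        (V x - `|u.1 x| `^ (p - 1)) * (h x * u.1 x ^+ 2) by rewrite /v /nl /=; ring.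
    have q : 0 <= h x * u.1 x ^+ 2 by rewrite mulr_ge0.
    have c20 : 0 <= c2 * u.1 x ^+ 2.
      rewrite mulr_ge0// mulr_ge0 ?addr_ge0 ?(ltW d00)//.
      by rewrite mulr_ge0 ?sqr_ge0// mulr_ge0 ?sqr_ge0.
    have [xr|xr] := ltP r `|x|.
      apply: (@le_trans _ _ (d0 * (h x * u.1 x ^+ 2))); first by rewrite gerBl.
      rewrite ler_wpM2r//.
      have fx := far x (le_lt_trans (ler_norm r0) xr).
      have : mu * (1 - d0 / mu) <= mu * g x by rewrite ler_wpM2l// ltW.
      rewrite mulrBr mulr1 mulrCA divff ?gt_eqF// mulr1 => h3.
      by apply: (far_bound _ h3 Kx); rewrite /d0 -/Kp; field.
    have hx : h x <= 3 * t ^+ 2 * r ^+ 2.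
      have q0 : 0 <= 3 * t ^+ 2 by rewrite pmulr_rge0// sqr_ge0.
      apply: (le_trans (hnear x)); apply: (ler_wpM2l q0).
      apply: lerXn2r; rewrite ?nnegrE; [exact: normr_ge0|exact: normr_ge0|exact: xr].
    apply: (@le_trans _ _ (- Kp * (h x * u.1 x ^+ 2))).
      apply: near_bound; rewrite /c2 -mulrA.
      by rewrite ler_wpM2l ?addr_ge0 ?(ltW d00)//; exact: ler_wpM2r.
    rewrite ler_wpM2r// -subr_ge0 opprK addrAC subr_ge0.
    by rewrite (le_trans Kx)// lerDr (le_trans ler01)// Vpot_ge1.
  have phipos : 0 <= lam * (phi.1 x * u.1 x * v.1 x).
    have -> : phi.1 x * u.1 x * v.1 x = phi.1 x * (h x * u.1 x ^+ 2) by rewrite /v/=; ring.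
    by rewrite mulr_ge0 ?(ltW l0)// mulr_ge0// mulr_ge0.
  exact: (add_bounds grad pot phipos).
have bound : d0 * \int[m]_x (h x * u.1 x ^+ 2) <= t * (B' * W).
  have le0 : \int[m]_x Lw x <= 0 by rewrite -T0; exact: le_Int_ae.
  have su := sol_sq S.
  have sg : \sum_(i < 3) sq (u.2 i) <= B.
    apply: le_trans uB; apply: le_trans (dv_control wg mu0 Du).
    by rewrite lerDl sq_ge0.
  have B0 : 0 <= B by apply: le_trans su; exact: sq_ge0.
  have BB : B <= B' by rewrite /B' (le_trans (ler_norm _))// lerDl.
  have c20 : 0 <= c2 + 3 * t.
    apply: addr_ge0; last by rewrite pmulr_rge0// ltW.
    apply: mulr_ge0; first by apply: addr_ge0; [exact: ltW|].
    by apply: mulr_ge0; [rewrite pmulr_rge0// sqr_ge0|exact: sqr_ge0].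
  have c2t : c2 <= t * (3 * (d0 + Kp) * r ^+ 2).
    rewrite (_ : c2 = t ^+ 2 * (3 * (d0 + Kp) * r ^+ 2)); last by rewrite /c2; ring.
    apply: ler_wpM2r; last by rewrite expr2 ler_piMl// ltW.
    apply: mulr_ge0; last exact: sqr_ge0.
    by rewrite pmulr_rge0//; apply: addr_ge0; [exact: ltW|].
  have m1 : (c2 + 3 * t) * sq u.1 <= (c2 + 3 * t) * B' by rewrite ler_wpM2l// (le_trans su).
  have m2 : t * \sum_(i < 3) sq (u.2 i) <= t * B'.
    by rewrite ler_wpM2l ?(ltW t0)// (le_trans sg).
  have m3 : c2 * B' <= t * (3 * (d0 + Kp) * r ^+ 2) * B' by rewrite ler_wpM2r// ltW.
  rewrite LwE in le0; rewrite (_ : t * (B' * W) = t * (3 * (d0 + Kp) * r ^+ 2) * B' + 4 * t * B').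
    exact: (sum_bounds le0 m1 m2 m3).
  by rewrite /W; ring.
have mc : measurable (~` cube t^-1 : set (R3 R)) by apply: measurableC; exact: measurable_cube.
apply: (@le_trans _ _ (4 * \int[m]_x (h x * u.1 x ^+ 2))).
  rewrite -IntZ// Rintegral_mkcond; apply: le_Int.
  - rewrite /intg -restrict_EFin.
    exact: ((integrable_mkcond _ mc).1 (intg_setS mc Lu.2)).
  - exact: intgZ.
  - move=> x; rewrite patchE; case: ifPn => [/set_mem|_]; last first.
      by rewrite pmulr_rge0//; apply: mulr_ge0; [exact: h0|exact: sqr_ge0].
    move=> /cubeN[i /hfar h4]; rewrite mulrA ler_peMl ?sqr_ge0//.
    by rewrite -ler_pdivrMl// mulr1 -div1r.
have X0 : 0 < B' * W by exact: mulr_gt0.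
have tX : t * (B' * W) <= d0 * (e / 4).
  apply: (le_trans (ler_wpM2r (ltW X0) te)); rewrite le_eqVlt; apply/orP; left.
  by apply/eqP; field; rewrite !gt_eqF.
by have := le_trans bound tX; rewrite (ler_pM2l d00) [4 * _]mulrC -ler_pdivlMr.
Qed.

End solutions.

(** * Limits of solutions *)

Lemma energy_arith (R : realType) (a L c k q : R) : a + L - c = 0 -> c <= k ->
  0 <= q -> 0 <= a -> 0 <= L -> 2^-1 * a + L / 4 - q <= k.
Proof. lra. Qed.

Lemma subtract_equations (R : realType) (a a0 c d d0 : R) : a + c - d = 0 ->
  a0 - d0 = - (a - a0) - c + (d - d0).
Proof. lra. Qed.

Lemma cvg_sum3 (R : realType) (f : 'I_3 -> nat -> R) (a : 'I_3 -> R) :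
  (forall i, f i n @[n --> \oo] --> a i) ->
  \sum_(i < 3) f i n @[n --> \oo] --> \sum_(i < 3) a i.
Proof.
move=> h; rewrite !big_ord_recl big_ord0.
under eq_fun do rewrite !big_ord_recl big_ord0.
by repeat (apply: cvgD; first exact: h); exact: cvg_cst.
Qed.

Section limits_of_solutions.
Context (R : realType) (p : R) (g : R3 R -> R) (mu K P B : R).
Hypotheses (p1 : 1 < p) (wg : well g) (mu0 : 0 < mu) (K0 : 0 < K) (P0 : 0 <= P).
Local Notation m := (leb3 R).
Local Notation sq := (sq m).
Local Notation V := (Vpot g mu).
Local Notation dv := (dv g mu).
Local Notation nl := (nl p).
Local Notation sol := (sol p g mu K P B).
Hypothesis gap : K `^ (p - 1) < 1 + mu.

(** Testing the equation with u expresses |u|_{p+1}^{p+1} as the sum of the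
    two nonnegative quadratic and potential terms, which dominates the energy;
    and |u|^(p+1) <= K^(p-1) u^2. *)
Lemma energy_le lam u phi : sol lam u phi ->
  energy p g mu lam u phi <= K `^ (p - 1) * sq u.1.
Proof.
move=> S; have [[l0 Du mphi] uK aephi uB eqn] := S.
have E := eqn u Du.
have Lu := sol_L2 wg mu0 S; have Lpu := sol_phi wg mu0 S.
have Ln := L2_nl p1 Lu uK.
have nE : \int[m]_x (nl (u.1 x) * u.1 x) <= K `^ (p - 1) * sq u.1.
  rewrite -IntZ; last exact: Lu.2.
  apply: le_Int_ae; [exact: L2M|exact: intgZ Lu.2|].
  apply: filterS uK => x ux.
  rewrite (le_trans (ler_norm _))// normrM -[X in _ <= _ * X]real_normK ?num_real//.
  by rewrite expr2 mulrA ler_wpM2r// nl_bound.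
have phi0 : 0 <= \int[m]_x (phi.1 x * u.1 x * u.1 x).
  rewrite (_ : 0 = \int[m]_x (0 : R)); last first.
    by rewrite /Rintegral integral0.
  apply: le_Int_ae; [exact: intg0|exact: L2M|].
  by apply: filterS aephi => x /andP[h _]; rewrite -mulrA mulr_ge0// -expr2 sqr_ge0.
have pw : 0 <= (p + 1)^-1 * \int[m]_x (`|u.1 x| `^ (p + 1)).
  rewrite mulr_ge0//; last by apply: Int_ge0 => x; exact: powR_ge0.
  by rewrite invr_ge0 addr_ge0// (le_trans ler01)// ltW.
have d0 := dv_ge0 wg mu0 u.
have J0 : 0 <= lam * \int[m]_x (phi.1 x * u.1 x * u.1 x) by rewrite mulr_ge0// ltW.
rewrite /energy.
have -> : \int[m]_x (gdot u u x + V x * u.1 x ^+ 2) = dv u u.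
  by apply: eq_Rintegral => x _; congr (_ + _); ring.
have -> : \int[m]_x (phi.1 x * u.1 x ^+ 2) = \int[m]_x (phi.1 x * u.1 x * u.1 x).
  by apply: eq_Rintegral => x _; ring.
rewrite [lam / 4 * _]mulrAC; exact: (energy_arith E nE pw d0 J0).
Qed.

(** Truncation to [-K, K]. An L^2 limit of functions bounded by K is bounded
    by K almost everywhere; its truncation is so everywhere, and it is no
    farther from these functions. *)
Definition clamp (s : R) : R := Num.max (- K) (Num.min K s).

Lemma clamp_bound s : `|clamp s| <= K.
Proof.
rewrite /clamp ler_norml le_max lexx/= ge_max ge_min lexx/= andbT.
by rewrite (le_trans _ (ltW K0))// oppr_le0 ltW.
Qed.

Lemma clamp_contract a s : `|a| <= K -> `|a - clamp s| <= `|a - s|.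
Proof.
rewrite ler_norml => /andP[h1 h2]; rewrite /clamp.
case: (leP K s) => Ks.
  rewrite max_r; last by rewrite (le_trans _ (ltW K0))// oppr_le0 ltW.
  by rewrite ler0_norm ?subr_le0// ler0_norm ?subr_le0 ?(le_trans h2)//; lra.
case: (leP (- K) s) => Ks'.
  by rewrite lexx.
by rewrite ger0_norm ?subr_ge0// ger0_norm ?subr_ge0 ?(le_trans (ltW Ks'))//; lra.
Qed.

Lemma measurable_clamp f : measurable_fun setT f ->
  measurable_fun setT (fun x : R3 R => clamp (f x)).
Proof.
by move=> mf; apply: measurable_maxr => //; exact: measurable_minr.
Qed.

Lemma dv_upper : exists2 G, 0 <= G & forall w, DV g mu w ->
  dv w w <= \sum_(i < 3) sq (w.2 i) + G * sq w.1.
Proof.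
have [G G0 VG] := Vpot_bounded wg mu0; exists G => // w Dw.
rewrite (dvE wg mu0)//; have /(DVP wg mu0)[_ Lw] := Dw; apply: lerD.
  by apply: ler_sum => i _; under eq_Rintegral do rewrite -expr2.
rewrite -IntZ; last exact: Lw.2.
apply: le_Int_ae; [exact: intg_pot|exact: intgZ Lw.2|].
apply: filterS VG => x Vx; rewrite -mulrA -expr2 ler_wpM2r ?sqr_ge0//.
by rewrite (le_trans (ler_norm _)).
Qed.

Section sequence.
Variables (l : nat -> R) (v phi : nat -> gfun R).
Hypothesis S : forall n, sol (l n) (v n) (phi n).
Hypothesis l0 : l n @[n --> \oo] --> 0.
Hypothesis fast : forall n, dv (v n.+1 - v n) (v n.+1 - v n) <= 4 ^- n.

Let Dv n : DV g mu (v n). Proof. by have [[]] := S n. Qed.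
Let D12v n : D12 (v n). Proof. by have /(DVP wg mu0)[] := Dv n. Qed.
Let Lv n : L2 m (v n).1. Proof. by have /(DVP wg mu0)[] := Dv n. Qed.

(** Completeness of L^2, for the functions and their partial derivatives. The
    differences are bounded by 2 K, so convergence in L^2 implies convergence
    in L^6 and the limit is in D^{1,2} by [D12_closed]. *)
Lemma limit_exists : exists u0 : gfun R,
  [/\ DV g mu u0, forall x, `|u0.1 x| <= K,
   sq (v n - u0).1 @[n --> \oo] --> 0 &
   forall i, sq ((v n - u0).2 i) @[n --> \oo] --> 0].
Proof.
have [w1 [Lw1 cw1]] : exists w, L2 m w /\ sq (fun x => (v n).1 x - w x) @[n --> \oo] --> 0.
  apply: L2_complete => n; first exact: Lv.
  apply: le_trans (fast n).
  exact: (dv_control1 wg mu0 (DVB wg mu0 (Dv n.+1) (Dv n))).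
have gradlim i : exists w, L2 m w /\
    sq (fun x => (v n).2 i x - w x) @[n --> \oo] --> 0.
  apply: L2_complete => n; first exact: D12_grad_L2.
  apply: le_trans (fast n).
  exact: (dv_control2 wg mu0 i (DVB wg mu0 (Dv n.+1) (Dv n))).
have {gradlim}[w2 hw2] := choice gradlim.
pose u0 : gfun R := (fun x => clamp (w1 x), w2).
have mu1 : measurable_fun setT u0.1 by apply: measurable_clamp; exact: Lw1.1.
have Ld n : L2 m (fun x => (v n).1 x - w1 x) by exact: L2B.
have contr n : {ae m, forall x, `|(v n).1 x - u0.1 x| <= `|(v n).1 x - w1 x|}.
  have [_ aeK _ _ _] := S n; apply: filterS aeK => x; exact: clamp_contract.
have Lc n : L2 m (fun x => (v n).1 x - u0.1 x).
  by apply: (le_L2_ae _ (contr n) (Ld n)); apply: measurable_funB => //; exact: (Lv n).1.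
have le1 n : sq (fun x => (v n).1 x - u0.1 x) <= sq (fun x => (v n).1 x - w1 x).
  apply: le_Int_ae; [exact: (Lc n).2|exact: (Ld n).2|].
  apply: filterS (contr n) => x h.
  by rewrite -[leLHS]real_normK ?num_real// -[leRHS]real_normK ?num_real// lerXn2r ?nnegrE.
have c1 : sq (v n - u0).1 @[n --> \oo] --> 0.
  apply: (@squeeze_cvgr _ _ _ _ (fun=> 0) (fun n => sq (fun x => (v n).1 x - w1 x))).
  - by apply: nearW => n; rewrite sq_ge0 le1.
  - exact: cvg_cst.
  - exact: cw1.
have Lu0 : L2 m u0.1.
  have [_ I] := L2B (Lv 0%N) (Lc 0%N); split => //.
  by apply: intg_eq I => x; congr (_ ^+ 2); ring.
have D12u0 : D12 u0.
  apply: D12_closed => //; first by move=> i; exact: (hw2 i).1.1.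
  move=> e e0.
  pose C := (2 * K) ^+ 4 + 1.
  have C0 : 0 < C by rewrite ltr_wpDl// exprn_ge0// mulr_ge0// ltW.
  have ev1 : \forall n \near \oo, sq (fun x => (v n).1 x - u0.1 x) <= e / C.
    by apply: (cvgr_le _ c1); rewrite divr_gt0.
  have ev2 : \forall n \near \oo, forall i : 'I_3, sq (fun x => (v n).2 i x - w2 i x) <= e.
    by apply: filter_forall => i; apply: (cvgr_le _ (hw2 i).2).
  have [n [n1 n2]] := filter_ex (filterI ev1 ev2).
  exists (v n).
  have pw : {ae m, forall x, `|((v n).1 x - u0.1 x) ^+ 6| <= C * ((v n).1 x - u0.1 x) ^+ 2}.
    have [_ aeK _ _ _] := S n; apply: filterS aeK => x hx.
    rewrite ger0_norm ?pow6_ge0//.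
    have b2 : `|(v n).1 x - u0.1 x| <= 2 * K.
      rewrite (le_trans (ler_normB _ _))// mulr_natl mulr2n lerD//.
      exact: clamp_bound.
    rewrite (_ : _ ^+ 6 = ((v n).1 x - u0.1 x) ^+ 4 * ((v n).1 x - u0.1 x) ^+ 2); last by ring.
    rewrite ler_wpM2r ?sqr_ge0//.
    apply: (@le_trans _ _ ((2 * K) ^+ 4)); last by rewrite lerDl.
    have -> : ((v n).1 x - u0.1 x) ^+ 4 = `|(v n).1 x - u0.1 x| ^+ 4.
      by rewrite -normrX ger0_norm// exprn_even_ge0.
    by apply: lerXn2r; rewrite ?nnegrE// mulr_ge0// ltW.
  have I2 := intgZ C (Lc n).2.
  have I6 : intg m (fun x => ((v n).1 x - u0.1 x) ^+ 6).
    by apply: (le_intg_ae _ pw I2); apply: measurable_funX; exact: (Lc n).1.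
  split => //.
  - apply: (@le_trans _ _ (C * sq (fun x => (v n).1 x - u0.1 x))).
      rewrite -IntZ; last exact: (Lc n).2.
      apply: le_Int_ae => //; apply: filterS pw => x; apply: le_trans; exact: ler_norm.
    by rewrite -ler_pdivlMl// mulrC.
  - move=> i; split; last exact: n2.
    by apply: L2B; [exact: D12_grad_L2|exact: (hw2 i).1].
exists u0; split=> //; first by apply/(DVP wg mu0).
- by move=> x; exact: clamp_bound.
- by move=> i; exact: (hw2 i).2.
Qed.

Lemma cvg_sqrt_sq (f : nat -> R) : f n @[n --> \oo] --> 0 ->
  Num.sqrt (f n) @[n --> \oo] --> 0.
Proof.
by move=> cf; rewrite -[X in _ --> X]sqrtr0; apply: continuous_cvg => //; exact: sqrt_continuous.
Qed.

Lemma limit_norm u0 : DV g mu u0 -> sq (v n - u0).1 @[n --> \oo] --> 0 ->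
  (forall i, sq ((v n - u0).2 i) @[n --> \oo] --> 0) ->
  DV_norm g mu (v n - u0) @[n --> \oo] --> 0.
Proof.
move=> Du0 c1 c2; under eq_fun do rewrite DV_normE; apply: cvg_sqrt_sq.
have [G G0 HG] := dv_upper.
apply: (@squeeze_cvgr _ _ _ _ (fun=> 0)
  (fun n => \sum_(i < 3) sq ((v n - u0).2 i) + G * sq (v n - u0).1)).
- by apply: nearW => n; rewrite dv_ge0//= HG//; exact: DVB.
- exact: cvg_cst.
- have z0 : (\sum_(i < 3) 0) + G * 0 = 0 :> R by rewrite big1// mulr0 addr0.
  rewrite -[X in _ --> X]z0.
  apply: cvgD; last by apply: cvgM => //; exact: cvg_cst.
  by apply: cvg_sum3 => i; exact: c2.
Qed.

(** The equation of v n differs from that of u0 by at most b n, which tends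
    to 0: Cauchy-Schwarz for the linear terms, l n times a bounded quantity for
    the potential, and the Lipschitz bound for the nonlinearity. *)
Lemma limit_weak_solution u0 : DV g mu u0 -> (forall x, `|u0.1 x| <= K) ->
  sq (v n - u0).1 @[n --> \oo] --> 0 ->
  (forall i, sq ((v n - u0).2 i) @[n --> \oo] --> 0) ->
  weak_solution0 p g mu u0.
Proof.
move=> Du0 u0K c1 c2; split => // z Dz.
have /(DVP wg mu0)[D12z Lz] := Dz; have /(DVP wg mu0)[D12u0 Lu0] := Du0.
have LVz := L2_Vpot wg mu0 Lz.
have Ln0 := L2_nl p1 Lu0 (aeW _ u0K).
pose Lp := p * K `^ (p - 1).
pose b n := (\sum_(i < 3) Num.sqrt (sq ((v n - u0).2 i)) * Num.sqrt (sq (z.2 i))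
    + Num.sqrt (sq (v n - u0).1) * Num.sqrt (sq (fun x => V x * z.1 x)))
    + l n * (P * (B + sq z.1))
    + Lp * (Num.sqrt (sq (v n - u0).1) * Num.sqrt (sq z.1)).
have cb : b n @[n --> \oo] --> 0.
  have z0 : ((\sum_(i < 3) 0 * Num.sqrt (sq (z.2 i)))
    + 0 * Num.sqrt (sq (fun x => V x * z.1 x)))
    + 0 * (P * (B + sq z.1)) + Lp * (0 * Num.sqrt (sq z.1)) = 0.
    by rewrite big1 => [|i _]; rewrite ?mul0r ?mulr0 ?addr0.
  rewrite -[X in _ --> X]z0.
  have c1' := cvg_sqrt_sq c1.
  apply: cvgD; last first.
    by apply: cvgM; [exact: cvg_cst|apply: cvgM => //; exact: cvg_cst].
  apply: cvgD; last by apply: cvgM => //; exact: cvg_cst.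
  apply: cvgD; last by apply: cvgM => //; exact: cvg_cst.
  apply: cvg_sum3 => i; apply: cvgM; last exact: cvg_cst.
  by apply: cvg_sqrt_sq; exact: c2.
apply/eqP; rewrite -subr_eq0 -normr_le0; apply: (cvgr_to_ge cb).
apply: nearW => n.
have [[ln0 _ _] vK _ vB eqn] := S n.
have E := eqn z Dz.
have Dd : DV g mu (v n - u0) by exact: DVB.
have E1 := dvB wg mu0 (Dv n) Du0 Dz.
have B1 := dv_bound wg mu0 Dd Dz.
have B2 := sol_phi_bound wg mu0 P0 (S n) Lz.
have Lnn := L2_nl p1 (Lv n) vK.
have /(DVP wg mu0)[_ Ldn] := Dd.
have B3 : `|\int[m]_x (nl ((v n).1 x) * z.1 x) - \int[m]_x (nl (u0.1 x) * z.1 x)| <=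
   Lp * (Num.sqrt (sq (v n - u0).1) * Num.sqrt (sq z.1)).
  rewrite -IntB; [|exact: L2M|exact: L2M].
  have -> : \int[m]_x (nl ((v n).1 x) * z.1 x - nl (u0.1 x) * z.1 x) =
      \int[m]_x ((nl ((v n).1 x) - nl (u0.1 x)) * z.1 x).
    by apply: eq_Rintegral => x _; rewrite mulrBl.
  have Lp0 : 0 <= Lp by rewrite mulr_ge0 ?powR_ge0// ltW// (lt_trans ltr01).
  apply: (le_trans (norm_IntM (L2B Lnn Ln0) Lz)); rewrite mulrA ler_wpM2r ?sqrtr_ge0//.
  have LE : Lp = Num.sqrt (Lp ^+ 2) by rewrite sqrtr_sqr ger0_norm.
  rewrite [X in X * _]LE.
  rewrite -sqrtrM ?sqr_ge0//; apply: ler_wsqrtr.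
  rewrite -IntZ; last exact: Ldn.2.
  apply: le_Int_ae; [exact: (L2B Lnn Ln0).2|exact: intgZ Ldn.2|].
  apply: filterS vK => x vx; rewrite -exprMn -[leLHS]real_normK ?num_real//.
  rewrite -[leRHS]real_normK ?num_real//; apply: lerXn2r; rewrite ?nnegrE//.
  rewrite normrM (ger0_norm Lp0); exact: nl_lipschitz.
have B2' : `|l n * \int[m]_x ((phi n).1 x * (v n).1 x * z.1 x)| <= l n * (P * (B + sq z.1)).
  rewrite normrM (gtr0_norm ln0) ler_pM2l//; apply: (le_trans B2).
  by rewrite ler_wpM2l// lerD2r; exact: (sol_sq wg mu0 (S n)).
rewrite -/(dv u0 z).
have -> : dv u0 z - \int[m]_x (`|u0.1 x| `^ (p - 1) * u0.1 x * z.1 x) =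
    - dv (v n - u0) z - l n * \int[m]_x ((phi n).1 x * (v n).1 x * z.1 x)
    + (\int[m]_x (nl ((v n).1 x) * z.1 x) - \int[m]_x (nl (u0.1 x) * z.1 x)).
  rewrite E1; exact: (subtract_equations _ _ E).
rewrite /b; apply: (le_trans (ler_normD _ _)); apply: lerD => //.
by apply: (le_trans (ler_normB _ _)); rewrite normrN; apply: lerD.
Qed.

(** If u0 vanished, the norms |v n|_2 would tend to 0, and with them the
    energies by [energy_le]. *)
Lemma limit_nontrivial u0 alpha : DV g mu u0 -> 0 < alpha ->
  (forall n, alpha <= energy p g mu (l n) (v n) (phi n)) ->
  sq (v n - u0).1 @[n --> \oo] --> 0 -> nontrivial u0.
Proof.
move=> Du0 alpha0 ha c1 triv.
have /(DVP wg mu0)[_ Lu0] := Du0.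
have sE n : sq (v n - u0).1 = sq (v n).1.
  apply: Int_ae.
  - by apply: measurable_funX; exact: (L2B (Lv n) Lu0).1.
  - by apply: measurable_funX; exact: (Lv n).1.
  - by apply: filterS triv => x h; rewrite /= !fctE h subr0.
have cv : K `^ (p - 1) * sq (v n).1 @[n --> \oo] --> K `^ (p - 1) * 0.
  apply: cvgM; first exact: cvg_cst.
  by under eq_cvg do rewrite -sE.
have := cvgr_to_ge cv; rewrite mulr0 => /(_ _ alpha).
have h : \forall n \near \oo, alpha <= K `^ (p - 1) * sq (v n).1.
  by apply: nearW => n; apply: le_trans (ha n) (energy_le (S n)).
by move=> /(_ h); rewrite leNgt alpha0.
Qed.

End sequence.

End limits_of_solutions.

(** * Convergence as lambda tends to 0 *)

(** Monotonicity of M0, M1 and M turns bounds at lam into bounds at l1. *)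
Lemma bounded_solution_sol (R : realType) (p : R) (g : R3 R -> R)
    (M0 M1 M : R -> R) (alpha : R) (c : R -> R) (mu l1 lam : R) (u : gfun R) :
  well g -> 0 < mu ->
  pos_nondecreasing M0 -> pos_nondecreasing M1 -> pos_nondecreasing M ->
  0 < lam <= l1 -> bounded_solution p g M0 M1 M alpha c mu lam u ->
  exists phi, sol p g mu (M0 l1) (M1 l1) (M l1 ^+ 2) lam u phi /\
    alpha <= energy p g mu lam u phi.
Proof.
move=> wg mu0 [_ mon0] [_ mon1] [_ mon] /andP[lam0 lam1].
move=> [phi [[[Du [D12phi _] eqn] _] uK phiP nuM /andP[aE _]]].
exists phi; split=> //; split.
- by split=> //; have [] := D12phi.
- by apply: filterS uK => x h; exact: le_trans h (mon0 _ _ lam0 lam1).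
- apply: filterS phiP => x /andP[h0 h1].
  by rewrite (ltW h0) (le_trans h1)//; exact: mon1.
- have h : Num.sqrt (dv g mu u u) <= M l1.
    rewrite -DV_normE; apply: le_trans (mon _ _ lam0 lam1); apply: le_trans nuM.
    by rewrite lerDl sqrtr_ge0.
  rewrite -(sqr_sqrtr (dv_ge0 wg mu0 u)); apply: lerXn2r => //; rewrite nnegrE.
    exact: sqrtr_ge0.
  by apply: le_trans h; exact: sqrtr_ge0.
- by move=> v Dv; exact: eqn.
Qed.

Section compactness.
Context (R : realType) (p : R) (g : R3 R -> R) (mu K P B l1 : R).
Hypotheses (p1 : 1 < p) (wg : well g) (mu0 : 0 < mu) (K0 : 0 < K) (P0 : 0 <= P).
Hypotheses (gap : K `^ (p - 1) < 1 + mu) (l10 : 0 < l1).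
Local Notation dv := (dv g mu).
Variables (u phi : R -> gfun R).
Hypothesis S : forall lam, 0 < lam <= l1 ->
  sol p g mu K P B lam (u lam) (phi lam).

(** Along an ultrafilter finer than the right neighborhoods of 0, the solutions
    are Cauchy in L^2 by [rellich], hence in D_V by [cauchy_estimate]. A fast
    sequence is then picked, its n-th term in the first n+1 sets of a family
    on which the distances are at most 4^-k. *)
Lemma cauchy_subsequence : exists l : nat -> R,
  [/\ forall n, 0 < l n <= l1, l n @[n --> \oo] --> 0 &
   forall n, dv (u (l n.+1) - u (l n)) (u (l n.+1) - u (l n)) <= 4 ^- n].
Proof.
have [F [UF sF]] : exists F : set_system R, UltraFilter F /\ (0 : R)^'+ `<=` F.
  exact: ultraFilterLemma.
have FF : ProperFilter F by exact: ultra_proper.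
have Fsmall e : 0 < e -> F [set lam | 0 < lam <= e].
  move=> e0; apply: sF; have h1 := nbhs_right_gt (0 : R).
  have h2 := nbhs_right_le e0.
  by apply: filterS2 h1 h2 => x /= -> ->.
pose D := [set lam : R | 0 < lam <= l1].
have B0 : 0 <= B.
  have l1l1 : 0 < l1 <= l1 by rewrite l10 lexx.
  by have [_ _ _ + _] := S l1l1; apply: le_trans; exact: dv_ge0.
have bd lam : D lam -> [/\ D12 (u lam), L2 (leb3 R) (u lam).1,
     {ae leb3 R, forall x, `|(u lam).1 x| <= K}, sq (leb3 R) (u lam).1 <= B &
     forall i, sq (leb3 R) ((u lam).2 i) <= B].
  move=> /S Sl; have [[_ Du _] uK _ uB _] := Sl.
  have /(DVP wg mu0)[D12u Lu] := Du; split => //; first exact: (sol_sq wg mu0 Sl).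
  by move=> i; exact: le_trans (dv_control2 wg mu0 i Du) uB.
have tight e : 0 < e -> exists2 N, 0 < N & forall lam, D lam ->
     \int[leb3 R]_(x in ~` cube N) ((u lam).1 x ^+ 2) <= e.
  move=> /(tightness P B p1 wg mu0 K0 gap)[N N0 hN]; exists N => // lam /S.
  exact: hN.
have Cauchy e : 0 < e -> exists A, F A /\
    forall lam lam', A lam -> A lam' -> dv (u lam - u lam') (u lam - u lam') <= e.
  move=> e0; pose Lp := p * K `^ (p - 1).
  have Lp0 : 0 < Lp by rewrite mulr_gt0 ?powR_gt0// (lt_trans ltr01).
  have [A [FA AD hA]] := rellich UF (Fsmall _ l10) bd tight
    (divr_gt0 e0 (mulr_gt0 (ltr0n R 2) Lp0)).
  pose Q := P * (5 * B) + 1.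
  have Q1 : P * (5 * B) <= Q by rewrite lerDl.
  have Q0 : 0 < Q by rewrite ltr_wpDl// mulr_ge0// mulr_ge0.
  have es : 0 < e / (4 * Q) by rewrite divr_gt0// mulr_gt0.
  exists (A `&` [set lam | 0 < lam <= e / (4 * Q)]); split.
    by apply: filterI => //; exact: Fsmall.
  move=> lam lam' [Al /andP[l0 le]] [Al' /andP[l0' le']].
  apply: (le_trans (cauchy_estimate p1 wg mu0 P0 (S (AD _ Al)) (S (AD _ Al')))).
  rewrite [leRHS]splitr; apply: lerD.
    rewrite -[p * _]/Lp; apply: (le_trans (ler_wpM2l (ltW Lp0) (hA _ _ Al Al'))).
    by rewrite le_eqVlt; apply/orP; left; apply/eqP; field; rewrite gt_eqF.
  apply: (@le_trans _ _ ((lam + lam') * Q)).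
    by rewrite ler_wpM2l// addr_ge0// ltW.
  apply: (@le_trans _ _ ((e / (4 * Q) + e / (4 * Q)) * Q)).
    by rewrite ler_pM2r// lerD.
  by rewrite le_eqVlt; apply/orP; left; apply/eqP; field; rewrite gt_eqF.
have e4 n : 0 < 4 ^- n :> R by rewrite invr_gt0 exprn_gt0.
have [A hA] := choice (fun n => Cauchy _ (e4 n)).
have pick n : exists lam, [/\ 0 < lam <= l1, lam <= n.+1%:R^-1 &
    forall k : 'I_n.+1, A k lam].
  have i0 : 0 < n.+1%:R^-1 :> R by rewrite invr_gt0 ltr0n.
  have hk : F [set lam | forall k : 'I_n.+1, A k lam].
    by apply: filter_forall => k; have [] := hA k.
  have [lam [[h1 /andP[_ h2]] h3]] :=
    filter_ex (filterI (filterI (Fsmall _ l10) (Fsmall _ i0)) hk).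
  by exists lam.
have [l hl] := choice pick.
exists l; split.
- by move=> n; have [] := hl n.
- apply: (@squeeze_cvgr _ _ _ _ (fun=> 0) (fun n => n.+1%:R^-1)).
  + by apply: nearW => n; have [/andP[/ltW -> _] -> _] := hl n.
  + exact: cvg_cst.
  + exact: cvg_harmonic.
- move=> n; have [_ _ h1] := hl n; have [_ _ h2] := hl n.+1.
  have [_] := hA n; apply; first exact: (h2 (widen_ord (leqnSn n.+1) ord_max)).
  exact: (h1 ord_max).
Qed.

End compactness.

Theorem theorem1p3 (R : realType) (p : R) (g : R3 R -> R)
  (M0 M1 M : R -> R) (alpha : R) (c : R -> R)
  (mu lbar : R) (u : R -> gfun R)
  (hp : 3 <= p < 5) (hg : well g)
  (hE2 : existence p g M0 M1 M alpha c)
  (hlbar : 0 < lbar)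
  (hmu : forall lam, 0 < lam < lbar -> mu2 p M0 lam < mu)
  (hu : forall lam, 0 < lam < lbar ->
          bounded_solution p g M0 M1 M alpha c mu lam (u lam)) :
  exists u0 : gfun R,
    [/\ weak_solution0 p g mu u0, nontrivial u0 &
        exists l : nat -> R,
          [/\ forall n, 0 < l n < lbar,
              l n @[n --> \oo] --> 0 &
              DV_norm g mu (u (l n) - u0) @[n --> \oo] --> 0]].
Proof.
have [m0 [m1 mM] alpha0 _ _] := hE2.
pose l1 := lbar / 2.
have l10 : 0 < l1 by rewrite divr_gt0.
have l1b : l1 < lbar by rewrite ltr_pdivrMr// mulr_natr mulr2n ltrDl.
have p1 : 1 < p by case/andP: hp => p3 _; apply: lt_le_trans p3; rewrite ltr1n.
have hmu1 : mu2 p M0 l1 < mu by apply: hmu; rewrite l10.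
have mu0 : 0 < mu by apply: le_lt_trans hmu1; rewrite /mu2 le_max lexx.
have gap : M0 l1 `^ (p - 1) < 1 + mu.
  by rewrite -ltrBlDl; apply: le_lt_trans hmu1; rewrite /mu2 le_max lexx orbT.
have K0 : 0 < M0 l1 by case: m0 => h _; exact: h.
have P0 : 0 <= M1 l1 by case: m1 => h _; rewrite ltW// h.
have sols lam : exists phi, 0 < lam <= l1 ->
    sol p g mu (M0 l1) (M1 l1) (M l1 ^+ 2) lam (u lam) phi /\
    alpha <= energy p g mu lam (u lam) phi.
  have [hl|] := boolP (0 < lam <= l1); last by exists 0.
  have hb : 0 < lam < lbar by case/andP: hl => -> /le_lt_trans; exact.
  have [phi hphi] := bounded_solution_sol hg mu0 m0 m1 mM hl (hu lam hb).
  by exists phi.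
have [phi hphi] := choice sols.
have [l [ll lc lf]] := cauchy_subsequence p1 hg mu0 K0 P0 gap l10
  (fun lam h => (hphi lam h).1).
have Sn n := (hphi _ (ll n)).1; have En n := (hphi _ (ll n)).2.
have [u0 [Du0 u0K c1 c2]] := limit_exists hg mu0 K0 Sn lf.
exists u0; split.
- exact: (limit_weak_solution p1 hg mu0 P0 Sn lc Du0 u0K c1 c2).
- exact: (limit_nontrivial p1 hg mu0 Sn Du0 alpha0 En c1).
exists l; split=> //; last exact: (limit_norm hg mu0 Sn Du0 c1 c2).
by move=> n; case/andP: (ll n) => -> /le_lt_trans; exact.
Qed.
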